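(* Let $X\subseteq 2^\omega$, regarded as a metric subspace of the Cantor cube. Then: (a) $X$ is $\mathcal P$-null if and only if $X$ is $\mathcal N$-additive; (b) $X$ is $\vec{\mathcal P}$-null if and only if $X$ is a $(\mathrm T')$-set; (c) $X$ is $\overline{\mathcal H}$-null if and only if $X$ is $\mathcal M$-additive, and $X$ is $\mathcal M$-additive if and only if $X$ is $\mathcal E$-additive; (d) $X$ is $\mathcal H$-null if and only if $X$ is strongly null. Moreover the following implications hold: $X$ is $\mathcal P$-null $\Rightarrow$ $X$ is $\vec{\mathcal P}$-null $\Rightarrow$ $X$ is $\overline{\mathcal H}$-null $\Rightarrow$ $X$ is $\mathcal H$-null; equivalently, $X$ is $\mathcal N$-additive $\Rightarrow$ $X$ is a $(\mathrm T')$-set $\Rightarrow$ $X$ is $\mathcal M$-additive $\Rightarrow$ $X$ is strongly null.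
   Context: **Cantor cube.** $2^\omega$ is the set of $0$-$1$ sequences, a compact group under coordinatewise addition mod 2, with metric $d(x,y)=2^{-n(x,y)}$ for $x\ne y$, where $n(x,y)=\min\{i:x(i)\neq y(i)\}$. $\mu$ is its Haar (= usual product) measure. $\mathcal M$ is the ideal of meager sets in $2^\omega$, $\mathcal N$ the ideal of $\mu$-null sets, $\mathcal E$ the $\sigma$-ideal generated by closed $\mu$-null sets (equivalently by $\mu$-null $F_\sigma$-sets). $A+B=\{a+b:a\in A,b\in B\}$. For an ideal $\mathcal J$ on $2^\omega$, $X$ is $\mathcal J$-additive if $X+J\in\mathcal J$ for every $J\in\mathcal J$. $X$ is strongly null if there is no $M\in\mathcal M$ with $X+M=2^\omega$. **$(\mathrm T')$-sets.** $\omega^{\uparrow\omega}$ denotes the set of nondecreasing unbounded sequences of natural numbers. $X\subseteq 2^\omega$ is a $(\mathrm T')$-set if there is $g\in\omega^\omega$ such that for each $f\in\omega^{\uparrow\omega}$ there are an infinite $I\subseteq\omega$ and a sequence $\langle H_n:n\in I\rangle$ such that for all $n\in I$: $H_n\subseteq 2^{[f(n),f(n+1))}$ and $|H_n|\le g(n)$; and for each $x\in X$, $x\restriction[f(n),f(n+1))\in H_n$ for all but finitely many $n\in I$. **Dimensions.** For a metric space $X$, $\dim_H X$ is Hausdorff dimension. With $X^\star$ the completion of $X$, the upper Hausdorff dimension is $\overline{\dim}_H X=\inf\{\dim_H K: K\ \sigma\text{-compact},\ X\subseteq K\subseteq X^\star\}$ ($\inf\emptyset=\infty$). $N_X(\delta)$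 is the minimal number of sets of diameter at most $\delta$ needed to cover $X$ ($\infty$ if no finite number suffices); $\overline{\dim}_B X=\limsup_{\delta\to0}\frac{\log N_X(\delta)}{|\log\delta|}$, $\underline{\dim}_B X=\liminf_{\delta\to0}\frac{\log N_X(\delta)}{|\log\delta|}$ (both $0$ for the empty set). The upper packing dimension is $\overline{\dim}_P X=\inf\{\sup_n\overline{\dim}_B X_n\}$ over all countable covers $\{X_n\}$ of $X$; the directed lower packing dimension is $\vec{\dim}_P X=\inf\{\sup_n\underline{\dim}_B X_n\}$ over all increasing sequences $(X_n)_{n\in\omega}$ of sets with union $X$. **Null notions.** A separable metric space $X$ is $\mathcal H$-null (resp. $\overline{\mathcal H}$-null, $\vec{\mathcal P}$-null, $\mathcal P$-null) if for every metric space $Y$ and every uniformly continuous $f:X\to Y$ one has $\dim_H f(X)=0$ (resp. $\overline{\dim}_H f(X)=0$, $\vec{\dim}_P f(X)=0$, $\overline{\dim}_P f(X)=0$). *)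

(* Defs.v *)
From HB Require Import structures.
From mathcomp Require Import all_boot all_order all_algebra finmap.
From mathcomp Require Import all_classical all_reals all_analysis.
From mathcomp Require Import lra.

Set Implicit Arguments.
Unset Strict Implicit.
Unset Printing Implicit Defensive.

Import Order.TTheory GRing.Theory Num.Theory.
Import numFieldNormedType.Exports.

Local Open Scope classical_set_scope.
Local Open Scope ring_scope.

Lemma entourage_sup (T : choiceType) (I : Type) (Tc : I -> Uniform T) (i : I)
    (A : set (T * T)) :
  @entourage (Uniform.Pack (Tc i)) A -> @entourage (sup_topology Tc) A.
Proof.
move=> entA; exists A => //.
have [p <- _] : exists2 p : {p : ({classic I} * set (T * T))%type |
    `[< @entourage (Uniform.Pack (Tc p.1)) p.2 >]}, (projT1 p).2 = A & True.
  have iA : `[< @entourage (Uniform.Pack (Tc (i : {classic I}))) A >] by exact/asboolP.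
  by exists (exist (fun p : ({classic I} * set (T * T))%type =>
    `[< @entourage (Uniform.Pack (Tc p.1)) p.2 >]) (i : {classic I}, A) iA).
exists [fset p]%fset; first by move=> ? _; rewrite inE.
apply/seteqP; split => [xy /(_ _ (fset11 _))//|xy Vp q /=].
by rewrite inE => /eqP ->.
Qed.

(* The metric d(x, y) = 2 ^ (- min {i | x i != y i}) on the Cantor cube.  It is
   declared on top of the product uniformity of cantor_space, so closed, compact
   and meager sets are those of the product topology. *)
Section cantor_metric.
Variable R : realType.
Implicit Types x y z : cantor_space.

Definition cantor_dist x y : R :=
  if pselect (exists i, x i != y i) is left h then 2^-1 ^+ ex_minn h else 0.

Lemma cantor_dist_lt x y n :
  (cantor_dist x y < 2^-1 ^+ n) <-> (forall i, (i <= n)%N -> x i = y i).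
Proof.
rewrite /cantor_dist; case: pselect => [h|h].
  case: ex_minnP => m xym mmin.
  rewrite ltr_iXn2l ?invr_gt0 ?invf_lt1 ?ltr1n//.
  split=> [nm i ile|xy].
    apply/eqP; apply: contraTT ile => /mmin mi.
    by rewrite -ltnNge (leq_trans nm).
  by rewrite ltnNge; apply: contra xym => /xy ->.
split=> [_ i _|_]; last by rewrite exprn_gt0// invr_gt0.
by apply: contrapT => /eqP xy; apply: h; exists i.
Qed.

Lemma cantor_dist_ge0 x y : 0 <= cantor_dist x y.
Proof.
by rewrite /cantor_dist; case: pselect => // h; rewrite exprn_ge0// invr_ge0.
Qed.

Lemma cantor_dist_sym x y : cantor_dist x y = cantor_dist y x.
Proof.
rewrite /cantor_dist; case: pselect => [h|h]; case: pselect => [h'|h'] //.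
- congr (_ ^+ _); case: ex_minnP => m xm mmin; case: ex_minnP => m' ym mmin'.
  by apply/eqP; rewrite eqn_leq mmin ?mmin'// eq_sym.
- by case: h'; case: h => i xy; exists i; rewrite eq_sym.
- by case: h; case: h' => i xy; exists i; rewrite eq_sym.
Qed.

Lemma cantor_dist_ultra x y z :
  cantor_dist x z <= Num.max (cantor_dist x y) (cantor_dist y z).
Proof.
rewrite {1}/cantor_dist; case: pselect => [h|h]; last first.
  by rewrite le_max cantor_dist_ge0.
case: ex_minnP => m xzm _; rewrite leNgt; apply/negP.
rewrite gt_max => /andP[/cantor_dist_lt xy /cantor_dist_lt yz].
by move: xzm; rewrite xy// yz// eqxx.
Qed.

Lemma cantor_dist_eq0 x y : cantor_dist x y = 0 -> x = y.
Proof.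
rewrite /cantor_dist; case: pselect => [h /eqP|h _].
  by rewrite expf_eq0 invr_eq0 pnatr_eq0 andbF.
by apply/funext => i; apply: contrapT => /eqP xy; apply: h; exists i.
Qed.

Lemma cantor_distxx x : cantor_dist x x = 0.
Proof.
by rewrite /cantor_dist; case: pselect => // h; have [i /eqP] := h.
Qed.

Let cball x (e : R) : set cantor_space := [set y | cantor_dist x y < e].

Let cball_center x (e : R) : 0 < e -> cball x e x.
Proof. by rewrite /cball/= cantor_distxx. Qed.

Let cball_sym x y (e : R) : cball x e y -> cball y e x.
Proof. by rewrite /cball/= cantor_dist_sym. Qed.

Let cball_triangle x y z (e1 e2 : R) :
  cball x e1 y -> cball y e2 z -> cball x (e1 + e2) z.
Proof.
rewrite /cball/= => xy yz.
have e10 : 0 < e1 by apply: le_lt_trans xy; exact: cantor_dist_ge0.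
have e20 : 0 < e2 by apply: le_lt_trans yz; exact: cantor_dist_ge0.
apply: le_lt_trans (cantor_dist_ultra _ y _) _.
by rewrite gt_max (lt_trans xy) ?(lt_trans yz) ?ltrDl ?ltrDr.
Qed.

Lemma half_expr_lt (e : R) : 0 < e -> exists n, 2^-1 ^+ n < e.
Proof.
move=> e0; have : (fun n => 2^-1 ^+ n : R) @ \oo --> (0 : R).
  by apply: cvg_expr; rewrite ger0_norm ?invr_ge0// invf_lt1 ?ltr1n.
move=> /cvgr_lt /(_ _ e0)[N _ /(_ N)] H; exists N; exact: H (leqnn N).
Qed.

Let cball_entourage : entourage = entourage_ cball.
Proof.
apply/seteqP; split => A.
- move=> [B [F _ <-] BA].
  pose N := \max_(p : F) (\val (\val p)).1.
  exists (2^-1 ^+ N); first by rewrite /= exprn_gt0// invr_gt0.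
  move=> [x y] /= /cantor_dist_lt xy; apply: BA => p pF.
  have : ((projT1 p).1 <= N)%N.
    by rewrite /N; apply: (@leq_bigmax _ (fun p : F => (\val (\val p)).1) [` pF]%fset).
  case: p pF => -[i V] /= /[dup] /asboolP [W entW WV] Vp pF iN.
  apply: WV => /=.
  change (W (x i, y i)); rewrite (xy _ iN).
  exact: entourage_refl.
- move=> [e /= e0 eA].
  have [n ne] := half_expr_lt e0.
  have E (i : nat) : @entourage cantor_space [set xy | xy.1 i = xy.2 i].
    pose V : set (cantor_space * cantor_space) := [set xy | xy.1 i = xy.2 i].
    have Vi : `[< @entourage (initial_topology (@proj _ (fun=> bool) i)) V >].
      apply/asboolP; exists [set xy | xy.1 = xy.2] => //.
      by move=> _ [b _ <-].
    by apply: (@entourage_sup _ _ (fun i => Uniform.class (initial_topology (@proj _ (fun=> bool) i))) i); exact/asboolP.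
  have : @entourage cantor_space
      [set xy | forall i : 'I_n.+1, xy.1 (i : nat) = xy.2 (i : nat)].
    by apply: (@filter_forall _ _ (fun i : 'I_n.+1 => [set xy : cantor_space * cantor_space | xy.1 (i : nat) = xy.2 (i : nat)]) (@entourage cantor_space) _) => i; exact: E.
  apply: (@filterS _ _ (@entourage_filter cantor_space)) => -[x y] xy.
  apply: eA => /=; rewrite /cball/=.
  by apply: lt_trans ne; apply/cantor_dist_lt => i ilt; have ilt' : (i < n.+1)%N by []; have := xy (Ordinal ilt').
Qed.

HB.instance Definition _ := Uniform_isPseudoMetric.Build R cantor_space
  cball_center cball_sym cball_triangle cball_entourage.

Let cantor_ballE x d : ball x d = [set y | cantor_dist x y < d].
Proof. by []. Qed.

HB.instance Definition _ := PseudoMetric_isMetric.Build R cantor_space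
  cantor_dist_ge0 cantor_dist_eq0 cantor_ballE.

End cantor_metric.

Definition determined (n : nat) : set (set cantor_space) :=
  [set A | forall x y : cantor_space,
    (forall i, (i < n)%N -> x i = y i) -> A x -> A y].

Definition cylinder n (t : n.-tuple bool) : set cantor_space :=
  [set x | forall i : 'I_n, x i = tnth t i].

Definition cantor_cons (b : bool) (x : cantor_space) : cantor_space :=
  fun i => if i is j.+1 then x j else b.

Lemma determined_le m n A : (m <= n)%N -> determined m A -> determined n A.
Proof.
by move=> mn mA x y xy; apply: mA => i im; apply: xy; exact: leq_trans mn.
Qed.

Lemma determinedS n b A :
  determined n.+1 A -> determined n (cantor_cons b @^-1` A).
Proof. by move=> nA x y xy; apply: nA => -[|i] //= /xy. Qed.

Lemma cylinder_cons n b (t : n.-tuple bool) A :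
  cylinder [tuple of b :: t] `<=` A <-> cylinder t `<=` cantor_cons b @^-1` A.
Proof.
split=> [H x tx|H x bx].
  apply: H => i; rewrite (tnth_nth false).
  case: i => -[|i] //= ilt; have := tx (Ordinal (ilt : (i < n)%N)).
  by rewrite (tnth_nth false).
have -> : x = cantor_cons b (fun i => x i.+1).
  apply/funext => -[|i] //=.
  by have := bx ord0; rewrite (tnth_nth false).
apply: H => i; have := bx (lift ord0 i).
by rewrite !(tnth_nth false).
Qed.

Lemma cylinder0 (t : 0.-tuple bool) : cylinder t = setT.
Proof. by apply/seteqP; split => // x _ []. Qed.

(* The sets depending on finitely many coordinates (the clopen sets) form an
   algebra of sets, carried by a copy of cantor_space.  The product measure is
   the Caratheodory extension of the premeasure giving mass 2 ^ (- n) to each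
   cylinder fixing the first n coordinates. *)
Section clopen_algebra.

Definition cantor_clopen_type : Type := cantor_space.
HB.instance Definition _ := Pointed.on cantor_clopen_type.

Let clopen : set (set cantor_clopen_type) := [set A | exists n, determined n A].

Let clopen0 : clopen set0.
Proof. by exists 0%N. Qed.

Let clopenU : setU_closed clopen.
Proof.
move=> A B [m mA] [n nB]; exists (maxn m n) => x y xy [/mA Ax|/nB Bx]; [left|right].
- by apply: Ax => i im; apply: xy; rewrite leq_max im.
- by apply: Bx => i im; apply: xy; rewrite leq_max im orbT.
Qed.

Let clopenC : setC_closed clopen.
Proof.
move=> A [n nA]; exists n => x y xy Ax Ay; apply: Ax; apply: nA Ay => i /xy //.
Qed.

Definition cantor_clopen_display : measure_display. Proof. by []. Qed.

HB.instance Definition _ := @isAlgebraOfSets.Build cantor_clopen_display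
  cantor_clopen_type clopen clopen0 clopenU clopenC.

End clopen_algebra.

Section haar.
Variable R : realType.
Implicit Types A B : set cantor_space.

(* The proportion of the cylinders of length n that are included in A. *)
Definition cylinder_frac n A : R :=
  \sum_(t : n.-tuple bool) (`[< cylinder t `<=` A >]%:R * 2^-1 ^+ n).

Lemma cylinder_frac0 A : cylinder_frac 0 A = `[< A = setT >]%:R.
Proof.
rewrite /cylinder_frac (bigD1 [tuple])//= big1 ?addr0 ?mulr1; last first.
  by move=> t /eqP; rewrite tuple0.
congr (_%:R); congr nat_of_bool; apply: asbool_equiv_eq; rewrite cylinder0.
by split=> [TA|->//]; apply/seteqP; split.
Qed.

Lemma cylinder_fracS n A : cylinder_frac n.+1 A =
  2^-1 * (cylinder_frac n (cantor_cons true @^-1` A) +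
          cylinder_frac n (cantor_cons false @^-1` A)).
Proof.
rewrite /cylinder_frac mulrDr !mulr_sumr.
pose f (p : bool * n.-tuple bool) := [tuple of p.1 :: p.2].
rewrite (reindex f)/=; last first.
  exists (fun t => (thead t, [tuple of behead t])) => [[b t] _|t _].
    by congr pair; exact: val_inj.
  by rewrite /f/= [RHS]tuple_eta; exact: val_inj.
rewrite -(pair_bigA _ (fun b (t : n.-tuple bool) =>
  `[< cylinder [tuple of b :: t] `<=` A >]%:R * 2^-1 ^+ n.+1))/=.
rewrite big_bool/=; congr (_ + _); apply: eq_bigr => t _;
  rewrite exprS mulrCA; congr (_ * (_%:R * _)); congr nat_of_bool;
  apply: asbool_equiv_eq; exact: cylinder_cons.
Qed.

Lemma cylinder_frac_ge0 n A : 0 <= cylinder_frac n A.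
Proof.
by apply: sumr_ge0 => t _; rewrite mulr_ge0 ?ler0n ?exprn_ge0 ?invr_ge0.
Qed.

Lemma le_cylinder_fracS n A : cylinder_frac n A <= cylinder_frac n.+1 A.
Proof.
elim: n A => [|n IHn] A.
  rewrite cylinder_fracS !cylinder_frac0.
  case: asboolP => [->|_]; last by rewrite mulr_ge0 ?invr_ge0 ?addr_ge0 ?ler0n.
  by rewrite !preimage_setT !asboolT//=; lra.
by rewrite cylinder_fracS [leRHS]cylinder_fracS ler_wpM2l ?invr_ge0// lerD.
Qed.

Lemma le_cylinder_frac m n A :
  (m <= n)%N -> cylinder_frac m A <= cylinder_frac n A.
Proof.
elim: n => [|n IHn]; first by rewrite leqn0 => /eqP ->.
rewrite leq_eqVlt => /predU1P[->//|/IHn /le_trans]; apply.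
exact: le_cylinder_fracS.
Qed.

Lemma determined0 A : determined 0 A -> A = set0 \/ A = setT.
Proof.
move=> A0; have [[x Ax]|A0'] := pselect (A !=set0).
  by right; apply/seteqP; split => // y _; exact: A0 Ax.
by left; apply/seteqP; split => // x Ax; apply: A0'; exists x.
Qed.

Lemma asbool_set0T : `[< set0 = [set: cantor_space] >] = false.
Proof.
by apply/asboolP => H; have : [set: cantor_space] point by []; rewrite -H.
Qed.

Lemma determined_cylinder_fracS n A :
  determined n A -> cylinder_frac n.+1 A = cylinder_frac n A.
Proof.
elim: n A => [|n IHn] A nA; last first.
  by rewrite cylinder_fracS [RHS]cylinder_fracS !IHn//; exact: determinedS.
rewrite cylinder_fracS !cylinder_frac0.
case: (determined0 nA) => ->; rewrite ?preimage_set0 ?preimage_setT.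
  by rewrite asbool_set0T addr0 mulr0.
by rewrite asboolT//=; lra.
Qed.

Lemma determined_cylinder_frac m n A :
  (m <= n)%N -> determined m A -> cylinder_frac n A = cylinder_frac m A.
Proof.
move=> + mA; elim: n => [|n IHn]; first by rewrite leqn0 => /eqP ->.
rewrite leq_eqVlt => /predU1P[->//|mn].
rewrite determined_cylinder_fracS ?IHn//.
exact: determined_le mA.
Qed.

Lemma cylinder_frac_setU n A B : determined n A -> determined n B ->
  A `&` B = set0 -> cylinder_frac n (A `|` B) = cylinder_frac n A + cylinder_frac n B.
Proof.
elim: n A B => [|n IHn] A B nA nB AB; last first.
  have IH b : cylinder_frac n (cantor_cons b @^-1` (A `|` B)) =
      cylinder_frac n (cantor_cons b @^-1` A) +
      cylinder_frac n (cantor_cons b @^-1` B).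
    rewrite preimage_setU; apply: IHn; [exact: determinedS|exact: determinedS|].
    by rewrite -preimage_setI AB preimage_set0.
  rewrite [LHS]cylinder_fracS (cylinder_fracS n A) (cylinder_fracS n B) !IH.
  by lra.
move: AB; rewrite !cylinder_frac0.
case: (determined0 nA) => ->; case: (determined0 nB) => ->;
  rewrite ?setUT ?setTU ?setU0 ?setTI ?asbool_set0T ?addr0 ?add0r//.
by move/esym => T0; have := asbool_set0T; rewrite asboolT.
Qed.

(* For a clopen set the sequence of fractions is eventually constant
   (haar_contentE). *)
Definition haar_content : set cantor_clopen_type -> \bar R :=
  fun A => ereal_sup (range (fun n => (cylinder_frac n A)%:E)).

Lemma haar_contentE n A : determined n A -> haar_content A = (cylinder_frac n A)%:E.
Proof.
move=> nA; apply/eqP; rewrite eq_le; apply/andP; split.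
  apply: ge_ereal_sup => _ [m _ <-]; rewrite lee_fin.
  rewrite -(determined_cylinder_frac (leq_maxr m n) nA).
  by apply: le_cylinder_frac; exact: leq_maxl.
by apply: ereal_sup_ubound; exists n.
Qed.

Let haar_content0 : haar_content set0 = 0%E.
Proof.
by rewrite (@haar_contentE 0%N)// cylinder_frac0 asbool_set0T.
Qed.

Let haar_content_ge0 A : (0 <= haar_content A)%E.
Proof.
apply: (@le_trans _ _ (cylinder_frac 0 A)%:E).
  by rewrite lee_fin cylinder_frac_ge0.
by apply: ereal_sup_ubound; exists 0%N.
Qed.

Let haar_content_semi_additive : measure_function.semi_additive haar_content.
Proof.
apply/(additive2P haar_content0) => A B [m mA] [n nB] AB.
have mA' := determined_le (leq_maxl m n) mA.
have nB' := determined_le (leq_maxr m n) nB.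
rewrite (haar_contentE mA') (haar_contentE nB') (@haar_contentE (maxn m n)).
  by rewrite cylinder_frac_setU// EFinD.
by move=> x y xy [/mA' Ax|/nB' Bx]; [left; exact: Ax|right; exact: Bx].
Qed.

HB.instance Definition _ := isContent.Build _ _ _ haar_content
  haar_content_ge0 haar_content_semi_additive.

Lemma determined_open n A : determined n A -> open A.
Proof.
move=> nA; rewrite openE => x Ax; rewrite /interior.
apply/(@nbhs_ballP R cantor_space); exists (2^-1 ^+ n).
  by rewrite /= exprn_gt0// invr_gt0.
move=> y; rewrite ballEmdist/= => /cantor_dist_lt xy.
by apply: nA Ax => i /ltnW /xy.
Qed.

Let haar_content_sigma_subadditive :
  measurable_subset_sigma_subadditive haar_content.
Proof.
move=> A F mF mA AF.
have clA : closed A.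
  case: (mA) => n nA; rewrite -(setCK A); apply: open_closedC.
  apply: (@determined_open n) => x y xy Ax Ay; apply: Ax.
  by apply: nA Ay => i /xy.
have cA : compact (A : set cantor_space).
  exact: subclosed_compact clA cantor_space_compact _.
have F_open i : setT i -> open (F i : set cantor_space).
  by move=> _; have [n nF] := mF i; exact: determined_open nF.
move: cA; rewrite compact_cover => /(_ nat setT F F_open)[|D _ AD].
  by move=> t /AF[i _ Fit]; exists i.
pose N := (\max_(i : D) (val i)).+1.
apply: (@le_trans _ _ (\sum_(i < N) haar_content (F i))%E).
  apply: content_subadditive => //.
  move=> t /AD[i /= iD Fit]; rewrite -bigcup_mkord; exists i => //=.
  by rewrite /N ltnS (@leq_bigmax _ (fun i : D => val i) [` iD]%fset).
rewrite -(big_mkord xpredT (fun i => haar_content (F i))).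
by apply: nneseries_lim_ge => n _ _; exact: haar_content_ge0.
Qed.

HB.instance Definition _ := Content_SigmaSubAdditive_isMeasure.Build _ _ _
  haar_content haar_content_sigma_subadditive.

Definition haar :
    {measure set (g_sigma_algebraType (@measurable _ cantor_clopen_type)) -> \bar R} :=
  measure_extension haar_content.

Lemma haar_cylinder n (t : n.-tuple bool) :
  haar (cylinder t) = (2^-1 ^+ n)%:E.
Proof.
have tn : determined n (cylinder t).
  by move=> x y xy tx i; rewrite -xy.
transitivity (haar_content (cylinder t)).
  by apply: measurable_mu_extE; exists n.
rewrite (haar_contentE tn) /cylinder_frac (bigD1 t)//= asboolT// big1.
  by rewrite addr0 mul1r.
move=> s /eqP st; rewrite asboolF ?mul0r// => H; apply: st.
pose x : cantor_space := fun i => nth false s i.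
have sx : cylinder s x by move=> i; rewrite (tnth_nth false).
by apply: eq_from_tnth => i; rewrite -(H _ sx) -sx.
Qed.

End haar.

Section ideals.
Implicit Types (X A M : set cantor_space) (J : set (set cantor_space)).

Definition cantor_add (x y : cantor_space) : cantor_space :=
  fun i => x i (+) y i.

Definition sumset A B : set cantor_space :=
  [set cantor_add x y | x in A & y in B].

Definition nowhere_dense (T : topologicalType) (A : set T) :=
  interior (closure A) = set0.

Definition meager (T : topologicalType) (A : set T) :=
  exists F : (set T)^nat,
    (forall n, nowhere_dense (F n)) /\ A `<=` \bigcup_n F n.

Definition ideal_M : set (set cantor_space) := [set A | meager A].

Definition ideal_N (R : realType) : set (set cantor_space) :=
  [set A | (haar R).-negligible A].

Definition ideal_E (R : realType) : set (set cantor_space) :=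
  [set A | exists C : (set cantor_space)^nat,
    (forall n, closed (C n) /\ (haar R).-negligible (C n)) /\
    A `<=` \bigcup_n C n].

Definition additive_for J X := forall A, J A -> J (sumset X A).

Definition strongly_null X :=
  ~ exists M, ideal_M M /\ sumset X M = [set: cantor_space].

End ideals.

(* The restriction of x to [a, b), read as a word of length b - a. *)
Definition restr (x : cantor_space) (a b : nat) : (b - a).-tuple bool :=
  [tuple x (a + i)%N | i < b - a].

Definition T'_set (X : set cantor_space) :=
  exists g : nat -> nat, forall f : nat -> nat,
    {homo f : m n / (m <= n)%N >-> (m <= n)%N} ->
    (forall m, exists n, (m <= f n)%N) ->
    exists (I : set nat) (H : forall n, {set (f n.+1 - f n).-tuple bool}),
      [/\ infinite_set I,
          forall n, I n -> (#|H n| <= g n)%N &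
          forall x, X x ->
            finite_set [set n | I n /\ restr x (f n) (f n.+1) \notin H n]].

Section metric_subspace.
Context {R : realType} {Y : metricType R} (A : set Y).

Let dist (x y : A) : R := mdist (set_val x) (set_val y).

Let dist_ge0 x y : 0 <= dist x y.
Proof. exact: mdist_ge0. Qed.

Let dist_positivity x y : dist x y = 0 -> x = y.
Proof. by move=> /mdist_positivity; exact: val_inj. Qed.

Let ballE (x : A) d : ball x d = [set y | dist x y < d].
Proof.
by apply/seteqP; split => y; rewrite -initial_ballE/= ballEmdist.
Qed.

HB.instance Definition _ := PseudoMetric_isMetric.Build R (set_type A)
  dist_ge0 dist_positivity ballE.

End metric_subspace.

(* Dimensions of a subset E of a metric space Y, E being seen as a metric space
   in its own right: allowing the covering sets to leave E does not change the
   values, as they can be intersected with E. *)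
Section dimensions.
Context {R : realType}.
Local Open Scope ereal_scope.

Section cover_dimensions.
Context {Y : metricType R}.
Implicit Types (E K : set Y) (A : (set Y)^nat) (s d : R).

(* The point 0 is added so that the diameter of the empty set is 0 (and
   not -oo). *)
Definition diam E : \bar R :=
  ereal_sup (0 |` [set (mdist x y)%:E | x in E & y in E]).

Definition hausdorff_premeasure s d E : \bar R :=
  ereal_inf [set \sum_(n <oo) diam (A n) `^ s | A in
    [set A : (set Y)^nat | E `<=` \bigcup_n A n /\ forall n, diam (A n) <= d%:E]].

Definition hausdorff_measure s E : \bar R :=
  ereal_sup [set hausdorff_premeasure s d E | d in [set d | (0 < d)%R]].

Definition dimH E : \bar R :=
  ereal_inf [set s%:E | s in [set s | (0 < s)%R /\ hausdorff_measure s E = 0]].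

Definition covering_number E d : \bar R :=
  ereal_inf [set n%:R%:E | n in [set n | exists A : 'I_n -> set Y,
    E `<=` \bigcup_i A i /\ forall i, diam (A i) <= d%:E]].

Definition box_ratio E d : \bar R :=
  lne (covering_number E d) * (`|ln d|^-1)%:E.

Definition upper_dimB E : \bar R :=
  if `[< E = set0 >] then 0 else limf_esup (box_ratio E) 0^'+.

Definition lower_dimB E : \bar R :=
  if `[< E = set0 >] then 0 else limf_einf (box_ratio E) 0^'+.

Definition upper_dimP E : \bar R :=
  ereal_inf [set ereal_sup (range (fun n => upper_dimB (A n))) | A in
    [set A : (set Y)^nat | \bigcup_n A n = E]].

Definition directed_lower_dimP E : \bar R :=
  ereal_inf [set ereal_sup (range (fun n => lower_dimB (A n))) | A in
    [set A : (set Y)^nat |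
      (forall m n, (m <= n)%N -> A m `<=` A n) /\ \bigcup_n A n = E]].

Definition sigma_compact K :=
  exists C : (set Y)^nat, (forall n, compact (C n)) /\ K = \bigcup_n C n.

End cover_dimensions.

(* The completeType of the library is pointed, which would exclude the
   completion of the empty space. *)
Definition complete_space (Z : uniformType) :=
  forall F : set_system Z, ProperFilter F -> cauchy F -> exists z : Z, F --> z.

Definition is_completion (X Z : metricType R) (i : X -> Z) :=
  [/\ complete_space Z,
      forall x y, mdist (i x) (i y) = mdist x y &
      dense (range i)].

(* Completions are unique up to isometry, so the choice of Z and i does not
   matter. *)
Definition upper_dimH {Y : metricType R} (E : set Y) : \bar R :=
  ereal_inf [set d | exists (Z : metricType R) (i : E -> Z) (K : set Z),
    [/\ is_completion i, sigma_compact K, range i `<=` K & d = dimH K]].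

Definition dim_null (dim : forall Y : metricType R, set Y -> \bar R)
    (X : metricType R) :=
  forall (Y : metricType R) (f : X -> Y), unif_continuous f ->
    dim Y (range f) = 0.

Definition H_null := dim_null (@dimH).
Definition upper_H_null := dim_null (@upper_dimH).
Definition directed_P_null := dim_null (@directed_lower_dimP).
Definition P_null := dim_null (@upper_dimP).

End dimensions.

(* Main.v *)
(* Each notion on X is equivalent to a combinatorial one about covering X by
   cylinders of prescribed lengths h(k), h : nat -> nat being arbitrary:
   - P-null and N-additive: X is a countable union of sets meeting at most k
     cylinders of length h(k), for almost all k (Pstar);
   - directed P-null and (T'): the same for an increasing union and for
     infinitely many k (dPstar);
   - upper H-null, M-additive and E-additive: X is a countable union of sets
     covered, for every a, by one cylinder of length h(k) for each k in some
     finite interval [a, b) (Ssharp);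
   - H-null and strongly null: X is covered by one cylinder of length h(k) for
     each k (Smz).
   Each of these clearly implies the next one.  For the dimensions, a modulus of
   uniform continuity turns coverings of X by cylinders into coverings of f(X) of
   small diameter; conversely one applies the hypothesis to the map
   x |-> (k |-> x|h(k)) into sequences of words with the first-difference metric.
   For the ideals N and E, the converse implications test additivity on sets of
   points y such that y vanishes at positions coded by the word y|e itself:
   translates of such sets by points with distinct prefixes of length e are
   independent events, and Baire's theorem bounds the number of prefixes. *)
From HB Require Import structures.
Require Import Defs.
From mathcomp Require Import all_boot all_order all_algebra.
From mathcomp Require Import all_classical all_reals all_analysis.
From mathcomp Require Import zify lra.

Set Implicit Arguments.
Unset Strict Implicit.
Unset Printing Implicit Defensive.

Import Order.TTheory GRing.Theory Num.Theory.
Import numFieldNormedType.Exports.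

Local Open Scope classical_set_scope.
Local Open Scope ring_scope.

Local Notation cantor := cantor_space.
Local Notation "x \+' y" := (cantor_add x y) (at level 50, left associativity).

(** * Coverings by cylinders *)

(** Because [h] is arbitrary, the number of cylinders allowed at index [k] may be any bound fixed
    before [h]. So a vanishing dimension is only used as dimension below 1: at scale 2^(-k) this
    leaves at most 2^(k+1) cylinders, whatever their length. Likewise a group of cylinders whose
    size is known before their length is fixed can be spread over as many indices, one cylinder for
    each. The ideals N and E allow different test sets. For N, a limsup of clopen sets of measure
    4^(-k) is null, while 8^k independent translates of the k-th one cover almost everything. For E
    the test set must be closed, so its conditions are imposed at every level, with one bit each;
    k+3 distinct prefixes at level k then leave an exceptional proportion 2^(-k-3), which is
    summable. If the translates stay in a closed null set, compactness makes the branching stop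
    before some finite level, which is how the finite intervals [a, b) arise. For the upper
    Hausdorff dimension they come from finite subcovers of compact pieces. *)

Definition agree (n : nat) (x y : cantor) := forall i, (i < n)%N -> x i = y i.

Lemma agree_refl n x : agree n x x. Proof. by []. Qed.

Lemma agree_sym n x y : agree n x y -> agree n y x.
Proof. by move=> xy i /xy. Qed.

Lemma agree_trans n y x z : agree n x y -> agree n y z -> agree n x z.
Proof. by move=> xy yz i ilt; rewrite xy// yz. Qed.

Lemma agree_le m n x y : (m <= n)%N -> agree n x y -> agree m x y.
Proof. by move=> mn xy i im; apply: xy; exact: leq_trans mn. Qed.

Lemma cantor_addK x y : (x \+' y) \+' y = x.
Proof. by apply/funext => i; rewrite /cantor_add addbK. Qed.

Lemma cantor_addC x y : x \+' y = y \+' x.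
Proof. by apply/funext => i; rewrite /cantor_add addbC. Qed.

Lemma cantor_add0 x : x \+' (fun=> false) = x.
Proof. by apply/funext => i; rewrite /cantor_add addbF. Qed.

Lemma agree_add n x y x' y' :
  agree n x x' -> agree n y y' -> agree n (x \+' y) (x' \+' y').
Proof. by move=> xx yy i ilt; rewrite /cantor_add xx// yy. Qed.

Lemma agree_addr n x y z : agree n (x \+' z) (y \+' z) -> agree n x y.
Proof.
by move=> /agree_add/(_ (@agree_refl n z)); rewrite !cantor_addK.
Qed.

Lemma determined_translate n (A : set cantor) z :
  determined n A -> determined n [set w | A (w \+' z)].
Proof. by move=> nA x y xy; apply: nA; apply: agree_add. Qed.

Lemma determinedI n A B : determined n A -> determined n B -> determined n (A `&` B).
Proof. by move=> nA nB x y xy [/(nA _ _ xy) + /(nB _ _ xy)]. Qed.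

Lemma determinedC n A : determined n A -> determined n (~` A).
Proof. by move=> nA x y /agree_sym xy Ax /(nA _ _ xy). Qed.

Lemma determined_agree n z : determined n [set w | agree n w z].
Proof. by move=> x y /agree_sym xy; exact: agree_trans. Qed.

Definition covered (n c : nat) (A : set cantor) := exists z : nat -> cantor,
  forall x, A x -> exists2 i, (i < c)%N & agree n x (z i).

Lemma covered_le m n c d (A B : set cantor) : (m <= n)%N -> (c <= d)%N -> A `<=` B ->
  covered n c B -> covered m d A.
Proof.
move=> mn cd AB [z zP]; exists z => x /AB/zP[i ic xi]; exists i.
  exact: leq_trans cd.
exact: agree_le xi.
Qed.

Lemma coveredU n c d A B : covered n c A -> covered n d B -> covered n (c + d) (A `|` B).
Proof.
move=> [z zP] [z' zP']; exists (fun i => if (i < c)%N then z i else z' (i - c)%N).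
move=> x [/zP|/zP'] [i ic xi].
  by exists i; rewrite ?ic//; lia.
by exists (c + i)%N; [lia|rewrite ifF ?addKn//; lia].
Qed.

(** Greedy selection: while the points chosen so far give no covering, some point of [A] has a
    prefix different from all of theirs. Failure of a covering by [c] cylinders is always used
    through these [c + 1] points. *)
Lemma not_covered n c A : ~ covered n c A -> exists z : nat -> cantor,
  (forall i, (i <= c)%N -> A (z i)) /\
  forall i j, (i < j)%N -> (j <= c)%N -> ~ agree n (z i) (z j).
Proof.
elim: c => [|c IH] nc.
  have [x Ax] : exists x, A x.
    by apply: contrapT => nA; apply: nc; exists (fun=> point) => x Ax; case: nA; exists x.
  by exists (fun=> x); split => // i j; lia.
have [|z [zA zd]] := IH.
  by move=> h; apply: nc; apply: covered_le h.
have [x [Ax xz]] : exists x, A x /\ forall i, (i <= c)%N -> ~ agree n x (z i).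
  apply: contrapT => nx; apply: nc; exists z => x Ax.
  apply: contrapT => h; apply: nx; exists x; split => // i ic xi; apply: h.
  by exists i.
exists (fun i => if (i <= c)%N then z i else x); split => [i ic|i j ij jc].
  by case: ifPn => // ?; apply: zA.
rewrite ifT; last by lia.
case: ifPn => jc'; first exact: zd.
by move=> /agree_sym; apply: xz; lia.
Qed.

(** * Interval partitions of the natural numbers *)

Lemma block_choice (T : Type) (Q : nat -> nat -> nat -> T -> Prop) :
  (forall n a, exists b d, (a < b)%N /\ Q n a b d) ->
  exists (g : nat -> nat) (D : nat -> T),
    forall n, (g n < g n.+1)%N /\ Q n (g n) (g n.+1) (D n).
Proof.
move=> H.
have /choice[F FP] : forall na : nat * nat, exists bd : nat * T,
    (na.2 < bd.1)%N /\ Q na.1 na.2 bd.1 bd.2.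
  by move=> [n a]; have [b [d ?]] := H n a; exists (b, d).
pose g := fix g n := if n is n'.+1 then (F (n', g n')).1 else 0%N.
by exists g, (fun n => (F (n, g n)).2) => n; exact: FP (n, g n).
Qed.

Lemma increasing_le (g : nat -> nat) : (forall n, (g n < g n.+1)%N) ->
  {homo g : m n / (m <= n)%N >-> (m <= n)%N}.
Proof.
move=> gS m n; elim: n m => [|n IH] m; first by case: m.
by rewrite leq_eqVlt => /predU1P[->//|/IH/leq_trans]; apply; exact: ltnW.
Qed.

Lemma increasing_ge (g : nat -> nat) : (forall n, (g n < g n.+1)%N) ->
  forall n, (n <= g n)%N.
Proof. by move=> gS; elim=> // n IH; exact: leq_ltn_trans (gS n). Qed.

Lemma block_uniq (g : nat -> nat) : (forall n, (g n < g n.+1)%N) ->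
  forall m n k, (g m <= k < g m.+1)%N -> (g n <= k < g n.+1)%N -> m = n.
Proof.
move=> /increasing_le gle m n k km kn.
by have [lt|lt|//] := ltngtP m n; have := gle _ _ lt; lia.
Qed.

Lemma block_ex (g : nat -> nat) : (forall n, (g n < g n.+1)%N) ->
  forall k, (g 0%N <= k)%N -> exists n, (g n <= k < g n.+1)%N.
Proof.
move=> gS; elim=> [|k IH] gk; first by exists 0%N; have := gS 0%N; lia.
have [g0|kg0] := leqP (g 0%N) k; last by exists 0%N; have := gS 0%N; lia.
have [n nP] := IH g0.
have [kn|kn] := ltnP k.+1 (g n.+1); first by exists n; lia.
by exists n.+1; have := gS n.+1; lia.
Qed.

(** Serves to glue data chosen block by block into one sequence, as in [t k = D (N k) k]. *)
Lemma block_index (g : nat -> nat) : (forall n, (g n < g n.+1)%N) ->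
  exists N : nat -> nat, forall n k, (g n <= k < g n.+1)%N -> N k = n.
Proof.
move=> gS; suff /choice[N NP] : forall k, exists m, forall n, (g n <= k < g n.+1)%N -> m = n.
  by exists N => n k; exact: NP.
move=> k; have [[n kn]|nk] := pselect (exists n, (g n <= k < g n.+1)%N).
  by exists n => m; exact: block_uniq.
by exists 0%N => n kn; case: nk; exists n.
Qed.

(** * The four covering properties and the implications between them *)

Definition Pstar (X : set cantor) := forall h : nat -> nat,
  exists Xm : nat -> set cantor, X `<=` \bigcup_m Xm m /\
    forall m, exists k0, forall k, (k0 <= k)%N -> covered (h k) k (Xm m).

Definition dPstar (X : set cantor) := forall h : nat -> nat,
  exists Xm : nat -> set cantor, [/\ X `<=` \bigcup_m Xm m,
    forall m n, (m <= n)%N -> Xm m `<=` Xm n &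
    forall m k0, exists2 k, (k0 <= k)%N & covered (h k) k (Xm m)].

Definition Ssharp (X : set cantor) := forall h : nat -> nat,
  exists Xm : nat -> set cantor, X `<=` \bigcup_m Xm m /\
    forall m a, exists b t, forall x, Xm m x ->
      exists2 k, (a <= k < b)%N & agree (h k) x (t k).

Definition Smz (X : set cantor) := forall h : nat -> nat,
  exists t : nat -> cantor, forall x, X x -> exists k, agree (h k) x (t k).

Definition runmax (h : nat -> nat) n := (\max_(i < n.+1) h i)%N.

Lemma leq_runmax h i n : (i <= n)%N -> (h i <= runmax h n)%N.
Proof.
move=> iln; have ilt : (i < n.+1)%N by [].
exact: (@leq_bigmax _ (fun i : 'I_n.+1 => h i) (Ordinal ilt)).
Qed.

(* A bound which does not depend on h can be lowered to k by speeding up h. *)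
Lemma Pstar_pow X :
  (forall h : nat -> nat, exists Xm : nat -> set cantor, X `<=` \bigcup_m Xm m /\
    forall m, exists k0, forall k, (k0 <= k)%N -> covered (h k) (8 ^ k) (Xm m)) ->
  Pstar X.
Proof.
move=> H h; have [Xm [XX Xc]] := H (fun k => runmax h (8 ^ k.+1)).
exists Xm; split => // m; have [k0 k0P] := Xc m.
exists (8 ^ k0)%N => k kk.
have k_gt0 : (0 < k)%N by rewrite (leq_trans _ kk)// expn_gt0.
(* With l = [trunc_log 8 k] one has 8^l <= k < 8^(l+1): the covering at l has at most [k] members,
   and its length, a maximum of [h] up to 8^(l+1), is at least [h k]. *)
have /andP[l1 l2] := trunc_log_bounds (isT : (1 < 8)%N) k_gt0.
apply: covered_le (k0P (trunc_log 8 k) _) => //.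
  by apply: leq_runmax; exact: ltnW.
by rewrite trunc_log_max.
Qed.

Lemma dPstar_pow X :
  (forall h : nat -> nat, exists Xm : nat -> set cantor, [/\ X `<=` \bigcup_m Xm m,
    forall m n, (m <= n)%N -> Xm m `<=` Xm n &
    forall m k0, exists2 k, (k0 <= k)%N & covered (h k) (8 ^ k) (Xm m)]) ->
  dPstar X.
Proof.
move=> H h; have [Xm [XX Xle Xc]] := H (fun k => h (8 ^ k)%N).
exists Xm; split => // m k0; have [k kk kP] := Xc m k0.
by exists (8 ^ k)%N => //; rewrite (leq_trans kk)// ltnW// ltn_expl.
Qed.


Lemma covered_bigcup n c m (Xm : nat -> set cantor) :
  (forall i, (i < m)%N -> covered n c (Xm i)) -> covered n (m * c) (\bigcup_(i < m) Xm i).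
Proof.
elim: m => [|m IH] H; first by exists (fun=> point) => x [].
apply: covered_le (leqnn n) _ _ (coveredU (IH _) (H m _)) => //.
- by lia.
- move=> x [i /= im xi]; have [eim|ne] := eqVneq i m; first by right; rewrite -eim.
  by left; exists i => //=; lia.
- by move=> i im; apply: H; lia.
Qed.

(** The first m+1 pieces together need (m+1)k cylinders, at most k^2 once k > m; hence the lengths
    h(k^2). *)
Lemma Pstar_dPstar X : Pstar X -> dPstar X.
Proof.
move=> H h; have [Xm [XX Xc]] := H (fun k => h (k * k)%N).
exists (fun m => \bigcup_(i < m.+1) Xm i); split.
- by move=> x /XX[i _ xi]; exists i => //; exists i => //=.
- by move=> m n mn x [i /= im xi]; exists i => //=; lia.
- move=> m k0; have [K KP] := choice Xc.
  pose k := maxn (maxn k0 m.+1) (runmax K m).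
  have kmax i : (i < m.+1)%N -> (K i <= k)%N.
    by move=> im; rewrite leq_max leq_runmax ?orbT.
  exists (k * k)%N; first by rewrite (@leq_trans k)// ?leq_max ?leqnn// /k; nia.
  have mk : (m.+1 * k <= k * k)%N by rewrite leq_mul2r !leq_max leqnn !orbT.
  apply: covered_le (leqnn _) mk (@subset_refl _ _) _.
  by apply: covered_bigcup => i im; apply: KP; exact: kmax.
Qed.

(** A covering by k >= a cylinders is spread over the indices a, ..., a+k-1. These are below 2k, so
    a length dominating [h] up to 2k can be shortened to [h] at each of them. *)
Lemma dPstar_Ssharp X : dPstar X -> Ssharp X.
Proof.
move=> H h; have [Xm [XX _ Xc]] := H (fun k => runmax h (2 * k)%N).
exists Xm; split => // m a; have [k ak [z zP]] := Xc m a.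
exists (a + k)%N, (fun i => z (i - a)%N) => x /zP[i ik xi].
exists (a + i)%N; first by lia.
by rewrite addKn; apply: agree_le xi; apply: leq_runmax; lia.
Qed.

(* The pieces X_0, ..., X_n are covered by consecutive groups of words. *)
Lemma Ssharp_groups X : Ssharp X -> forall h : nat -> nat,
  exists (t : nat -> cantor) (g : nat -> nat), (forall n, (g n < g n.+1)%N) /\
    forall x, X x -> exists n0, forall n, (n0 <= n)%N ->
      exists2 k, (g n <= k < g n.+1)%N & agree (h k) x (t k).
Proof.
move=> H h; have [Xm [XX Xc]] := H h.
have U n a : exists b t, (a < b)%N /\ forall x m, (m <= n)%N -> Xm m x ->
      exists2 k, (a <= k < b)%N & agree (h k) x (t k).
  elim: n => [|n [b [t [ab bt]]]].
    have [b [t bt]] := Xc 0%N a; exists (maxn a.+1 b), t; split; first by lia.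
    by move=> x m; rewrite leqn0 => /eqP -> /bt[k kab xk]; exists k => //; lia.
  have [b' [t' bt']] := Xc n.+1 b.
  exists (maxn b b'), (fun k => if (k < b)%N then t k else t' k); split; first by lia.
  move=> x m; rewrite leq_eqVlt => /predU1P[->|mn] xm.
    by have [k kb xk] := bt' _ xm; exists k; [lia|rewrite ifF//; lia].
  by have [k kb xk] := bt x m mn xm; exists k; [lia|rewrite ifT//; lia].
have [g [D gD]] := block_choice U.
have gS n : (g n < g n.+1)%N by have [] := gD n.
have [N NE] := block_index gS.
exists (fun k => D (N k) k), g; split => // x /XX[m _ xm].
exists m => n mn; have [_ /(_ x m mn xm)[k kn xk]] := gD n.
by exists k => //; rewrite (NE n).
Qed.

Lemma Ssharp_Smz X : Ssharp X -> Smz X.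
Proof.
move=> /Ssharp_groups H h; have [t [g [_ tP]]] := H h; exists t => x /tP[n nP].
by have [k _ ?] := nP n (leqnn n); exists k.
Qed.

(* Applying the property to the subsequences (2^i (2k+1))_k. *)
Lemma Smz_io X : Smz X -> forall h : nat -> nat, exists t : nat -> cantor,
  forall x N, X x -> exists2 k, (N <= k)%N & agree (h k) x (t k).
Proof.
move=> H h.
have [t tP] := choice (fun i => H (fun k => h (2 ^ i * (2 * k).+1)%N)).
(* The index l = 2^i (2k+1) is decoded into i and k. A hit in the N-th subsequence has an index at
   least 2^N >= N, so hits occur arbitrarily far out. *)
exists (fun l => t (logn 2 l) ((l %/ 2 ^ logn 2 l) %/ 2)%N) => x N /(tP N)[k xk].
exists (2 ^ N * (2 * k).+1)%N.
  by rewrite (@leq_trans (2 ^ N))// ?leq_pmulr// ltnW// ltn_expl.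
have -> : logn 2 (2 ^ N * (2 * k).+1) = N.
  rewrite lognM ?expn_gt0// pfactorK// lognE/= dvdn2 /= mul2n odd_double /=.
  by rewrite addn0.
rewrite mulKn ?expn_gt0//.
by have -> : ((2 * k).+1 %/ 2 = k)%N by lia.
Qed.

(** * (T')-sets and the topology of the Cantor cube *)

Lemma nat_finite_bounded (A : set nat) : finite_set A -> exists N, forall n, A n -> (n < N)%N.
Proof.
move=> /finite_seqP[s ->]; exists (\max_(i <- s) i).+1 => n /= ns.
by rewrite ltnS; apply: (@leq_bigmax_seq _ s xpredT id).
Qed.

Lemma nat_infinite_unbounded (A : set nat) : infinite_set A ->
  forall N, exists2 n, A n & (N <= n)%N.
Proof.
move=> Ainf N; apply: contrapT => H; apply: Ainf.
apply: sub_finite_set (finite_II N) => n An /=; rewrite ltnNge; apply/negP => Nn.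
by apply: H; exists n.
Qed.

Lemma unbounded_nat_infinite (A : set nat) :
  (forall N, exists2 n, A n & (N <= n)%N) -> infinite_set A.
Proof.
by move=> AN /nat_finite_bounded[N NA]; have [n /NA + Nn] := AN N; rewrite ltnNge Nn.
Qed.

Definition ext (s : seq bool) : cantor := nth false s.

Lemma agree_ext n (x : cantor) : agree n x (ext (mkseq x n)).
Proof. by move=> i ilt; rewrite /ext nth_mkseq. Qed.

Lemma covered_seq n (s : seq cantor) (A : set cantor) :
  (forall x, A x -> exists2 y, y \in s & agree n x y) -> covered n (size s) A.
Proof.
move=> H; exists (nth point s) => x /H[y ys xy]; exists (index y s).
  by rewrite index_mem.
by rewrite nth_index.
Qed.

Lemma covered_words n (A : set cantor) : covered n (2 ^ n) A.
Proof.
pose s := [seq ext t | t : n.-tuple bool].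
have <- : size s = (2 ^ n)%N by rewrite size_map -cardE card_tuple card_bool.
apply: covered_seq => x _; exists (ext (mkseq x n)); last exact: agree_ext.
apply/mapP; exists (mktuple (fun i : 'I_n => x i)); rewrite ?mem_enum//=.
by rewrite /mkseq -val_enum_ord -map_comp.
Qed.

Lemma covered_prefixes m n c (A : set cantor) :
  (forall r, covered n c (A `&` [set x | agree m x r])) -> covered n (2 ^ m * c) A.
Proof.
move=> H; have [z zP] := @covered_words m setT.
apply: covered_le (leqnn _) (leqnn _) _ (covered_bigcup (fun i _ => H (z i))).
by move=> x Ax; have [i im xi] := zP x I; exists i.
Qed.

Lemma agree_restr a b (x y : cantor) : restr x a b = restr y a b <->
  forall i, (a <= i < b)%N -> x i = y i.
Proof.
split=> [xy i iab|xy].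
  have ilt : (i - a < b - a)%N by lia.
  have := congr1 (fun t => tnth t (Ordinal ilt)) xy; rewrite !tnth_mktuple/=.
  by rewrite subnKC//; lia.
by apply: eq_from_tnth => i; rewrite !tnth_mktuple; apply: xy; have := ltn_ord i; lia.
Qed.

Lemma T'_dPstar X : T'_set X -> dPstar X.
Proof.
move=> [g gP] h.
(* The words of [H n] preceded by the 2^(f n) possible prefixes give at most this many cylinders of
   length f(n+1). The successor keeps the number at least 2^(f n), hence at least [k0], even when
   [g n] is 0. *)
pose K n a := (2 ^ a * (g n).+1)%N.
pose f := fix f n := if n is n'.+1 then maxn (f n').+1 (h (K n' (f n'))) else 0%N.
have fS n : (f n < f n.+1)%N by rewrite /= leq_max leqnn.
have [J [H [Jinf Hg HX]]] := gP f (increasing_le fS)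
  (fun m => ex_intro _ m (increasing_ge fS m)).
exists (fun m => [set x | forall n, J n -> (m <= n)%N -> restr x (f n) (f n.+1) \in H n]).
split.
- move=> x /HX/nat_finite_bounded[m mP]; exists m => // n Jn mn.
  by apply: contraT => nH; have := mP n (conj Jn nH); rewrite ltnNge mn.
- by move=> m n mn x xm i Ji ni; apply: xm => //; exact: leq_trans ni.
- move=> m k0; have [n Jn mkn] := nat_infinite_unbounded Jinf (maxn m k0).
  exists (K n (f n)).
    rewrite (@leq_trans (2 ^ f n))// ?leq_pmulr// ltnW// (leq_ltn_trans _ (ltn_expl _ _))//.
    by rewrite (leq_trans _ (increasing_ge fS n))//; lia.
  have hle : (h (K n (f n)) <= f n.+1)%N by rewrite leq_max leqnn orbT.
  apply: covered_le hle (leqnn _) (@subset_refl _ _) _.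
  apply: covered_prefixes => r.
  pose w (t : (f n.+1 - f n).-tuple bool) : cantor :=
    fun i => if (i < f n)%N then r i else ext t (i - f n)%N.
  have sz : (size (map w (enum (H n))) <= (g n).+1)%N.
    by rewrite size_map -cardE (leq_trans (Hg _ Jn)).
  apply: covered_le (leqnn _) sz (@subset_refl _ _) _.
  apply: covered_seq => x [xm xr]; exists (w (restr x (f n) (f n.+1))).
    by apply: map_f; rewrite mem_enum; apply: xm => //; lia.
  move=> i ilt; rewrite /w; case: ltnP => [/xr//|fi].
  have ilt' : (i - f n < f n.+1 - f n)%N by lia.
  by rewrite /ext -(tnth_nth _ _ (Ordinal ilt')) tnth_mktuple/= subnKC.
Qed.

(** The identity serves as bound: n cylinders of length f(n+1) leave at most n words on [f(n),
    f(n+1)). One index is chosen for each piece; as the pieces increase, a point of piece m is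
    caught at the indices of all later pieces. *)
Lemma dPstar_T' X : dPstar X -> T'_set X.
Proof.
move=> H; exists id => f f_le f_unb.
have [Xm [XX Xle Xc]] := H (fun k => f k.+1).
have Q n a : exists b (_ : unit), (a < b)%N /\ covered (f b.+1) b (Xm n).
  by have [b ab bP] := Xc n a.+1; exists b, tt.
have [g [_ gP]] := block_choice Q.
have gS n : (g n < g n.+1)%N := (gP n).1.
have /= E n : exists H : {set (f n.+1 - f n).-tuple bool}, forall m, n = g m.+1 ->
    (#|H| <= n)%N /\ forall x, Xm m x -> restr x (f n) (f n.+1) \in H.
  have [[m ->]|nm] := pselect (exists m, n = g m.+1); last first.
    by exists finset.set0 => m nE; case: nm; exists m.
  have [z zP] := (gP m).2.
  exists [set restr (z i) (f (g m.+1)) (f (g m.+1).+1) | i : 'I_(g m.+1)]%SET => m' gm.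
  have -> : m' = m.
    have [lt|lt|//] := ltngtP m' m.
      by have := increasing_le gS (lt : (m'.+2 <= m.+1)%N); have := gS m'.+1; lia.
    by have := increasing_le gS (lt : (m.+2 <= m'.+1)%N); have := gS m.+1; lia.
  split; first by rewrite (leq_trans (leq_imset_card _ _))// card_ord.
  move=> x /zP[i im xi]; apply/imsetP; exists (Ordinal im) => //=.
  by apply/agree_restr => j /andP[_ /xi].
exists (range (fun m => g m.+1)), (fun n => projT1 (cid (E n))); split.
- apply: unbounded_nat_infinite => N; exists (g N.+1); first by exists N.
  by rewrite ltnW// increasing_ge.
- move=> _ [m _ <-]; case: cid => /= H' /(_ m erefl)[]//.
- move=> x /XX[m _ xm]; apply: sub_finite_set (finite_II (g m.+1)).
  move=> _ [[m' _ <-]]; case: cid => /= H' /(_ m' erefl)[_ xH'] /negP xH.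
  rewrite ltnNge; apply/negP => gmm; apply: xH; apply: xH'; apply: Xle xm.
  rewrite leqNgt; apply/negP => lt.
  by have := increasing_le gS (lt : (m'.+2 <= m.+1)%N); have := gS m'.+1; lia.
Qed.

(* R only serves to describe the product topology by a metric. *)
Section topology.
Variable R : realType.

Lemma cantor_nbhsP (x : cantor) (U : set cantor) :
  nbhs x U <-> exists n, forall y, agree n x y -> U y.
Proof.
split=> [/(@nbhs_ballP R cantor)[e /= e0 eU]|[n nU]].
  have [n ne] := half_expr_lt e0; exists n.+1 => y xy; apply: eU.
  rewrite ballEmdist/=; apply: lt_trans ne; apply/cantor_dist_lt => i ilt; exact: xy.
apply/(@nbhs_ballP R cantor); exists (2^-1 ^+ n) => /=.
  by rewrite exprn_gt0// invr_gt0.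
by move=> y; rewrite ballEmdist/= => /cantor_dist_lt xy; apply: nU => i /ltnW /xy.
Qed.

Lemma cantor_closureP (A : set cantor) x :
  closure A x <-> forall n, exists2 y, A y & agree n x y.
Proof.
split=> [Ax n|H B /cantor_nbhsP[n nB]].
  have /Ax[y [Ay xy]] : nbhs x (agree n x) by apply/cantor_nbhsP; exists n.
  by exists y.
by have [y Ay xy] := H n; exists y; split => //; exact: nB.
Qed.

Lemma cantor_closedP (A : set cantor) :
  closed A <-> forall x, (forall n, exists2 y, A y & agree n x y) -> A x.
Proof. by split=> H x Ax; apply: H; apply/cantor_closureP. Qed.

Lemma nowhere_denseP (A : set cantor) : nowhere_dense A <->
  forall x n, exists m y, [/\ (n <= m)%N, agree n x y & forall y', agree m y y' -> ~ A y'].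
Proof.
split=> [A0 x n|H].
  have [y [xy Ay]] : exists y, agree n x y /\ ~ closure A y.
    apply: contrapT => H; suff : interior (closure A) x by rewrite A0.
    apply/cantor_nbhsP; exists n => y xy; apply: contrapT => Ay; apply: H.
    by exists y.
  have [m mA] : exists m, forall y', agree m y y' -> ~ A y'.
    apply: contrapT => H; apply: Ay; apply/cantor_closureP => m.
    by apply: contrapT => H'; apply: H; exists m => y' yy' Ay'; apply: H'; exists y'.
  exists (maxn n m), y; split=> //; first exact: leq_maxl.
  by move=> y' yy'; apply: mA; apply: agree_le yy'; exact: leq_maxr.
apply/seteqP; split => // x /cantor_nbhsP[n nA].
have [m [y [_ xy yA]]] := H x n.
by have /cantor_closureP/(_ m)[y' Ay' /yA] := nA y xy.
Qed.

(** The word is lengthened for one pair at a time; what is achieved for earlier pairs survives,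
    since a set is avoided on a whole cylinder. *)
Lemma nowhere_dense_word (F : nat -> set cantor) (s : seq (cantor * nat)) n :
  (forall i, nowhere_dense (F i)) -> exists m z, (n <= m)%N /\
    forall p, p \in s -> forall y, agree n y p.1 ->
      (forall i, (n <= i < m)%N -> y i = z i) -> ~ F p.2 y.
Proof.
move=> nF; elim: s => [|p s [m [z [nm mz]]]]; first by exists n, point.
pose x : cantor := fun i => if (i < n)%N then p.1 i else z i.
have [m' [z' [mm' zz' Fz']]] := (nowhere_denseP (F p.2)).1 (nF p.2) x m.
exists m', z'; split; first exact: leq_trans mm'.
move=> q; rewrite inE => /predU1P[->|qs] y yq yz'.
  apply: Fz' => i im'; have [ni|ni] := leqP n i; first by rewrite yz'// ni.
  by rewrite yq// -zz' ?/x ?ni//; exact: leq_trans nm.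
apply: mz => // i inm; rewrite yz'; last by lia.
by rewrite -zz' ?/x ?ifF//; lia.
Qed.

Definition avoids (g : nat -> nat) (z y : cantor) (n : nat) :=
  exists2 i, (g n <= i < g n.+1)%N & y i != z i.

(** The classical combinatorial form of meagerness, with converse [avoids_meager]. Block n carries a
    word which leaves the first n+1 nowhere dense sets whichever of the finitely many prefixes comes
    before it. *)
Lemma meager_avoids (A : set cantor) : meager A -> exists (g : nat -> nat) z,
  (forall n, (g n < g n.+1)%N) /\
  forall y, A y -> exists n0, forall n, (n0 <= n)%N -> avoids g z y n.
Proof.
move=> [F [nF AF]].
have Q n a : exists b z, (a < b)%N /\ forall i y, (i <= n)%N ->
    (forall j, (a <= j < b)%N -> y j = z j) -> ~ F i y.
  pose s := [seq (ext (tval t), val i) | t <- enum {: a.-tuple bool}, i <- enum 'I_n.+1].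
  have [m [z [am mz]]] := nowhere_dense_word s a nF.
  exists (maxn a.+1 m), z; split; first by lia.
  move=> i y iln yz; have iln' : (i < n.+1)%N by [].
  apply: (mz (ext (mkseq y a), i)).
  - apply/allpairsP; exists (mktuple (fun i : 'I_a => y i), Ordinal iln') => /=.
    by rewrite !mem_enum; split=> //; rewrite /mkseq -val_enum_ord -map_comp.
  - exact: agree_ext.
  - by move=> j jam; apply: yz; lia.
have [g [D gD]] := block_choice Q.
have gS n : (g n < g n.+1)%N := (gD n).1.
have [N NE] := block_index gS.
exists g, (fun k => D (N k) k); split=> // y /AF[i _ Fy]; exists i => n iln.
apply: contrapT => H; apply: (gD n).2 iln _ Fy => j jn.
by apply: contrapT => /eqP yj; apply: H; exists j => //; rewrite (NE n).
Qed.

Lemma avoids_meager (g : nat -> nat) z : (forall n, (g n < g n.+1)%N) ->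
  meager [set y | exists n0, forall n, (n0 <= n)%N -> avoids g z y n].
Proof.
move=> gS; exists (fun m => [set y | forall n, (m <= n)%N -> avoids g z y n]).
split=> [m|y [m mP]]; last by exists m.
apply/nowhere_denseP => x n; pose k := maxn m n.
exists (g k.+1), (fun i => if (i < g k)%N then x i else z i); split.
- by have := increasing_ge gS k.+1; lia.
- by move=> i iln; rewrite ifT//; have := increasing_ge gS k; lia.
- move=> y' yy' /(_ k (leq_maxl _ _))[i /andP[gi ig]]; rewrite -yy'//.
  by rewrite ltnNge gi eqxx.
Qed.

End topology.

(** * Meager-additive and strongly null sets *)

(** The [c k] cylinders of the k-th covering receive the consecutive indices from [s k] on, where
    [h] is at most their length [F k]. *)
Lemma covered_words_index (h s F c : nat -> nat) (A : nat -> set cantor) :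
  (forall k, s k + c k <= s k.+1)%N -> (forall k, s k < s k.+1)%N ->
  (forall k l, (l < s k + c k)%N -> (h l <= F k)%N) ->
  (forall k, covered (F k) (c k) (A k)) ->
  exists t, forall k x, A k x ->
    exists2 l, (s k <= l < s k + c k)%N & agree (h l) x (t l).
Proof.
move=> sc sS hF /choice[z zP]; have [N NE] := block_index sS.
exists (fun l => z (N l) (l - s (N l))%N) => k x /(zP k)[i ik xi].
have kP : (s k <= s k + i < s k.+1)%N by have := sc k; lia.
exists (s k + i)%N; first by lia.
rewrite (NE k)// addKn.
by apply: agree_le xi; apply: hF; lia.
Qed.

Section meager_additive.
Variable R : realType.

(** If [x] agrees with [t k] on block k and [y] leaves [z] there, then x + y leaves z + t k. The
    length g(k+1) makes the prefix contain block k; each group of indices becomes one block of a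
    coarser partition. *)
Lemma Ssharp_meager_additive X : Ssharp X -> additive_for ideal_M X.
Proof.
move=> XS M /(meager_avoids R)[g [z [gS Mz]]].
have [t [u [uS tu]]] := Ssharp_groups XS (fun k => g k.+1).
have guS n : (g (u n) < g (u n.+1))%N.
  by apply: leq_trans (gS _) _; apply: increasing_le.
have [N NE] := block_index gS.
pose w : cantor := fun i => z i (+) t (N i) i.
have [F [nF wF]] := avoids_meager R (g := fun n => g (u n)) w guS.
exists F; split => // y [x Xx [y' My' <-]]; apply: wF => /=.
have [n0 n0P] := Mz _ My'; have [n1 n1P] := tu _ Xx.
exists (maxn n0 n1) => n; rewrite geq_max => /andP[nn0 nn1].
have [k ukn xk] := n1P n nn1.
have n0k : (n0 <= k)%N by have := increasing_ge uS n; lia.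
have [i gi yz] := n0P k n0k; exists i.
  have ik : (g (u n) <= g k)%N by apply: (increasing_le gS); lia.
  have ik' : (g k.+1 <= g (u n.+1))%N by apply: (increasing_le gS); lia.
  by lia.
rewrite /w/= (NE k)// /cantor_add xk; last by lia.
by apply: contra yz => /eqP; rewrite addbC => /addIb ->.
Qed.

(* A theorem of Bartoszynski and Judah.  If x disagrees with z on infinitely many
   blocks, let w be z on these blocks and differ from x elsewhere: then x + w is
   in the meager set, but w meets z on infinitely many blocks. *)
Lemma meager_additive_agree X (f : nat -> nat) : additive_for ideal_M X ->
  (forall n, f n < f n.+1)%N -> exists (u : nat -> nat) z,
  (forall n, u n < u n.+1)%N /\ forall x, X x -> exists n0, forall n, (n0 <= n)%N ->
    exists2 k, (u n <= k < u n.+1)%N & forall i, (f k <= i < f k.+1)%N -> x i = z i.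
Proof.
move=> XM fS; pose zero : cantor := fun=> false.
have /(meager_avoids R)[g [z [gS Mz]]] := XM _ (avoids_meager R zero fS).
(* The block of [u] is prolonged until its image under [f] contains a whole block [g(j), g(j+1))
   with j >= n: if [w] equals [z] on that image, it fails to avoid [z] at j. *)
have Q n a : exists b (_ : unit), (a < b)%N /\
    exists j, [/\ (n <= j)%N, (f a <= g j)%N & (g j.+1 <= f b)%N].
  pose j := maxn n (f a); exists (maxn a.+1 (g j.+1)), tt; split; first by lia.
  exists j; split; first by lia.
    by have := increasing_ge gS j; lia.
  apply: leq_trans (increasing_ge fS _) _; apply: increasing_le => //; lia.
have [u [_ uP]] := block_choice Q.
have uS n : (u n < u n.+1)%N := (uP n).1.
have fuS n : (f (u n) < f (u n.+1))%N.
  by apply: leq_trans (fS _) _; apply: increasing_le.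
exists u, z; split => // x Xx; apply: contrapT => Hx.
pose bad n := ~ exists2 k, (u n <= k < u n.+1)%N &
  forall i, (f k <= i < f k.+1)%N -> x i = z i.
have bad_io n0 : exists2 n, (n0 <= n)%N & bad n.
  apply: contrapT => H; apply: Hx; exists n0 => n nn0; apply: contrapT => Bn.
  by apply: H; exists n.
pose w : cantor := fun i => if `[< exists2 n, (f (u n) <= i < f (u n.+1))%N & bad n >]
  then z i else ~~ x i.
have /Mz[n0 n0P] : sumset X [set y | exists n0, forall n, (n0 <= n)%N -> avoids f zero y n] w.
  exists x => //; exists (w \+' x); last by rewrite cantor_addC cantor_addK.
  exists (u 0%N) => k uk; have [n kn] := block_ex uS uk.
  have fk i : (f k <= i < f k.+1)%N -> (f (u n) <= i < f (u n.+1))%N.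
    have : (f (u n) <= f k)%N by apply: (increasing_le fS); lia.
    have : (f k.+1 <= f (u n.+1))%N by apply: (increasing_le fS); lia.
    by lia.
  have [bn|nbn] := pselect (bad n).
    apply: contrapT => H; apply: (bn); exists k => // i ki.
    apply/eqP/negPn/negP => xz; apply: H; exists i => //.
    rewrite /cantor_add /zero /w asboolT; last by exists n => //; exact: fk.
    by case: (x i) (z i) xz => -[].
  exists (f k); first by rewrite leqnn fS.
  rewrite /cantor_add /zero /w asboolF; first by case: (x _).
  move=> [n' n'k bn']; apply: nbn.
  have fkk : (f k <= f k < f k.+1)%N by rewrite leqnn fS.
  by rewrite (@block_uniq (fun n => f (u n)) fuS n n' (f k) (fk _ fkk) n'k).
have [n nn0 bn] := bad_io n0; have [j [nj fg gf]] := (uP n).2.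
have [|i gij] := n0P j; first exact: leq_trans nj.
by rewrite /w asboolT ?eqxx//; exists n => //; lia.
Qed.

(** If a point agrees with [z] on [f(k), f(k+1)), its first f(k) bits determine its first f(k+1)
    bits. The resulting 2^f(k) cylinders receive the indices from 2^f(k) to 2^(f(k)+1) - 1, on which
    f(k+1) is made to dominate [h]. *)
Lemma meager_additive_Ssharp X : additive_for ideal_M X -> Ssharp X.
Proof.
move=> XM h.
pose f := fix f n := if n is n'.+1 then maxn (f n').+1 (runmax h (2 ^ (f n').+1)) else 0%N.
have fS n : (f n < f n.+1)%N by rewrite /= leq_max leqnn.
have [u [z [uS Xu]]] := meager_additive_agree XM fS.
pose A k := [set x : cantor | forall i, (f k <= i < f k.+1)%N -> x i = z i].
have Ac k : covered (f k.+1) (2 ^ f k) (A k).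
  rewrite -[X in covered _ X _]muln1; apply: covered_prefixes => r.
  exists (fun _ i => if (i < f k)%N then r i else z i) => x [Ax xr].
  by exists 0%N => // i ik; case: ltnP => [/xr//|fi]; apply: Ax; rewrite fi.
pose Xm m := [set x | forall n, (m <= n)%N -> exists2 k, (u n <= k < u n.+1)%N & A k x].
exists Xm; split=> [x /Xu[m mP]|m a]; first by exists m.
have sS k : (2 ^ f k < 2 ^ f k.+1)%N by rewrite ltn_exp2l.
have sc k : (2 ^ f k + 2 ^ f k <= 2 ^ f k.+1)%N.
  by rewrite addnn -mul2n -expnS leq_exp2l//; exact: fS.
have hF k l : (l < 2 ^ f k + 2 ^ f k)%N -> (h l <= f k.+1)%N.
  rewrite addnn -mul2n -expnS => lk; rewrite [f k.+1]/= leq_max; apply/orP; right.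
  by apply: leq_runmax; exact: ltnW.
have [t tP] := covered_words_index sc sS hF Ac.
have an : (a <= 2 ^ f (u (maxn m a)))%N.
  have := increasing_ge fS (u (maxn m a)); have := increasing_ge uS (maxn m a).
  by have := ltn_expl (f (u (maxn m a))) (isT : (1 < 2)%N); lia.
exists (2 ^ f (u (maxn m a).+1))%N, t => x xm.
have [k ku /tP[l lk xl]] := xm (maxn m a) (leq_maxl _ _); exists l => //.
have : (2 ^ f (u (maxn m a)) <= 2 ^ f k)%N.
  by rewrite leq_exp2l//; apply: (increasing_le fS); lia.
have : (2 ^ f k.+1 <= 2 ^ f (u (maxn m a).+1))%N.
  by rewrite leq_exp2l//; apply: (increasing_le fS); lia.
by have := sc k; lia.
Qed.

(* Galvin, Mycielski and Solovay *)
Lemma Smz_strongly_null X : Smz X -> strongly_null X.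
Proof.
move=> /Smz_io XS [M [/(meager_avoids R)[g [z [gS Mz]]] XM]].
have [t tP] := XS (fun k => g k.+1).
have [N NE] := block_index gS.
(* The point z + t cannot be in X + M: if it is x + y and x agrees with t on a block, then y equals
   z on that block, and such blocks lie arbitrarily far out. *)
have : sumset X M (fun i => z i (+) t (N i) i) by rewrite XM.
move=> [x Xx [y /Mz[n0 n0P] xy]].
have [k nk xk] := tP x n0 Xx; have [i gi /eqP] := n0P k nk; apply.
have := congr1 (@^~ i) xy; rewrite /cantor_add (NE k)// xk; last by case/andP: gi.
by rewrite addbC => /addIb.
Qed.

(** The set [M] is the complement of a dense open set, the union of cylinders of length [h n] around
    an enumeration of all finite words. For z outside X + M, the point z + x is in one of them, so x
    is in the cylinder around z + w n. *)
Lemma strongly_null_Smz X : strongly_null X -> Smz X.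
Proof.
move=> XS h; pose w n := ext (odflt [::] (unpickle n)).
pose M := [set y | forall n, ~ agree (h n) y (w n)].
have MM : meager M.
  exists (fun=> M); split=> [_|y My]; last by exists 0%N.
  apply/(nowhere_denseP R) => x n; pose k := pickle (mkseq x n).
  exists (maxn n (h k)), (w k); split; first exact: leq_maxl.
    by rewrite /w pickleK; exact: agree_ext.
  move=> y wy /(_ k); apply; apply: agree_sym; apply: agree_le wy; exact: leq_maxr.
have [z Xz] : exists z, ~ sumset X M z.
  apply: contrapT => H; apply: XS; exists M; split=> //.
  by apply/seteqP; split=> // z _; apply: contrapT => Xz; apply: H; exists z.
exists (fun n => z \+' w n) => x Xx; apply: contrapT => H; apply: Xz.
exists x => //; exists (z \+' x); last by rewrite cantor_addC cantor_addK.
move=> n zx; apply: H; exists n.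
have := agree_add zx (@agree_refl _ z).
by rewrite (cantor_addC z x) cantor_addK (cantor_addC (w n)).
Qed.

End meager_additive.

(** * Counting words *)

(** Each word is tested at its extension by zeros; for a set depending on the first n coordinates
    the count is 2^n times the measure. *)
Definition vol n (A : set cantor) : nat := #|[set t : n.-tuple bool | `[< A (ext t) >]]%SET|.

Lemma in_vol n A (t : n.-tuple bool) :
  (t \in [set t : n.-tuple bool | `[< A (ext t) >]]%SET) = `[< A (ext t) >].
Proof. by rewrite inE. Qed.

Definition word (x : cantor) n : n.-tuple bool := [tuple x i | i < n].

Lemma agree_word n x : agree n (ext (word x n)) x.
Proof.
by move=> i ilt; rewrite /ext -(tnth_nth _ _ (Ordinal ilt)) tnth_mktuple.
Qed.

Lemma word_agree n x y : word x n = word y n <-> agree n x y.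
Proof.
split=> [xy|xy]; last by apply: eq_from_tnth => i; rewrite !tnth_mktuple xy.
apply: agree_trans (agree_sym (@agree_word n x)) _; rewrite xy.
exact: agree_word.
Qed.

Lemma wordK n (t : n.-tuple bool) : word (ext t) n = t.
Proof. by apply: eq_from_tnth => i; rewrite tnth_mktuple /ext (tnth_nth false). Qed.

Lemma vol_sub n A B : A `<=` B -> (vol n A <= vol n B)%N.
Proof.
by move=> AB; apply/subset_leq_card/fintype.subsetP => t; rewrite !inE; exact: AB.
Qed.

Lemma eq_vol n A B : (forall x, A x <-> B x) -> vol n A = vol n B.
Proof.
by move=> AB; apply/eqP; rewrite eqn_leq !vol_sub// => x /AB.
Qed.

Lemma vol0 n : vol n set0 = 0%N.
Proof. by apply: eq_card0 => t; rewrite inE asboolF. Qed.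

Lemma volT n : vol n setT = (2 ^ n)%N.
Proof.
rewrite -[RHS]/((2 : nat) ^ n)%N -[in RHS]card_bool -card_tuple; apply: eq_card => t.
by rewrite !inE asboolT.
Qed.

Lemma volID n A B : (vol n (A `&` B) + vol n (A `&` ~` B) = vol n A)%N.
Proof.
rewrite /vol -(cardsID [set t : n.-tuple bool | `[< B (ext t) >]]%SET
  [set t : n.-tuple bool | `[< A (ext t) >]]%SET).
congr (_ + _)%N; apply: eq_card => t.
  by rewrite finset.in_setI !in_vol asbool_and.
by rewrite finset.in_setD !in_vol asbool_and asbool_neg andbC.
Qed.

Lemma volU n A B : (vol n (A `|` B) <= vol n A + vol n B)%N.
Proof.
by rewrite -(volID n (A `|` B) A); apply: leq_add; apply: vol_sub => x [[]].
Qed.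

Lemma vol_bigcup n m (A : nat -> set cantor) :
  (vol n (\bigcup_(i < m) A i) <= \sum_(i < m) vol n (A i))%N.
Proof.
elim: m => [|m IH].
  by rewrite big_ord0 (@eq_vol n _ set0) ?vol0// => x; split=> [[i]|[]].
rewrite big_ord_recr/= (leq_trans _ (leq_add IH (leqnn _)))// -[X in (_ <= X)%N]/(_ + _)%N.
apply: leq_trans (volU _ _ _); apply: vol_sub => x [i /= im Ai].
have [eim|ne] := eqVneq i m; first by right; rewrite -eim.
by left; exists i => //=; lia.
Qed.

Lemma vol_agree n x : vol n [set w | agree n w x] = 1%N.
Proof.
rewrite /vol (_ : [set t : n.-tuple bool | _]%SET = [set word x n]%SET) ?cards1//.
apply/setP => t; rewrite !inE; apply/asboolP/eqP => [tx|->].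
  by rewrite -(wordK t); apply/word_agree.
exact: agree_word.
Qed.

Lemma vol_preimage n (th : cantor -> cantor) (A : set cantor) :
  (forall x y, agree n (th x) (th y) -> agree n x y) -> determined n A ->
  vol n (th @^-1` A) = vol n A.
Proof.
move=> thI nA; pose f (t : n.-tuple bool) := word (th (ext t)) n.
have fI : injective f.
  by move=> s t /word_agree/thI/word_agree; rewrite !wordK.
rewrite /vol -(card_preimset [set t : n.-tuple bool | `[< A (ext t) >]]%SET fI).
apply: eq_card => t; rewrite !inE; apply: asbool_equiv_eq.
by split; apply: nA; [apply: agree_sym|]; exact: agree_word.
Qed.

Lemma determined_ext n A x : determined n A -> A (ext (word x n)) <-> A x.
Proof. by move=> nA; split; apply: nA; [|apply: agree_sym]; exact: agree_word. Qed.

Lemma vol_translate n A z : determined n A -> vol n [set w | A (w \+' z)] = vol n A.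
Proof. by move=> nA; rewrite -(@vol_preimage n (cantor_add^~ z) A)// => x y /agree_addr. Qed.

Definition flip (p : nat) (w : cantor) : cantor := fun i => w i (+) (i == p).

Lemma flipK p w : flip p (flip p w) = w.
Proof. by apply/funext => i; rewrite /flip addbK. Qed.

Lemma agree_flip n p w : (n <= p)%N -> agree n (flip p w) w.
Proof. by move=> np i ilt; rewrite /flip (_ : i == p = false) ?addbF//; lia. Qed.

(* Flipping the bit at p exchanges the two halves of D. *)
Lemma vol_flip_half e n (p : cantor -> nat) (D B : set cantor) :
  (forall x y, agree e x y -> p x = p y) -> (forall x, e <= p x)%N ->
  determined n D -> determined n B -> (e <= n)%N ->
  (forall w, D w -> D (flip (p w) w)) -> (forall w, B (flip (p w) w) <-> ~ B w) ->
  (vol n (D `&` B) * 2 = vol n D)%N.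
Proof.
move=> pe ep nD nB en DB BB; pose th w := flip (p w) w.
have ath w : agree e (th w) w by apply: agree_flip.
have pth w : p (th w) = p w by apply: pe.
have thK w : th (th w) = w by rewrite {1}/th pth flipK.
have thI x y : agree n (th x) (th y) -> agree n x y.
  move=> xy i ilt; have pxy : p x = p y.
    by apply: pe => j je; rewrite -(ath x j je) -(ath y j je) xy//; exact: leq_trans en.
  by have := xy i ilt; rewrite /th /flip pxy => /addIb.
rewrite -(volID n D B) muln2 -addnn; congr (_ + _)%N.
rewrite -(vol_preimage thI (determinedI nD nB)); apply: eq_vol => w; split.
  by move=> [Dw /BB Bw]; split=> //; rewrite -[w]thK; exact: DB.
by move=> [Dw Bw]; split; [exact: DB|exact/BB].
Qed.

(** * Tables of entries and the independence of their translates *)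

Definition code e (w : cantor) : nat := enum_rank (word w e).

Lemma code_lt e w : (code e w < 2 ^ e)%N.
Proof. by rewrite -[2%N in X in (_ < X)%N]card_bool -[in X in (_ < X)%N]card_tuple ltn_ord. Qed.

Lemma code_agree e x y : code e x = code e y <-> agree e x y.
Proof.
split=> [xy|/word_agree xy]; last by rewrite /code xy.
by apply/word_agree; apply: enum_rank_inj; exact: val_inj.
Qed.

(* The coordinates from e on are read as a table with an entry of j bits for
   each word of length e; zeros e j y says that the entry of y|e vanishes. *)
Definition zeros e j : set cantor :=
  [set y | forall l, (l < j)%N -> y (e + j * code e y + l)%N = false].

Lemma table_lt e j l w : (l < j)%N -> (e + j * code e w + l < e + j * 2 ^ e)%N.
Proof. by move=> lj; have := code_lt e w; nia. Qed.

Lemma determined_zeros e j : determined (e + j * 2 ^ e) (zeros e j).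
Proof.
move=> x y xy xz l lj.
have -> : code e y = code e x.
  by apply/code_agree/agree_sym; apply: agree_le xy; exact: leq_addr.
by rewrite -xy ?xz// table_lt.
Qed.

(** The j bits are imposed one by one, each halving the count: the position read through w + u
    depends only on the first [e] bits of w, so flipping w there changes neither the position nor
    the bits already imposed. *)
Lemma vol_zeros e j n u (D : set cantor) : (e + j * 2 ^ e <= n)%N -> determined n D ->
  (forall w l, (l < j)%N -> D w -> D (flip (e + j * code e (w \+' u) + l) w)) ->
  (vol n (D `&` [set w | zeros e j (w \+' u)]) * 2 ^ j = vol n D)%N.
Proof.
move=> en nD DD; pose E k := [set w | forall l, (l < k)%N ->
  (w \+' u) (e + j * code e (w \+' u) + l)%N = false].
have cE x y : agree e x y -> code e (x \+' u) = code e (y \+' u).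
  by move=> xy; apply/code_agree; exact: agree_add.
have nE k : (k <= j)%N -> determined n (E k).
  move=> kj x y xy Ex l lk; rewrite -(cE x y); last by apply: agree_le xy; lia.
  rewrite -(Ex l lk); apply: (agree_add (agree_sym xy) (agree_refl u)).
  by have := @table_lt e j l (x \+' u) (leq_trans lk kj); lia.
suff H k : (k <= j)%N -> (vol n (D `&` E k) * 2 ^ k = vol n D)%N.
  by rewrite -[RHS](H j).
elim: k => [_|k IH kj].
  by rewrite expn0 muln1; apply: eq_vol => w; split=> [[]|].
have kj' := ltnW kj; rewrite -(IH kj') expnS mulnA; congr (_ * _)%N.
rewrite -(@vol_flip_half e n (fun w => e + j * code e (w \+' u) + k)%N (D `&` E k)
  [set w | (w \+' u) (e + j * code e (w \+' u) + k)%N = false]).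
- congr (_ * _)%N; apply: eq_vol => w; split.
    by move=> [Dw Ew]; split; [split=> // l lk; apply: Ew; lia|exact: Ew].
  move=> [[Dw Ew] wk]; split=> // l; rewrite ltnS leq_eqVlt => /predU1P[->//|].
  exact: Ew.
- by move=> x y xy; rewrite (cE x y).
- by move=> x; lia.
- by apply: determinedI => //; exact: nE.
- move=> x y xy /= <-; rewrite -(cE x y); last by apply: agree_le xy; lia.
  apply: (agree_add (agree_sym xy) (agree_refl u)).
  by have := @table_lt e j k (x \+' u) kj; lia.
- by lia.
- move=> w [Dw Ew]; split; first exact: DD.
  move=> l lk; rewrite (cE _ w); last by apply: agree_flip; lia.
  rewrite -(Ew l lk) /cantor_add /flip; congr (_ (+) _).
  by rewrite (_ : _ == _ = false) ?addbF//; lia.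
- move=> w /=; rewrite (cE _ w); last by apply: agree_flip; lia.
  rewrite /cantor_add /flip eqxx addbT.
  by case: (w _) => /=; case: (u _).
Qed.

(* The events w \in z_i + zeros e j are independent of each other, and of w|e. *)
Lemma vol_misses e j n (z : nat -> cantor) s (Q : set cantor) :
  (e + j * 2 ^ e <= n)%N -> determined e Q ->
  (forall i i', (i < i')%N -> (i' < s)%N -> ~ agree e (z i) (z i')) ->
  (vol n (Q `&` [set w | forall i, (i < s)%N -> ~ zeros e j (w \+' z i)]) * 2 ^ (j * s) =
   (2 ^ j - 1) ^ s * vol n Q)%N.
Proof.
move=> en eQ; elim: s => [|s IH] zd.
  rewrite muln0 !expn0 muln1 mul1n; apply: eq_vol => w; split=> [[]//|Qw].
  by split.
pose D k := Q `&` [set w | forall i, (i < k)%N -> ~ zeros e j (w \+' z i)].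
have nD k : determined n (D k).
  move=> x y xy [Qx xz]; split; first by apply: eQ Qx; apply: agree_le xy; lia.
  move=> i ik yz; apply: (xz i ik); apply: determined_zeros yz.
  by apply: agree_add => //; apply: agree_sym; apply: agree_le xy.
have IHs : (vol n (D s) * 2 ^ (j * s) = (2 ^ j - 1) ^ s * vol n Q)%N.
  by apply: IH => i i' ii' i's; apply: zd => //; exact: ltnW.
rewrite -/(D s.+1); have /(_ en (nD s)) := @vol_zeros e j n (z s) (D s).
have -> : D s.+1 = D s `&` ~` [set w | zeros e j (w \+' z s)].
  apply/seteqP; split=> w.
    by move=> [Qw wz]; split; [split=> // i ik; apply: wz; lia|exact: wz].
  move=> [[Qw wz] ws]; split=> // i; rewrite ltnS leq_eqVlt => /predU1P[->//|].
  exact: wz.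
have := volID n (D s) [set w | zeros e j (w \+' z s)].
set a := vol n (D s `&` _); set b := vol n (D s `&` _) => ab H.
have {}H : (a * 2 ^ j = a + b)%N.
  rewrite ab; apply: H => w l lj [Qw wz]; have fe : agree e
      (flip (e + j * code e (w \+' z s) + l) w) w by apply: agree_flip; lia.
  split; first by apply: eQ Qw; exact: agree_sym.
  move=> i ik fz; apply: (wz i ik) => l' lj'; have := fz l' lj'.
  have -> : code e (flip (e + j * code e (w \+' z s) + l) w \+' z i) = code e (w \+' z i).
    by apply/code_agree; exact: agree_add.
  (* Distinct prefixes read disjoint table entries: a flip in the entry read through [z s] leaves
     those read through the earlier [z i] intact. This is the independence. *)
  have cis : code e (w \+' z i) != code e (w \+' z s).
    apply/eqP => /code_agree; rewrite cantor_addC (cantor_addC w) => /agree_addr.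
    by apply: zd.
  rewrite /cantor_add /flip (_ : _ == _ = false) ?addbF//.
  apply/negP => /eqP.
  move: (code e _) (code e _) cis => c c'; rewrite neq_ltn => /orP[] lt.
    by have := leq_mul (leqnn j) lt; rewrite mulnS; lia.
  by have := leq_mul (leqnn j) lt; rewrite mulnS; lia.
rewrite mulnS expnD expnS -[RHS]mulnA -IHs -ab !mulnA; congr (_ * _)%N.
have := expn_gt0 2 j; case: (2 ^ j)%N H => // k H _.
by rewrite subn1/=; nia.
Qed.

(** * Null sets *)

Lemma compact_nat_cover (T : topologicalType) (C : set T) (F : nat -> set T) :
  compact C -> (forall i, open (F i)) -> C `<=` \bigcup_i F i ->
  exists N, C `<=` \bigcup_(i < N) F i.
Proof.
move=> cC oF CF; apply: contrapT => nN.
pose B N := C `\` \bigcup_(i < N) F i.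
have FF : ProperFilter (filter_from [set: nat] B).
  apply: filter_from_proper => [|N _]; last first.
    apply/set0P/negP => /eqP B0; apply: nN; exists N => x Cx; apply: contrapT => Fx.
    by have : B N x by []; rewrite B0.
  apply: filter_fromT_filter => [|m n]; first by exists 0%N.
  exists (maxn m n) => x [Cx Fx]; split; split=> // -[i /= im Fi]; apply: Fx; exists i => //=.
    by rewrite (leq_trans im)// leq_maxl.
  by rewrite (leq_trans im)// leq_maxr.
have [|z [Cz clz]] := cC _ FF; first by exists 0%N => // x [].
have [j _ Fz] := CF z Cz.
have [||x [[_ Bx] Fx]] := clz (B j.+1) (F j).
- by exists j.+1.
- exact: open_nbhs_nbhs.
- by apply: Bx; exists j => //=.
Qed.

Section haar_null.
Variable R : realType.

Definition dens n (A : set cantor) : R := (vol n A)%:R * 2^-1 ^+ n.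

Lemma dens_ge0 n A : 0 <= dens n A.
Proof. by rewrite mulr_ge0// exprn_ge0// invr_ge0. Qed.

Lemma determined_dens n A : determined n A -> cylinder_frac R n A = dens n A.
Proof.
move=> nA; rewrite /cylinder_frac -mulr_suml -natr_sum; congr (_%:R * _).
rewrite /vol -sum1_card [RHS]big_mkcond/=; apply: eq_bigr => t _; rewrite in_vol.
have -> : `[< cylinder t `<=` A >] = `[< A (ext t) >]; last by case: asboolP.
apply: asbool_equiv_eq; split=> [tA|At x xt].
  by apply: tA => i; rewrite /ext (tnth_nth false).
by apply: nA At => i ilt; rewrite (xt (Ordinal ilt)) /ext (tnth_nth false).
Qed.

Lemma determined_haar n A : determined n A -> haar R A = (dens n A)%:E.
Proof.
move=> nA; rewrite -determined_dens//.
transitivity (@haar_content R A); first by apply: measurable_mu_extE; exists n.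
exact: haar_contentE.
Qed.

Local Notation mcantor := (g_sigma_algebraType (@measurable _ cantor_clopen_type)).

Lemma determined_measurable n (A : set cantor) : determined n A ->
  measurable (A : set mcantor).
Proof. by move=> nA; apply: sub_sigma_algebra; exists n. Qed.

Lemma determined_dens_le m n A : (m <= n)%N -> determined m A -> dens n A = dens m A.
Proof.
move=> mn mA; rewrite -!determined_dens//; last exact: determined_le mA.
exact: determined_cylinder_frac.
Qed.

Lemma haar_bigcup_le (F : nat -> set cantor) (n : nat -> nat) (e : R) :
  (forall i, determined (n i) (F i)) ->
  (forall N, \sum_(i < N) dens (n i) (F i) <= e) -> (haar R (\bigcup_i F i) <= e%:E)%E.
Proof.
move=> nF Fe; apply: (@le_trans _ _ (\sum_(i <oo) haar R (F i)))%E.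
  have mF i : measurable (F i : set mcantor) := determined_measurable (nF i).
  by apply: measure_sigma_subadditive => //; exact: bigcup_measurable.
apply: lime_le; first by apply: is_cvg_nneseries => *; exact: measure_ge0.
apply: nearW => N; rewrite big_mkord.
rewrite (eq_bigr (fun i : 'I_N => (dens (n i) (F i))%:E)) ?sumEFin ?lee_fin; first exact: Fe.
by move=> i _; exact: determined_haar.
Qed.

Definition null (A : set cantor) := forall e : R, 0 < e ->
  exists (F : nat -> set cantor) (n : nat -> nat),
  [/\ forall i, determined (n i) (F i), A `<=` \bigcup_i F i &
      forall N, \sum_(i < N) dens (n i) (F i) <= e].

Lemma negligible_null A : (haar R).-negligible A -> null A.
Proof.
move=> [B [mB B0 AB]] e e0.
have : (haar R B < e%:E)%E by rewrite B0 lte_fin.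
move=> /ereal_inf_lt[_ [F [mF BF] <-] Fe].
have /choice[n nF] : forall i, exists n, determined n (F i) by [].
exists F, n; split=> // [x /AB/BF//|N].
rewrite -lee_fin -sumEFin; apply: le_trans (ltW Fe).
rewrite (eq_bigr (fun i : 'I_N => @haar_content R (F i))); last first.
  by move=> i _; rewrite (haar_contentE R (nF i)) determined_dens.
rewrite -(big_mkord xpredT (fun i => @haar_content R (F i))).
apply: nneseries_lim_ge => k _ _; exact: measure_ge0.
Qed.

Lemma null_negligible A : null A -> (haar R).-negligible A.
Proof.
move=> A0.
have /choice[Fn FnP] : forall m, exists Fn : (nat -> set cantor) * (nat -> nat),
    [/\ forall i, determined (Fn.2 i) (Fn.1 i), A `<=` \bigcup_i Fn.1 i &
      forall N, \sum_(i < N) dens (Fn.2 i) (Fn.1 i) <= (m.+1%:R)^-1].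
  move=> m; have [|F [n Fn]] := A0 (m.+1%:R)^-1; first by rewrite invr_gt0.
  by exists (F, n).
pose U m : set mcantor := \bigcup_i (Fn m).1 i.
have mU m : measurable (U m).
  apply: bigcup_measurable => i _.
  by have [/(_ i)/determined_measurable] := FnP m.
have Um m : (haar R (U m) <= ((m.+1%:R)^-1)%:E)%E.
  by have [mF _ Fm] := FnP m; exact: haar_bigcup_le mF Fm.
exists (\bigcap_m U m); split; first exact: bigcap_measurable.
- apply/eqP; rewrite eq_le measure_ge0 andbT; apply/lee_addgt0Pr => e e0.
  rewrite add0e; have [m me] : exists m, (m.+1%:R)^-1 <= e :> R.
    by have [m] := ltr_add_invr e0; rewrite add0r => /ltW; exists m.
  apply: (@le_trans _ _ ((m.+1%:R)^-1)%:E); last by rewrite lee_fin.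
  apply: le_trans (Um m); apply: le_measure; rewrite ?inE//.
    exact: bigcap_measurable.
  by apply: bigcap_inf.
- by move=> x Ax m _; have [_ /(_ x Ax)] := FnP m.
Qed.

Lemma closed_cover_finite (C : set cantor) (F : nat -> set cantor) (n : nat -> nat) :
  closed C -> (forall i, determined (n i) (F i)) -> C `<=` \bigcup_i F i ->
  exists N, C `<=` \bigcup_(i < N) F i.
Proof.
move=> Ccl nF CF; apply: compact_nat_cover => [|i|//].
  by apply: subclosed_compact Ccl cantor_space_compact _.
exact: (determined_open R (nF i)).
Qed.

Lemma closed_null_dens (C : set cantor) (e : R) : closed C -> (haar R).-negligible C -> 0 < e ->
  exists n V, [/\ determined n V, C `<=` V & dens n V <= e].
Proof.
move=> Ccl /negligible_null/[apply] -[F [n [nF CF Fe]]].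
have [N CN] := closed_cover_finite Ccl nF CF.
pose m := (\max_(i < N) n i)%N.
have nm (i : 'I_N) : (n i <= m)%N by exact: (@leq_bigmax _ (fun i : 'I_N => n i)).
exists m, (\bigcup_(i < N) F i); split=> //.
  move=> x y xy [i iN Fx]; exists i => //.
  by apply: nF Fx => j jn; apply: xy; apply: leq_trans jn (nm (Ordinal iN)).
apply: le_trans (Fe N).
apply: (@le_trans _ _ (\sum_(i < N) dens m (F i))).
  by rewrite /dens -mulr_suml -natr_sum ler_wpM2r ?exprn_ge0 ?invr_ge0// ler_nat vol_bigcup.
by apply: ler_sum => i _; rewrite (determined_dens_le (nm i)).
Qed.

End haar_null.

(** * Null-additive sets *)

Section pstar_null_additive.
Variable R : realType.

Lemma dens_bigcup n m (A : nat -> set cantor) :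
  dens R n (\bigcup_(i < m) A i) <= \sum_(i < m) dens R n (A i).
Proof.
by rewrite /dens -mulr_suml -natr_sum ler_wpM2r ?exprn_ge0 ?invr_ge0// ler_nat vol_bigcup.
Qed.

Lemma dens_sub n A B : A `<=` B -> dens R n A <= dens R n B.
Proof. by move=> AB; rewrite ler_wpM2r ?exprn_ge0 ?invr_ge0// ler_nat vol_sub. Qed.

Lemma small_tails (a : nat -> R) (M d : R) : (forall i, 0 <= a i) ->
  (forall N, \sum_(i < N) a i <= M) -> 0 < d ->
  exists T, forall T', (T <= T')%N -> forall N, \sum_(i < N) a (T' + i)%N <= d.
Proof.
move=> a0 aM d0; pose S := range (fun N => \sum_(i < N) a i).
have hS : has_sup S.
  by split; [exists 0, 0%N; rewrite ?big_ord0|exists M => _ [N _ <-]].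
have [_ [T _ <-] ST] := sup_adherent d0 hS.
exists T => T' TT' N.
have : \sum_(i < T' + N) a i <= sup S by apply: ub_le_sup; [exact: hS.2|exists (T' + N)%N].
have : \sum_(i < T) a i <= \sum_(i < T') a i.
  rewrite -(subnKC TT') big_split_ord/= lerDl; exact: sumr_ge0.
rewrite big_split_ord/=; lra.
Qed.

Lemma geometric_sum_le (K N : nat) : \sum_(i < N) (2^-1 : R) ^+ (K + i) <= 2^-1 ^+ K * 2.
Proof.
suff -> : \sum_(i < N) (2^-1 : R) ^+ (K + i) = 2^-1 ^+ K * 2 - 2^-1 ^+ K * 2 * 2^-1 ^+ N.
  by rewrite lerBlDr lerDl !mulr_ge0 ?exprn_ge0 ?invr_ge0.
elim: N => [|N IH]; first by rewrite big_ord0 expr0 mulr1 subrr.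
rewrite big_ord_recr/= IH exprD exprS; lra.
Qed.

(** For each j, a clopen covering of [A] of measure at most 8^(-j) is cut into groups, the k-th one,
    for k >= j, having measure at most 8^(-k). [C k] joins the k-th groups of the coverings 0, ...,
    k, whence (k+1) 8^(-k) <= 4^(-k). A point of [A] lies in each covering j, so in some [C k] with
    k >= j. *)
Lemma null_limsup A : null R A -> exists (h : nat -> nat) (C : nat -> set cantor),
  [/\ forall k, determined (h k) (C k), forall k, dens R (h k) (C k) <= 4^-1 ^+ k &
      forall x k0, A x -> exists2 k, (k0 <= k)%N & C k x].
Proof.
move=> A0.
have /choice[Fn FnP] : forall j, exists Fn : (nat -> set cantor) * (nat -> nat),
    [/\ forall i, determined (Fn.2 i) (Fn.1 i), A `<=` \bigcup_i Fn.1 i &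
      forall N, \sum_(i < N) dens R (Fn.2 i) (Fn.1 i) <= 8^-1 ^+ j].
  move=> j; have [|F [n Fn]] := A0 (8^-1 ^+ j); first by rewrite exprn_gt0// invr_gt0.
  by exists (F, n).
pose a j i := dens R ((Fn j).2 i) ((Fn j).1 i).
have /choice[T TP] : forall jk : nat * nat, exists T, forall T', (T <= T')%N ->
    forall N, \sum_(i < N) a jk.1 (T' + i)%N <= 8^-1 ^+ jk.2.
  move=> [j k]; have [_ _ Fj] := FnP j; apply: small_tails Fj _ => [i|].
    exact: dens_ge0.
  by rewrite exprn_gt0// invr_gt0.
(* The groups of covering j begin at k = j with the first set of the sequence; that first group is
   bounded by the full sum, at most 8^(-j). *)
pose N j k := if (k <= j)%N then 0%N else maxn k (T (j, k)).
pose L j k := (N j k.+1 - N j k)%N.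
have sumN j k : (j <= k)%N -> \sum_(i < L j k) a j (N j k + i)%N <= 8^-1 ^+ k.
  rewrite leq_eqVlt => /predU1P[<-|jk].
    have -> : N j j = 0%N by rewrite /N leqnn.
    by have [_ _] := FnP j; apply.
  by apply: (TP (j, k)); rewrite /N (leqNgt k j) jk leq_maxr.
pose D j k := \bigcup_(i < L j k) (Fn j).1 (N j k + i)%N.
pose h k := (\max_(j < k.+1) \max_(i < N j k.+1) (Fn j).2 i)%N.
have nh j k i : (j <= k)%N -> (i < L j k)%N -> ((Fn j).2 (N j k + i) <= h k)%N.
  move=> jk iL; have jk' : (j < k.+1)%N by [].
  apply: leq_trans (@leq_bigmax _
    (fun j : 'I_k.+1 => \max_(i < N j k.+1) (Fn j).2 i)%N (Ordinal jk')) => /=.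
  have iN : (N j k + i < N j k.+1)%N by move: iL; rewrite /L; lia.
  exact: (@leq_bigmax _ (fun i : 'I_(N j k.+1) => (Fn j).2 i) (Ordinal iN)).
have nD j k i : (j <= k)%N -> (i < L j k)%N -> determined (h k) ((Fn j).1 (N j k + i)%N).
  by move=> jk iL; have [/(_ (N j k + i)%N)] := FnP j; move/(determined_le (nh _ _ _ jk iL)).
exists h, (fun k => \bigcup_(j < k.+1) D j k); split.
- move=> k x y xy [j /= jk [i /= iL Fx]]; exists j => //; exists i => //.
  by apply: nD Fx.
- move=> k; apply: le_trans (dens_bigcup _ _ _) _.
  apply: (@le_trans _ _ (\sum_(j < k.+1) 8^-1 ^+ k)).
    apply: ler_sum => -[j /= jk] _. apply: le_trans (sumN j k jk).
    apply: le_trans (dens_bigcup _ _ _) _; apply: ler_sum => -[i /= iL] _.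
    by rewrite /a -(determined_dens_le _ (nh j k i jk iL))//; have [] := FnP j.
  rewrite sumr_const card_ord -[_ *+ k.+1]mulr_natl.
  rewrite (_ : 8^-1 = 2^-1 * 4^-1 :> R); last by lra.
  rewrite exprMn mulrA ler_piMl ?exprn_ge0 ?invr_ge0// exprVn.
  by rewrite ler_pdivrMr ?exprn_gt0// mul1r -natrX ler_nat ltn_expl.
- move=> x j Ax; have [_ /(_ x Ax)[i _ Fx] _] := FnP j.
  have exk : exists k, (i < N j k)%N.
    by exists (maxn j i).+1; rewrite /N ifF ?leq_max; lia.
  case: (ex_minnP exk) => -[|k] ik kmin; first by move: ik; rewrite /N.
  have jk : (j <= k)%N by rewrite leqNgt; apply/negP => kj; move: ik; rewrite /N kj ltn0.
  exists k => //; exists j => //=.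
  have Nki : (N j k <= i)%N by rewrite leqNgt; apply/negP => /kmin; rewrite ltnn.
  by exists (i - N j k)%N; rewrite /= ?subnKC// /L; lia.
Qed.

(** Borel-Cantelli: the sets from a large index on cover [A] with small total measure. *)
Lemma limsup_null A (h : nat -> nat) (V : nat -> set cantor) k0 :
  (forall k, (k0 <= k)%N -> determined (h k) (V k)) ->
  (forall k, (k0 <= k)%N -> dens R (h k) (V k) <= 2^-1 ^+ k) ->
  (forall x N, A x -> exists2 k, (N <= k)%N & V k x) -> null R A.
Proof.
move=> hV Vk AV e e0; have [|K Ke] := @half_expr_lt R (e / 2); first by rewrite divr_gt0.
pose k1 := maxn k0 K; have k01 i : (k0 <= k1 + i)%N by rewrite /k1; lia.
exists (fun i => V (k1 + i)%N), (fun i => h (k1 + i)%N); split.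
- by move=> i; exact: hV.
- by move=> x /(AV _ k1)[k kk Vx]; exists (k - k1)%N => //; rewrite subnKC.
- move=> N; apply: (@le_trans _ _ (\sum_(i < N) 2^-1 ^+ (k1 + i))).
    by apply: ler_sum => i _; exact: Vk.
  apply: le_trans (geometric_sum_le _ _) _; rewrite -ler_pdivlMr//.
  apply: le_trans (ltW Ke); rewrite ler_iXn2l ?invr_gt0 ?invf_lt1 ?ltr1n//.
  exact: leq_maxr.
Qed.

(** For large k, adding a piece of [X] to [C k] stays within k translates of [C k], of total measure
    k 4^(-k) <= 2^(-k). *)
Lemma Pstar_null_additive X : Pstar X -> additive_for (ideal_N R) X.
Proof.
move=> XP A /negligible_null/null_limsup[h [C [hC Ck AC]]].
have [Xm [XX Xc]] := XP h.
suff XmA m : (haar R).-negligible (sumset (Xm m) A).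
  apply: negligibleS (negligible_bigcup XmA).
  by move=> _ [x /XX[m _ xm] [y Ay <-]]; exists m => //; exists x => //; exists y.
apply: null_negligible; have [k0 k0P] := Xc m.
have /choice[z zP] : forall k, exists z : nat -> cantor, (k0 <= k)%N ->
    forall x, Xm m x -> exists2 i, (i < k)%N & agree (h k) x (z i).
  move=> k; case: (leqP k0 k) => [/k0P[z zP]|_]; first by exists z.
  by exists (fun=> point).
pose V k := \bigcup_(i < k) [set w | C k (w \+' z k i)].
have nV k i : determined (h k) [set w | C k (w \+' z k i)] by exact: determined_translate.
apply: (@limsup_null _ h V k0).
- by move=> k _ x y xy [i ik Cx]; exists i => //; apply: nV Cx.
- move=> k _; apply: le_trans (dens_bigcup _ _ _) _.
  apply: (@le_trans _ _ (\sum_(i < k) 4^-1 ^+ k)).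
    by apply: ler_sum => i _; rewrite /dens vol_translate; [exact: Ck|exact: hC].
  rewrite sumr_const card_ord -[_ *+ k]mulr_natl.
  rewrite (_ : 4^-1 = 2^-1 * 2^-1 :> R); last by lra.
  rewrite exprMn mulrA ler_piMl ?exprn_ge0 ?invr_ge0// exprVn.
  by rewrite ler_pdivrMr ?exprn_gt0// mul1r -natrX ler_nat ltnW// ltn_expl.
- move=> _ N [x xm [y Ay <-]]; have [k kN Cy] := AC y (maxn N k0) Ay.
  exists k; first by lia.
  have [|i ik xz] := zP k _ x xm; first by lia.
  exists i => //=; apply: hC Cy; apply: agree_sym.
  rewrite cantor_addC -[X in agree _ _ X](cantor_addK y x) (cantor_addC y).
  rewrite cantor_addC; apply: agree_add => //; exact: agree_sym.
Qed.
End pstar_null_additive.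

(** * From null-additivity to coverings, through Baire's theorem *)

Section null_additive_pstar.
Variable R : realType.

Lemma cantor_baire (K : set cantor) (F : nat -> set cantor) : closed K -> K !=set0 ->
  (forall N, closed (F N)) -> K `<=` \bigcup_N F N ->
  exists y n N, K y /\ forall w, K w -> agree n w y -> F N w.
Proof.
move=> Kcl [y0 Ky0] Fcl KF; apply: contrapT => H.
have step (p : cantor * nat * nat) : exists q : cantor * nat, K p.1.1 ->
    [/\ K q.1, agree p.1.2 p.1.1 q.1, (p.1.2 < q.2)%N &
        forall w, agree q.2 q.1 w -> ~ F p.2 w].
  case: p => -[y n] N /=; have [Ky|nKy] := pselect (K y); last by exists (y, n).
  have [w [Kw wy nFw]] : exists w, [/\ K w, agree n w y & ~ F N w].
    apply: contrapT => nw; apply: H; exists y, n, N; split => // w Kw wy.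
    by apply: contrapT => nFw; apply: nw; exists w.
  have [m mF] : exists m, forall w', agree m w w' -> ~ F N w'.
    apply: contrapT => nm; apply: nFw; apply/(cantor_closedP R _).1 => // m.
    apply: contrapT => nF; apply: nm; exists m => w' ww' Fw'; apply: nF.
    by exists w'.
  exists (w, maxn n.+1 m) => _ /=; split=> //; first exact: agree_sym.
    exact: leq_maxl.
  by move=> w' ww'; apply: mF; apply: agree_le ww'; exact: leq_maxr.
have [St StP] := choice step.
pose s := fix s i := if i is i'.+1 then St (s i', i') else (y0, 0%N).
have Ks i : K (s i).1 by elim: i => //= i IH; have [] := StP (s i, i) IH.
have sP i := StP (s i, i) (Ks i).
have sS i : ((s i).2 < (s i.+1).2)%N by have [] := sP i.
have s_agree i j : (i <= j)%N -> agree (s i).2 (s i).1 (s j).1.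
  elim: j => [|j IH]; first by rewrite leqn0 => /eqP ->.
  rewrite leq_eqVlt => /predU1P[->//|ij]; apply: agree_trans (IH ij) _.
  have [_ + _ _] := sP j; apply: agree_le.
  exact: (increasing_le (g := fun i => (s i).2) sS).
pose z : cantor := fun i => (s i.+1).1 i.
have zs i : agree (s i).2 (s i).1 z.
  move=> j ji; rewrite /z; have [ij|ij] := leqP i j.
    by rewrite (s_agree i j.+1)// (leq_trans ij).
  rewrite (s_agree j.+1 i)//.
  exact: (increasing_ge (g := fun i => (s i).2) sS j.+1).
have Kz : K z.
  apply/(cantor_closedP R _).1 => // n; exists (s n).1 => //.
  apply: agree_sym; apply: agree_le (zs n).
  exact: (increasing_ge (g := fun i => (s i).2) sS n).
by have [N _ Fz] := KF z Kz; have [_ _ _ /(_ z (zs N.+1))] := sP N.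
Qed.

Definition cyl (s : seq bool) : set cantor := [set w | agree (size s) w (ext s)].

Lemma determined_cyl s : determined (size s) (cyl s).
Proof. exact: determined_agree. Qed.

Definition baire_code (i : nat) : seq bool * nat := odflt ([::], 0%N) (unpickle i).

(** Makes Baire's theorem uniform: all points of a piece share one cylinder meeting [K] and one
    index, and there are countably many such pairs. *)
Definition baire_piece (K : set cantor) (F : cantor -> nat -> set cantor) i :=
  [set x : cantor | (exists2 y, K y & cyl (baire_code i).1 y) /\
    forall w, K w -> cyl (baire_code i).1 w -> F x (baire_code i).2 w].

Lemma baire_pieces (X K : set cantor) (F : cantor -> nat -> set cantor) :
  closed K -> K !=set0 -> (forall x N, closed (F x N)) ->
  (forall x, X x -> K `<=` \bigcup_N F x N) -> X `<=` \bigcup_i baire_piece K F i.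
Proof.
move=> Kcl K0 Fcl XF x Xx.
have [y [n [N [Ky yN]]]] := cantor_baire Kcl K0 (Fcl x) (XF x Xx).
exists (pickle (mkseq y n, N)) => //; rewrite /baire_piece /baire_code pickleK/=.
have cyly w : cyl (mkseq y n) w -> agree n w y.
  move=> ws; apply: agree_trans (agree_sym (@agree_ext n y)) => j jn.
  by apply: ws; rewrite size_mkseq.
split; last by move=> w Kw /cyly wy; exact: yN.
by exists y => // j; rewrite size_mkseq; apply: agree_ext.
Qed.

Lemma bernoulli_le (p : R) s : 0 <= p <= 1 -> (1 - p) ^+ s * (1 + s%:R * p) <= 1.
Proof.
move=> /andP[p0 p1]; elim: s => [|s IH]; first by rewrite expr0 mul0r addr0 mulr1.
apply: le_trans IH; rewrite exprSr -mulrA ler_wpM2l ?exprn_ge0 ?subr_ge0//.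
by rewrite -natr1; have := ler0n R s; nra.
Qed.

Lemma dens_zeros e j n u : (e + j * 2 ^ e <= n)%N ->
  dens R n [set w | zeros e j (w \+' u)] = 2^-1 ^+ j.
Proof.
move=> en; have := @vol_zeros e j n u setT en (fun _ _ _ _ => I) (fun _ _ _ _ => I).
rewrite volT setTI => /(congr1 (fun k => k%:R : R)); rewrite natrM !natrX /dens => H.
have X0 k : (2 : R) ^+ k != 0 by rewrite expf_neq0.
by apply: (mulIf (X0 j)); rewrite mulrAC H !exprVn mulfV// mulVf.
Qed.

Lemma dens_misses e j n (z : nat -> cantor) s : (e + j * 2 ^ e <= n)%N ->
  (forall i i', (i < i')%N -> (i' < s)%N -> ~ agree e (z i) (z i')) ->
  dens R n [set w | forall i, (i < s)%N -> ~ zeros e j (w \+' z i)] =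
  (1 - 2^-1 ^+ j) ^+ s.
Proof.
move=> en zd; have := @vol_misses e j n z s setT en (fun _ _ _ _ => I) zd.
rewrite volT setTI => /(congr1 (fun k => k%:R : R)).
rewrite !natrM !natrX natrB ?expn_gt0// natrX /dens => H.
have X0 k : (2 : R) ^+ k != 0 by rewrite expf_neq0.
apply: (mulIf (X0 (j * s)%N)); rewrite mulrAC H exprM -exprMn mulrBl mul1r !exprVn mulVf//.
by rewrite mulfK.
Qed.

(* x \in X sends the part of K inside a cylinder into the complement of the
   clopen sets C_k, k >= N; then the prefixes x|h(k) are few, since the
   translates of C_k = zeros by points with distinct prefixes are independent. *)
Lemma null_additive_Pstar X : additive_for (ideal_N R) X -> Pstar X.
Proof.
move=> XN; apply: Pstar_pow => h.
(* Entries of 2k bits give [C k] the measure 4^(-k), which is summable, whereas 8^k independent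
   translates miss a point with probability (1 - 4^(-k))^(8^k), which tends to 0. *)
pose n k := (h k + (2 * k) * 2 ^ h k)%N.
pose C k := zeros (h k) (2 * k).
have nC k : determined (n k) (C k) by exact: determined_zeros.
pose A := [set y | forall N, exists2 k, (N <= k)%N & C k y].
have A0 : (haar R).-negligible A.
  apply: null_negligible; apply: (@limsup_null R A n C 0) => // k _.
  have -> : C k = [set w | zeros (h k) (2 * k) (w \+' (fun=> false))].
    by apply/funext => w /=; rewrite cantor_add0.
  rewrite dens_zeros// ler_iXn2l ?invr_gt0 ?invf_lt1 ?ltr1n//; lia.
have /negligible_null/(_ 2^-1)[] := XN _ A0; first by rewrite invr_gt0.
move=> F [m [mF XAF Fle]].
pose U := \bigcup_i F i.
pose mcantor := g_sigma_algebraType (@measurable _ cantor_clopen_type).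
have mU : measurable (U : set mcantor).
  by apply: bigcup_measurable => i _; exact: determined_measurable (mF i).
have U2 : (haar R U <= (2^-1)%:E)%E by exact: haar_bigcup_le mF Fle.
have mcyl s : measurable (cyl s : set mcantor) := determined_measurable (@determined_cyl s).
have mK : measurable (~` U : set mcantor) by exact: measurableC.
pose sg i : seq bool := odflt [::] (unpickle i).
have sgK s : sg (pickle s) = s by rewrite /sg pickleK.
(* Removing the basic cylinders in which the complement of [U] is null gives every nonempty
   relatively open subset of [K] positive measure. *)
pose Z := \bigcup_(i in [set i | haar R (~` U `&` cyl (sg i)) = 0%E]) cyl (sg i).
have mZ : measurable (Z : set mcantor) by apply: bigcup_measurable.
pose K := ~` (U `|` Z).
have ZU0 : haar R (~` U `&` Z) = 0%E.
  apply/negligibleP; first exact: measurableI.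
  rewrite setI_bigcupr bigcup_mkcond; apply: negligible_bigcup => i.
  case: ifPn => [|_]; last exact: negligible_set0.
  rewrite inE => i0; apply/negligibleP => //; exact: measurableI.
have mKs s : measurable (K `&` cyl s : set mcantor).
  by apply: measurableI => //; apply: measurableC; exact: measurableU.
have Kcyl y s : K y -> cyl s y -> (0 < haar R (K `&` cyl s))%E.
  move=> Ky sy; rewrite lt_def measure_ge0 andbT; apply/eqP => Ks0.
  apply: Ky; right; exists (pickle s); rewrite ?sgK//= sgK.
  apply/eqP; rewrite eq_le measure_ge0 andbT.
  have -> : ~` U `&` cyl s = (K `&` cyl s) `|` (~` U `&` Z `&` cyl s).
    apply/seteqP; split=> w.
      move=> [Uw sw]; have [Zw|Zw] := pselect (Z w); first by right.
      by left; split=> // -[].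
    by move=> [[UZ sw]|[[Uw _] sw]]; split=> // Uw; apply: UZ; left.
  apply: le_trans (measureU2 _ _ _) _ => //.
    by apply: measurableI => //; exact: measurableI.
  rewrite [X in (X + _)%E](Ks0 : _ = _) add0e -ZU0; apply: le_measure; rewrite ?inE//.
    by apply: measurableI => //; exact: measurableI.
  exact: measurableI.
have K0 : K !=set0.
  apply/set0P/negP => /eqP K0.
  have : (haar R setT <= haar R U + haar R (~` U `&` Z))%E.
    apply: le_trans (measureU2 _ _ _) => //; last exact: measurableI.
    apply: le_measure; rewrite ?inE//.
      by apply: measurableU => //; exact: measurableI.
    move=> w _; have [Uw|Uw] := pselect (U w); first by left.
    right; split=> //; apply: contrapT => Zw.
    have : K w by case.
    by rewrite K0.
  rewrite [X in (_ + X)%E](ZU0 : _ = _) adde0 (@determined_haar R 0)//.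
  rewrite /dens volT expr0 mulr1 => /le_trans/(_ U2).
  by rewrite lee_fin leNgt invf_lt1 ?ltr1n.
have Kcl : closed K.
  apply/(cantor_closedP R) => x xK [[i _ Fx]|[i i0 Zx]].
    have [y Ky xy] := xK (m i); apply: Ky; left; exists i => //.
    exact: mF Fx.
  have [y Ky xy] := xK (size (sg i)); apply: Ky; right; exists i => //.
  exact: determined_cyl Zx.
pose F' x N := [set w | forall k, (N <= k)%N -> ~ C k (w \+' x)].
exists (baire_piece K F'); split=> [|i].
  apply: baire_pieces => // [x N|x Xx w Kw].
    apply/(cantor_closedP R) => w wN k Nk Cw.
    have [w' w'N ww'] := wN (n k); apply: (w'N k Nk).
    by apply: nC Cw; exact: agree_add.
  apply: contrapT => H; apply: Kw; left; apply: XAF.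
  exists x => //; exists (w \+' x); last by rewrite cantor_addC cantor_addK.
  move=> N; apply: contrapT => HN; apply: H; exists N => //= k Nk Cw.
  by apply: HN; exists k.
have [[y Ky yi]|nK] := pselect (exists2 y, K y & cyl (baire_code i).1 y); last first.
  by exists 0%N => k _; exists (fun=> point) => x [].
have Kpos := Kcyl _ _ Ky yi.
have [r r0 rK] : exists2 r : R, 0 < r & (r%:E <= haar R (K `&` cyl (baire_code i).1))%E.
  move: Kpos; case: (haar R _) => [r|_|]; first by rewrite lte_fin => r0; exists r.
    by exists 1; rewrite ?leey.
  by rewrite ltNge leNye.
have [k0 k0r] := half_expr_lt r0.
exists (maxn k0 (baire_code i).2) => k; rewrite geq_max => /andP[kk0 ki].
apply: contrapT => /not_covered[z [zX zd]].
have zd' p q : (p < q)%N -> (q < 8 ^ k)%N -> ~ agree (h k) (z p) (z q).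
  by move=> pq q8; apply: zd => //; exact: ltnW.
pose D := [set w | forall i, (i < 8 ^ k)%N -> ~ zeros (h k) (2 * k) (w \+' z i)].
have nD : determined (n k) D.
  move=> x x' xx' Dx p pk Cz; apply: (Dx p pk); apply: nC Cz.
  by apply: agree_add => //; exact: agree_sym.
have KD : (haar R (K `&` cyl (baire_code i).1) <= haar R D)%E.
  apply: le_measure; rewrite ?inE//; first exact: determined_measurable nD.
  by move=> w [Kw wi] p pk; apply: (zX p (ltnW pk)).2.
have := le_trans rK KD; rewrite (determined_haar R nD) (dens_misses (leqnn _) zd') lee_fin.
have p01 : 0 <= (2^-1 : R) ^+ (2 * k) <= 1.
  apply/andP; split; first by rewrite exprn_ge0// invr_ge0.
  by apply: exprn_ile1; rewrite ?invr_ge0// invf_le1 ?ler1n.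
(* For p = 4^(-k) and 8^k factors this bounds the measure of [D] by 1/(1 + 2^k), while k >= k0 gives
   r 2^k > 1. *)
have := bernoulli_le (8 ^ k) p01.
have X0 : (2 : R) ^+ k != 0 by rewrite expf_neq0.
have -> : (8 ^ k)%:R * 2^-1 ^+ (2 * k) = 2 ^+ k :> R.
  rewrite natrX (_ : 8 = 2 * (2 * 2) :> R); last by lra.
  by rewrite exprMn -[2 * 2]expr2 -exprM exprVn -mulrA mulfV ?mulr1// expf_neq0.
have k0r' : 2^-1 ^+ k < r.
  by apply: le_lt_trans k0r; rewrite ler_iXn2l ?invr_gt0 ?invf_lt1 ?ltr1n.
have r2 : 1 < r * 2 ^+ k by rewrite -ltr_pdivrMr ?exprn_gt0// div1r -exprVn.
move=> bern rb; have : r * (1 + 2 ^+ k) <= 1.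
  by apply: le_trans bern; rewrite ler_wpM2r// addr_ge0// exprn_ge0.
by rewrite mulrDr mulr1; lra.
Qed.

End null_additive_pstar.

(** * E-additive sets *)

Section closed_null_additive.
Variable R : realType.

Lemma agree_cancel n x y z : agree n x z -> agree n ((x \+' y) \+' z) y.
Proof.
move=> xz; rewrite -[X in agree _ _ X](cantor_addK y x) (cantor_addC x).
by apply: agree_add => //; exact: agree_sym.
Qed.

(** If x agrees with [t k] up to [h k], then x + C j is inside V k + t k for j <= k. The sets of the
    union are closed because each block of indices is finite, and null because their points lie in
    infinitely many [W k], of measure at most 2^(-k). *)
Lemma Ssharp_closed_null_additive X : Ssharp X -> additive_for (ideal_E R) X.
Proof.
move=> XS A [C [Cn AC]].
have /choice[nV nVP] : forall k, exists nV : nat * set cantor,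
    [/\ determined nV.1 nV.2, \bigcup_(i < k.+1) C i `<=` nV.2 &
        dens R nV.1 nV.2 <= 2^-1 ^+ k].
  move=> k; have [|||n [V VP]] := @closed_null_dens R (\bigcup_(i < k.+1) C i) (2^-1 ^+ k).
  - by apply: closed_bigcup => // i _; case: (Cn i).
  - apply: negligibleS (negligible_bigcup (fun i => (Cn i).2)).
    by move=> x [i _ Cx]; exists i.
  - by rewrite exprn_gt0// invr_gt0.
  - by exists (n, V).
pose h k := (nV k).1; pose V k := (nV k).2.
have hV k : determined (h k) (V k) by case: (nVP k).
have [t [g [gS tg]]] := Ssharp_groups XS h.
pose W k := [set w | V k (w \+' t k)].
have hW k : determined (h k) (W k) by exact: determined_translate.
exists (fun N => [set w | forall n, (N <= n)%N -> exists2 k, (g n <= k < g n.+1)%N & W k w]).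
split=> [N|_ [x /tg[n1 n1P] [y /AC[j _ Cy] <-]]].
  split.
    apply/(cantor_closedP R) => w wN n Nn.
    have [w' /(_ n Nn)[k kn Ww'] ww'] := wN (runmax h (g n.+1)).
    exists k => //; apply: hW Ww'; apply: agree_sym; apply: agree_le ww'.
    by apply: leq_runmax; lia.
  apply: null_negligible; apply: (@limsup_null R _ h W 0) => // [k _|w K wN].
    by rewrite /dens vol_translate//; case: (nVP k).
  have [k kn Ww] := wN (maxn N K) (leq_maxl _ _); exists k => //.
  by have := increasing_ge gS (maxn N K); lia.
exists (maxn n1 j) => // n jn.
have [|k kn xt] := n1P n; first by lia.
exists k => //; rewrite /W/=; apply: hV (agree_sym (agree_cancel y xt)) _.
have [_ + _] := nVP k; apply; exists j => //=.
by have := increasing_ge gS n; lia.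
Qed.

Lemma dens_fubini m n (W Q : set cantor) (c : R) : (m <= n)%N -> determined m Q ->
  (forall w, Q w -> c * 2^-1 ^+ m <= dens R n (W `&` [set w' | agree m w' w])) ->
  c * dens R m Q <= dens R n (W `&` Q).
Proof.
move=> mn mQ H; rewrite [leRHS]/dens.
have -> : vol n (W `&` Q) = (\sum_(u : m.-tuple bool | `[< Q (ext u) >])
    vol n (W `&` [set w' | agree m w' (ext u)]))%N.
  rewrite {1}/vol -sum1_card (partition_big (fun t => word (ext (tval t)) m)
    (fun u : m.-tuple bool => `[< Q (ext u) >])); last first.
    move=> t; rewrite inE => /asboolP[_ Qt]; apply/asboolP.
    exact/(determined_ext _ mQ).
  apply: eq_bigr => u /asboolP Qu; rewrite /vol -sum1_card; apply: eq_bigl => t.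
  rewrite !in_vol; apply/andP/asboolP => [[/asboolP[Wt _] /eqP <-]|[Wt tu]].
    by split=> //; apply: agree_sym; exact: agree_word.
  split; last by apply/eqP; rewrite -[RHS]wordK; apply/word_agree.
  apply/asboolP; split=> //; apply: mQ Qu; exact: agree_sym.
rewrite natr_sum mulr_suml /dens.
have -> : vol m Q = (\sum_(u : m.-tuple bool | `[< Q (ext u) >]) 1)%N.
  by rewrite /vol -sum1_card; apply: eq_bigl => t; rewrite in_vol.
rewrite natr_sum mulr_suml mulr_sumr; apply: ler_sum => u /asboolP Qu.
by rewrite mul1r; exact: H.
Qed.

End closed_null_additive.

(** * From E-additivity to coverings, through trees of good points *)

Section closed_null_additive_converse.
Variable R : realType.
Variables e f : nat -> nat.
Hypothesis fe : forall k, (f k <= e k)%N.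
Hypothesis ef : forall k, f k.+1 = (e k + 1 * 2 ^ e k)%N.

Let fS k : (f k < f k.+1)%N.
Proof. by rewrite ef mul1n; have := fe k; have := expn_gt0 2 (e k); lia. Qed.

(** The test set for E: requiring zeros at all levels, instead of infinitely many, makes it closed,
    and one bit per entry halves the measure at each level. *)
Definition zero_entries : set cantor := [set y | forall k, zeros (e k) 1 y].

Lemma determined_zeros_f k : determined (f k.+1) (zeros (e k) 1).
Proof. by rewrite ef; exact: determined_zeros. Qed.

Lemma zero_entries_closed : closed zero_entries.
Proof.
apply/(cantor_closedP R) => x xE k; have [y Ey xy] := xE (f k.+1).
exact: determined_zeros_f (agree_sym xy) (Ey k).
Qed.

Lemma zero_entries_null : (haar R).-negligible zero_entries.
Proof.
pose V k := [set y | forall i, (i < k)%N -> zeros (e i) 1 y].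
have nV k : determined (f k) (V k).
  move=> x y xy Vx i ik; apply: determined_zeros_f (Vx i ik).
  apply: agree_le xy; exact: (increasing_le fS).
apply: null_negligible; apply: (@limsup_null R _ f V 0) => // [k _|x N xE]; last first.
  by exists N => // i _; exact: xE.
elim: k => [|k IH].
  rewrite /dens expr0 (@eq_vol _ (V 0%N) setT) ?volT// natrX -exprMn mulfV// expr1n//.
apply: le_trans (_ : 2^-1 * dens R (f k) (V k) <= _); last by rewrite exprS ler_wpM2l ?invr_ge0.
rewrite -(determined_dens_le R (ltnW (fS k)) (nV k)) /dens.
have -> : vol (f k.+1) (V k) = (vol (f k.+1) (V k.+1) * 2)%N.
  rewrite -(@vol_zeros (e k) 1 (f k.+1) (fun=> false) (V k)).
  - rewrite expn1; congr (_ * _)%N; apply: eq_vol => w; split.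
      move=> [Vw]; rewrite /= cantor_add0 => kw i.
      by rewrite ltnS leq_eqVlt => /predU1P[->|/Vw].
    move=> Vw; split=> [i ik|]; first by apply: Vw; exact: ltnW.
    by rewrite /= cantor_add0; exact: Vw.
  - by rewrite ef.
  - by apply: determined_le (nV k); exact: ltnW.
  - move=> w l _; apply: nV; apply: agree_sym; apply: agree_flip.
    by have := fe k; lia.
by rewrite natrM; lra.
Qed.

(* Level f (j - d): a point is good if its prefix of length f (j - d) splits into
   many good ones at level e (j - d), so a good tree adds up with zero_entries to
   a set of large measure. *)
Section good.
Variables (X : set cantor) (j : nat).

Fixpoint good d : set cantor :=
  if d is d'.+1 then
    let k := (j - d)%N in
    [set x | ~ covered (e k) k.+2 (good d' `&` [set x' | agree (f k) x' x])]
  else [set x | exists2 x', X x' & agree (f j) x' x].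

(** Approximates X + [zero_entries] near [x], imposing only the levels from j - d to j - 1, so that
    membership depends on the first [f j] coordinates and can be counted. *)
Definition sums d (x : cantor) : set cantor := [set w | exists x', [/\ X x',
  agree (f (j - d)) x' x & forall i, (j - d <= i < j)%N -> zeros (e i) 1 (w \+' x')]].

(** At level k a good point has k+3 good successors with distinct prefixes. The corresponding
    one-bit events are independent with probability 1/2, so all fail with probability 2^(-k-3). The
    induction hypothesis loses another 2^(-k-3), and the two losses add up to 2^(-k-2). The events
    are also independent of the prefix of w, whence an arbitrary [r]. *)
Lemma good_dens d x r : (d <= j)%N -> good d x ->
  (1 - 2^-1 ^+ (j - d).+2) * 2^-1 ^+ f (j - d) <=
  dens R (f j) (sums d x `&` [set w | agree (f (j - d)) w r]).
Proof.
elim: d x r => [|d IH] x r dj.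
  rewrite subn0 => -[x' Xx' xx'].
  rewrite /dens (_ : sums 0 x `&` _ = [set w | agree (f j) w r]).
    rewrite vol_agree mul1r ler_piMl ?exprn_ge0 ?invr_ge0//.
  apply/seteqP; split=> [w []|w wr]; rewrite ?subn0//; split=> //.
  by exists x'; split; rewrite ?subn0// => i; lia.
set k := (j - d.+1)%N => /not_covered[z [zg zd]].
have kd : (j - d = k.+1)%N by rewrite /k; lia.
pose Q := [set w | agree (f k) w r].
pose D := [set w | forall i, (i < k.+3)%N -> ~ zeros (e k) 1 (w \+' z i)].
have eQ : determined (e k) Q by apply: determined_le (@determined_agree (f k) r); exact: fe.
have nQ : determined (f k.+1) Q.
  by apply: determined_le (@determined_agree (f k) r); exact: ltnW.
have nD : determined (f k.+1) D.
  move=> w w' ww' Dw i ik wz; apply: (Dw i ik); apply: determined_zeros_f wz.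
  by apply: agree_add => //; exact: agree_sym.
have zd' i i' : (i < i')%N -> (i' < k.+3)%N -> ~ agree (e k) (z i) (z i').
  by move=> ii' i'k; apply: zd.
have QD : dens R (f k.+1) (Q `&` ~` D) = (1 - 2^-1 ^+ k.+3) * 2^-1 ^+ f k.
  have := @vol_misses (e k) 1 (f k.+1) z k.+3 Q _ eQ zd'; rewrite ef => /(_ (leqnn _)).
  rewrite -ef expn1 subSS subn0 exp1n !mul1n -/D => QDk.
  have := volID (f k.+1) Q D => /(congr1 (fun k => k%:R : R)).
  move: QDk => /(congr1 (fun k => k%:R : R)); rewrite natrM natrD natrX => QDk QDD.
  have <- : dens R (f k.+1) Q = 2^-1 ^+ f k.
    rewrite (determined_dens_le R (ltnW (fS k)))//; last exact: determined_agree.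
    by rewrite /dens vol_agree mul1r.
  rewrite /dens -QDD mulrA; congr (_ * _); rewrite mulrBl mul1r {2}QDD -QDk exprVn.
  by rewrite mulrC mulfK ?expf_neq0//; lra.
have : (1 - 2^-1 ^+ k.+3) * dens R (f k.+1) (Q `&` ~` D) <=
    dens R (f j) (sums d.+1 x `&` (Q `&` ~` D)).
  apply: dens_fubini.
  - by rewrite -kd; apply: (increasing_le fS); lia.
  - by apply: determinedI => //; exact: determinedC.
  - move=> w [Qw Dw].
    have [i [ik wz]] : exists i, (i < k.+3)%N /\ zeros (e k) 1 (w \+' z i).
      apply: contrapT => H; apply: Dw => i ik wz; apply: H; by exists i.
    have [gz /= zx] := zg i ik.
    have := IH (z i) w (ltnW dj) gz; rewrite kd => /le_trans; apply.
    apply: dens_sub => w' [[x' [Xx' x'z x'd]] w'w]; split=> //.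
    rewrite kd in x'z x'd; exists x'; split=> //.
      by apply: agree_trans zx; apply: agree_le x'z; exact: ltnW.
    move=> i'; rewrite -/k leq_eqVlt => /andP[/predU1P[<-|ki'] i'j].
      apply: determined_zeros_f wz; apply: agree_add => //; exact: agree_sym.
    by apply: x'd; rewrite ki'.
move=> H; apply: le_trans (le_trans H _); last by apply: dens_sub => w [? []].
rewrite QD mulrA ler_wpM2r ?exprn_ge0 ?invr_ge0//.
rewrite (exprS _ k.+2); set q := 2^-1 ^+ k.+2; nra.
Qed.

End good.

(** Padding by zeros after [f j]: the entries of level i >= j lie beyond e(i) >= f(j), hence
    vanish. *)
Lemma zero_entries_extend (x y : cantor) k j : (k <= j)%N -> zero_entries y ->
  agree (f k) x y -> (forall i, (k <= i < j)%N -> zeros (e i) 1 x) ->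
  exists v, [/\ zero_entries v, agree (f k) v y & agree (f j) v x].
Proof.
move=> kj Ey xy xj; pose v : cantor := fun i => if (i < f j)%N then x i else false.
have vx : agree (f j) v x by move=> i ij; rewrite /v ij.
have fle := increasing_le fS.
have vy : agree (f k) v y by apply: agree_trans xy; apply: agree_le vx; exact: fle.
exists v; split=> // i; have [ik|ki] := ltnP i k.
  apply: determined_zeros_f (Ey i); apply: agree_sym; apply: agree_le vy; exact: fle.
have [ij|ji] := ltnP i j.
  apply: (determined_zeros_f _ (xj i _)); last by rewrite ki.
  by apply: agree_sym; apply: agree_le vx; exact: fle.
move=> l _; rewrite /v ifF//; have := fle _ _ ji; have := fe i; lia.
Qed.

Definition splits (G : nat -> set cantor) k : set cantor :=
  [set x | covered (e k) k.+2 (G k.+1 `&` [set x' | agree (f k) x' x]) /\ G k.+1 x].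

Lemma splits_covered G k : covered (e k) (2 ^ f k * k.+2) (splits G k).
Proof.
apply: covered_prefixes => r.
have [[x [[xc _] xr]]|nx] := pselect (exists x, (splits G k `&` [set x | agree (f k) x r]) x).
  apply: covered_le (leqnn _) (leqnn _) _ xc => x' [[_ Gx'] x'r]; split=> //.
  by apply: agree_trans x'r _; exact: agree_sym.
by exists (fun=> point) => x xX; case: nx; exists x.
Qed.

(** [C] lies in a clopen set of at most half the measure of a cylinder of length f(k0), whereas a
    point good at level k0 would force at least the proportion 1 - 2^(-k0-2). So goodness of each
    point of [X] fails at some level between k0 and j, where the point falls into [splits]. *)
Lemma translates_split (X C : set cantor) y k0 :
  closed C -> (haar R).-negligible C -> zero_entries y ->
  (forall x w, X x -> zero_entries w -> agree (f k0) w y -> C (w \+' x)) ->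
  exists2 j, (k0 <= j)%N & exists G, forall x, X x ->
    exists2 k, (k0 <= k < j)%N & splits G k x.
Proof.
move=> Ccl C0 Ey XC.
have [|n [V [nV CV Vle]]] := closed_null_dens (e := 2^-1 * 2^-1 ^+ f k0) Ccl C0.
  by rewrite mulr_gt0 ?exprn_gt0 ?invr_gt0.
pose j := maxn k0 n; have k0j : (k0 <= j)%N by exact: leq_maxl.
have nj : (n <= f j)%N.
  by apply: leq_trans (increasing_ge fS n) _; apply: (increasing_le fS); exact: leq_maxr.
have notgood x : ~ good X j (j - k0) x.
  move=> /(@good_dens X j (j - k0) x (x \+' y) (leq_subr _ _)); rewrite subKn// => H.
  have : dens R (f j) (sums X j (j - k0) x `&` [set w | agree (f k0) w (x \+' y)]) <=
      dens R (f j) V.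
    apply: dens_sub => w [[x' [Xx' x'x x'E]] wxy].
    rewrite subKn// in x'x x'E.
    have wy : agree (f k0) (w \+' x') y.
      apply: agree_trans (agree_add wxy (agree_refl x')) _.
      exact: agree_cancel (agree_sym x'x).
    have [v [Ev vy vw]] := zero_entries_extend k0j Ey wy x'E.
    apply: nV (CV _ (XC _ _ Xx' Ev vy)).
    have := agree_add (agree_le nj vw) (agree_refl x'); rewrite cantor_addK.
    exact.
  move=> /(le_trans H); rewrite (determined_dens_le R nj nV) => /le_trans/(_ Vle).
  rewrite ler_pM2r ?exprn_gt0 ?invr_gt0// !exprS.
  have : (2^-1 : R) ^+ k0 <= 1 by apply: exprn_ile1; rewrite ?invr_ge0// invf_le1 ?ler1n.
  by move=> ? ?; lra.
exists j => //; exists (fun k => good X j (j - k)) => x Xx.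
(* At d = 0 every point of [X] is good, so the least failure is a successor d+1 and the point is
   still good at d. *)
have exd : exists d, ~~ `[< good X j d x >] by exists (j - k0)%N; apply/asboolP.
case: (ex_minnP exd) => -[|d] /asboolP ng dmin.
  by case: ng; exists x.
have gd : good X j d x.
  apply: contrapT => ng'; have /dmin : ~~ `[< good X j d x >] by apply/asboolP.
  by rewrite ltnn.
have dj : (d.+1 <= j - k0)%N by apply: dmin; apply/asboolP.
have dE : (j - (j - d.+1).+1 = d)%N by lia.
exists (j - d.+1)%N; first by lia.
rewrite /splits /= dE; split=> //; exact: contrapT ng.
Qed.

End closed_null_additive_converse.

Lemma closed_null_additive_Ssharp (R : realType) X : additive_for (ideal_E R) X -> Ssharp X.
Proof.
move=> XE h.
(* For m = f(k) this is the number of cylinders in [splits_covered]. They will occupy the indices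
   from c to 2c - 1, on which [E] makes their length dominate [h]. *)
pose c m k := (2 ^ m * k.+2)%N.
pose E k m := maxn m (runmax h (2 * c m k)).
pose f := fix f n := if n is n'.+1 then (E n' (f n') + 1 * 2 ^ E n' (f n'))%N else 0%N.
pose e k := E k (f k).
have fe k : (f k <= e k)%N by exact: leq_maxl.
have ef k : f k.+1 = (e k + 1 * 2 ^ e k)%N by [].
have fS k : (f k < f k.+1)%N.
  by rewrite ef mul1n; have := fe k; have := expn_gt0 2 (e k); lia.
have cldZ := zero_entries_closed R ef.
have [|C [Cn XC]] := XE (zero_entries e).
  exists (fun=> zero_entries e); split=> [_|y Ey]; last by exists 0%N.
  by split=> //; apply: zero_entries_null fe ef.
exists (baire_piece (zero_entries e) (fun x N => [set w | C N (w \+' x)])).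
split=> [|i a].
  apply: (baire_pieces R) => // [|x N|x Xx w Ew].
  - by exists (fun=> false) => k l.
  - apply/(cantor_closedP R) => w wN.
    apply: ((cantor_closedP R _).1 (Cn N).1) => n.
    have [w' Cw' ww'] := wN n; exists (w' \+' x) => //; exact: agree_add.
  - have [|N _ CN] := XC (x \+' w); first by exists x => //; exists w.
    by exists N => //=; rewrite cantor_addC.
have [[y Ey yi]|nE] := pselect (exists2 y, zero_entries e y & cyl (baire_code i).1 y); last first.
  by exists 0%N, (fun=> point) => x [].
(* The first bound puts cylinders of length f(k0) around [y] inside that of the piece; the second
   keeps the indices at least [a]. *)
pose k0 := maxn (size (baire_code i).1) a.
pose P := baire_piece (zero_entries e) (fun x N => [set w | C N (w \+' x)]) i.
have [|j k0j [G GP]] := @translates_split R e f fe ef P (C (baire_code i).2) y k0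
  (Cn _).1 (Cn _).2 Ey.
  move=> x w [_ xC] Ew wy; apply: xC => //.
  apply: agree_trans yi; apply: agree_le wy.
  by rewrite (leq_trans (leq_maxl _ a))// -/k0 increasing_ge.
pose s k := c (f k) k.
have sS k : (s k + s k <= s k.+1)%N.
  rewrite /s /c addnn -mul2n mulnA -expnS leq_mul// leq_exp2l//; exact: fS.
have sS' k : (s k < s k.+1)%N.
  have : (0 < s k)%N by rewrite muln_gt0 expn_gt0.
  by have := sS k; lia.
have hF k l : (l < s k + s k)%N -> (h l <= e k)%N.
  rewrite addnn -mul2n => lk; rewrite /e /E leq_max; apply/orP; right.
  by apply: leq_runmax; exact: ltnW.
have [t tP] := covered_words_index sS sS' hF (splits_covered e f G).
exists (s j), t => x /GP[k kj /tP[l lk xl]]; exists l => //.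
have : (s k0 <= s k)%N by apply: (increasing_le sS'); lia.
have : (s k.+1 <= s j)%N by apply: (increasing_le sS'); lia.
have := increasing_ge sS' k0; have := sS k; rewrite {1}/k0; lia.
Qed.

(** * Metrics and box dimensions *)

Section unif_continuous_metric.
Variables (R : realType) (S Y : metricType R).

Lemma unif_continuous_mdistP (f : S -> Y) : unif_continuous f <->
  forall e : R, 0 < e -> exists2 d : R, 0 < d &
    forall x y, mdist x y < d -> mdist (f x) (f y) < e.
Proof.
split=> [fU e e0|H].
  have : entourage [set xy : Y * Y | ball xy.1 e xy.2] by exact: entourage_ball (PosNum e0).
  move=> /fU; rewrite /nbhs/= -entourage_ballE => -[d /= d0 dP].
  exists d => // x y xy; have := dP (x, y); rewrite /= !ballEmdist/=; exact.
move=> A; rewrite /nbhs/= -!entourage_ballE => -[e /= /H[d d0 dP] eA].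
exists d => // -[x y] /=; rewrite ballEmdist/= => /dP xy.
by apply: (eA (f x, f y)); rewrite /= ballEmdist.
Qed.

End unif_continuous_metric.

(** The type carries [R] so that a metric with values in [R] can be attached to it. *)
Definition baire_space (R : realType) : Type := nat -> seq bool.

HB.instance Definition _ (R : realType) := Choice.on (baire_space R).

Section baire_metric.
Variable R : realType.
Implicit Types x y z : baire_space R.

Definition baire_dist x y : R :=
  if pselect (exists i, x i != y i) is left h then 2^-1 ^+ ex_minn h else 0.

Lemma baire_dist_lt x y n :
  (baire_dist x y < 2^-1 ^+ n) <-> (forall i, (i <= n)%N -> x i = y i).
Proof.
rewrite /baire_dist; case: pselect => [h|h].
  case: ex_minnP => m xym mmin.
  rewrite ltr_iXn2l ?invr_gt0 ?invf_lt1 ?ltr1n//.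
  split=> [nm i ile|xy].
    apply/eqP; apply: contraTT ile => /mmin mi.
    by rewrite -ltnNge (leq_trans nm).
  by rewrite ltnNge; apply: contra xym => /xy ->.
split=> [_ i _|_]; last by rewrite exprn_gt0// invr_gt0.
by apply: contrapT => /eqP xy; apply: h; exists i.
Qed.

Lemma baire_dist_ge0 x y : 0 <= baire_dist x y.
Proof. by rewrite /baire_dist; case: pselect => // h; rewrite exprn_ge0// invr_ge0. Qed.

Let dxx x : baire_dist x x = 0.
Proof. by rewrite /baire_dist; case: pselect => // h; have [i /eqP] := h. Qed.

Let d0 x y : baire_dist x y = 0 -> x = y.
Proof.
rewrite /baire_dist; case: pselect => [h /eqP|h _].
  by rewrite expf_eq0 invr_eq0 pnatr_eq0 andbF.
by apply/funext => i; apply: contrapT => /eqP xy; apply: h; exists i.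
Qed.

Let d_val x y (r : R) : 0 <= r -> r < baire_dist x y ->
  exists m, r < 2^-1 ^+ m /\ ~ forall i, (i <= m)%N -> x i = y i.
Proof.
move=> r0; rewrite {1}/baire_dist; case: pselect => [h|_]; last by rewrite ltNge r0.
move=> rm; exists (ex_minn h); split=> // xy.
by case: ex_minnP xy => m + _ xy; rewrite xy ?eqxx.
Qed.

Let dC x y : baire_dist x y = baire_dist y x.
Proof.
suff H u v : baire_dist u v <= baire_dist v u by apply/eqP; rewrite eq_le !H.
rewrite leNgt; apply/negP => /(d_val (baire_dist_ge0 _ _))[m [/baire_dist_lt vu]].
by apply => i /vu.
Qed.

Let d_triangle y x z : baire_dist x z <= baire_dist x y + baire_dist y z.
Proof.
rewrite leNgt; apply/negP => /d_val[|m [dm]]; first by rewrite addr_ge0// baire_dist_ge0.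
have xy : baire_dist x y < 2^-1 ^+ m.
  by apply: le_lt_trans dm; rewrite lerDl baire_dist_ge0.
have yz : baire_dist y z < 2^-1 ^+ m.
  by apply: le_lt_trans dm; rewrite lerDr baire_dist_ge0.
by apply => i im; move/baire_dist_lt: xy => ->//; move/baire_dist_lt: yz => ->.
Qed.

HB.instance Definition _ := isMetric.Build R (baire_space R) dxx d0 dC d_triangle.

Lemma mdist_baire_lt x y n :
  (mdist x y < 2^-1 ^+ n) <-> (forall i, (i <= n)%N -> x i = y i).
Proof. exact: baire_dist_lt. Qed.

End baire_metric.

Section subset_maps.
Variables (R : realType) (X : set cantor).
Local Notation S := (set_type X : metricType R).

Lemma mdist_subset (x y : S) : mdist x y = cantor_dist R (set_val x) (set_val y).
Proof. by []. Qed.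

Definition prefixes (h : nat -> nat) (x : S) : baire_space R :=
  fun k => mkseq (set_val x) (h k).

Lemma prefixes_eq h (x y : S) k :
  prefixes h x k = prefixes h y k <-> agree (h k) (set_val x) (set_val y).
Proof.
split=> [xy i ik|xy].
  by have := congr1 (fun s => nth false s i) xy; rewrite !nth_mkseq.
by apply: (@eq_from_nth _ false); rewrite !size_mkseq// => i ik; rewrite !nth_mkseq// xy.
Qed.

Lemma prefixes_unif_continuous h : unif_continuous (prefixes h).
Proof.
apply/unif_continuous_mdistP => e /half_expr_lt[n ne].
exists (2^-1 ^+ runmax h n); first by rewrite exprn_gt0// invr_gt0.
move=> x y; rewrite mdist_subset => /cantor_dist_lt xy.
apply: lt_trans ne; apply/mdist_baire_lt => k kn; apply/prefixes_eq => i ik; apply: xy.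
by apply: leq_trans (ltnW ik) _; exact: leq_runmax.
Qed.

Lemma unif_continuous_modulus (Y : metricType R) (f : S -> Y) : unif_continuous f ->
  forall d : nat -> R, (forall k, 0 < d k) -> exists h : nat -> nat,
  forall k (x y : S), agree (h k) (set_val x) (set_val y) -> mdist (f x) (f y) < d k.
Proof.
move=> /unif_continuous_mdistP fU d d0.
suff /choice[h hP] : forall k, exists n, forall x y : S,
    agree n (set_val x) (set_val y) -> mdist (f x) (f y) < d k by exists h.
move=> k; have [e e0 eP] := fU _ (d0 k); have [n ne] := half_expr_lt e0.
exists n.+1 => x y xy; apply: eP; rewrite mdist_subset.
by apply: lt_trans ne; apply/cantor_dist_lt => i ilt; exact: xy.
Qed.

End subset_maps.

Section diameter.
Variables (R : realType) (Y : metricType R).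
Implicit Types (A E : set Y) (d : R).

Lemma diam_le A d : 0 <= d -> (forall x y, A x -> A y -> mdist x y <= d) ->
  (diam A <= d%:E)%E.
Proof.
move=> d0 Ad; apply: ge_ereal_sup => _ [->|[x Ax [y Ay <-]]]; rewrite lee_fin//.
exact: Ad.
Qed.

Lemma mdist_le_diam A x y : A x -> A y -> ((mdist x y)%:E <= diam A)%E.
Proof. by move=> Ax Ay; apply: ereal_sup_ubound; right; exists x => //; exists y. Qed.

Lemma diam_ge0 A : (0 <= diam A)%E.
Proof. by apply: ereal_sup_ubound; left. Qed.

Lemma covering_number_le E d n (A : nat -> set Y) :
  E `<=` \bigcup_(i < n) A i -> (forall i, (i < n)%N -> (diam (A i) <= d%:E)%E) ->
  (covering_number E d <= n%:R%:E)%E.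
Proof.
move=> EA Ad; apply: ereal_inf_lbound; exists n => //; exists (fun i : 'I_n => A i).
split=> [x /EA[i /= iltn Ax]|i]; last exact: Ad.
by exists (Ordinal iltn).
Qed.

Lemma covering_number_ge1 E d : E !=set0 -> (1 <= covering_number E d)%E.
Proof.
move=> [x Ex]; apply: le_ereal_inf_tmp => _ [n [A [EA _]] <-].
by have [[i ilt] _ _] := EA x Ex; rewrite lee_fin ler1n; exact: leq_ltn_trans ilt.
Qed.

Lemma box_ratio_ge0 E d : E !=set0 -> (0 <= box_ratio E d)%E.
Proof.
move=> E0; rewrite mule_ge0 ?lee_fin ?invr_ge0// lne_ge0; exact: covering_number_ge1.
Qed.

Lemma at_right0P (V : set R) :
  0^'+ V <-> exists2 d, 0 < d & forall e, 0 < e < d -> V e.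
Proof.
split=> [[d /= d0 dV]|[d d0 dV]]; exists d => //.
  by move=> e /andP[e0 ed]; apply: dV => //=; rewrite sub0r normrN gtr0_norm.
by move=> e /=; rewrite sub0r normrN => ed e0; apply: dV; rewrite e0 -(gtr0_norm e0).
Qed.

Lemma upper_dimB_ge0 E : (0 <= upper_dimB E)%E.
Proof.
rewrite /upper_dimB; case: asboolP => // /eqP/set0P E0.
apply: limf_esup_ge0 => [/at_right0P[d d0 /(_ (d / 2))]|d]; last exact: box_ratio_ge0.
by apply; rewrite divr_gt0//= ltr_pdivrMr// ltr_pMr// ltr1n.
Qed.

Lemma lower_dimB_ge0 E : (0 <= lower_dimB E)%E.
Proof.
rewrite /lower_dimB; case: asboolP => // /eqP/set0P E0.
rewrite limf_einfE; apply: ereal_sup_ge; exists (ereal_inf (box_ratio E @` setT)).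
  by exists setT => //; apply/at_right0P; exists 1.
by apply: le_ereal_inf_tmp => _ [d _ <-]; exact: box_ratio_ge0.
Qed.

Lemma upper_dimB_lt E (r : \bar R) : E !=set0 -> (upper_dimB E < r)%E ->
  exists2 d0, 0 < d0 & forall d, 0 < d < d0 -> (box_ratio E d < r)%E.
Proof.
move=> E0; rewrite /upper_dimB asboolF; last by apply/eqP/set0P.
move=> /ereal_inf_lt[_ [V /at_right0P[d0 d00 d0V] <-] Vr].
exists d0 => // d /d0V Vd; apply: le_lt_trans Vr.
by apply: ereal_sup_ubound; exists d.
Qed.

Lemma lower_dimB_lt E (r : \bar R) : E !=set0 -> (lower_dimB E < r)%E ->
  forall d0, 0 < d0 -> exists2 d, 0 < d < d0 & (box_ratio E d < r)%E.
Proof.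
move=> E0; rewrite /lower_dimB asboolF; last by apply/eqP/set0P.
rewrite limf_einfE => Er d0 d00.
have : (ereal_inf (box_ratio E @` [set d | (0 < d < d0)%R]) < r)%E.
  apply: le_lt_trans Er; apply: ereal_sup_ubound; exists [set d | (0 < d < d0)%R] => //.
  by apply/at_right0P; exists d0.
by move=> /ereal_inf_lt[_ [d dd <-] dr]; exists d.
Qed.

Lemma upper_dimB_le E (e : R) : 0 <= e ->
  (exists2 d0, 0 < d0 & forall d, 0 < d < d0 -> (box_ratio E d <= e%:E)%E) ->
  (upper_dimB E <= e%:E)%E.
Proof.
move=> e0 [d0 d00 H]; rewrite /upper_dimB; case: asboolP => [_|_]; first by rewrite lee_fin.
apply: (@le_trans _ _ (ereal_sup (box_ratio E @` [set d | (0 < d < d0)%R]))).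
  apply: ereal_inf_lbound; exists [set d | (0 < d < d0)%R] => //.
  by apply/at_right0P; exists d0.
by apply: ge_ereal_sup => _ [d dd <-]; exact: H.
Qed.

Lemma lower_dimB_le E (e : R) : 0 <= e ->
  (forall d0, 0 < d0 -> exists2 d, 0 < d < d0 & (box_ratio E d <= e%:E)%E) ->
  (lower_dimB E <= e%:E)%E.
Proof.
move=> e0 H; rewrite /lower_dimB; case: asboolP => [_|_]; first by rewrite lee_fin.
rewrite limf_einfE; apply: ge_ereal_sup => _ [V /at_right0P[d0 /H[d dd Ed] d0V] <-].
by apply: le_trans Ed; apply: ereal_inf_lbound; exists d => //; exact: d0V.
Qed.

End diameter.

(** * Packing dimensions *)

Section packing.
Variables (R : realType) (X : set cantor).
Local Notation S := (set_type X : metricType R).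

Lemma set_typeP x : X x -> exists p : S, set_val p = x.
Proof. by move=> Xx; exists (exist _ x (mem_set Xx)). Qed.

Lemma lne_ratio_lt1 (x : \bar R) (d : R) : 0 < d < 1 ->
  (lne x * (`|ln d|^-1)%:E < 1)%E -> (x < (d^-1)%:E)%E.
Proof.
move=> /andP[d0 d1] xd; rewrite ltNge; apply/negP => dx; move: xd; apply/negP; rewrite -leNgt.
have ld : 0 < `|ln d| by rewrite normr_gt0 lt_eqF// ln_lt0// d0.
have d0' : (0 < (d^-1)%:E)%E by rewrite lte_fin invr_gt0.
have dd : lne (d^-1)%:E = `|ln d|%:E.
  by rewrite lne_EFin ?invr_gt0// lnV ?posrE// ltr0_norm// ln_lt0// d0.
apply: (@le_trans _ _ (lne (d^-1)%:E * (`|ln d|^-1)%:E)%E).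
  by rewrite dd -EFinM mulfV// gt_eqF.
rewrite lee_wpmul2r// ?lee_fin ?invr_ge0// lee_lne// in_itv/= ?leey ?andbT ltW//.
exact: lt_le_trans dx.
Qed.

(** A ratio below 1 means fewer than 1/d <= 2^(k+1) sets, and a diameter at most d < 2^(-k) forces a
    common k-th word. The count does not involve [h]. *)
Lemma box_ratio_covered h (A : set (baire_space R)) (d : R) k :
  2^-1 ^+ k.+1 <= d < 2^-1 ^+ k -> (box_ratio A d < 1)%E ->
  covered (h k) (2 ^ k.+1) [set x | exists p : S, set_val p = x /\ A (prefixes h p)].
Proof.
move=> /andP[kd dk] /lne_ratio_lt1 H.
have d0 : 0 < d by apply: lt_le_trans kd; rewrite exprn_gt0// invr_gt0.
have d1 : d < 1 by apply: lt_le_trans dk _; apply: exprn_ile1; rewrite ?invr_ge0// invf_le1 ?ler1n.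
have /H/ereal_inf_lt[_ [n [B [AB Bd]] <-]] : 0 < d < 1 by rewrite d0.
rewrite lte_fin => nd.
have nk : (n <= 2 ^ k.+1)%N.
  rewrite -(ler_nat R) natrX (le_trans (ltW nd))//.
  by rewrite -[leRHS]invrK lef_pV2 ?posrE ?invr_gt0 ?exprn_gt0// -exprVn.
have /choice[z zP] : forall i, exists z : cantor, forall ilt : (i < n)%N, forall p : S,
    B (Ordinal ilt) (prefixes h p) -> agree (h k) (set_val p) z.
  move=> i; have [ilt|ni] := pselect (i < n)%N; last by exists point.
  have [[q Bq]|nq] := pselect (exists q : S, B (Ordinal ilt) (prefixes h q)); last first.
    by exists point => ilt' p Bp; case: nq; exists p; rewrite (bool_irrelevance ilt ilt').
  exists (set_val q) => ilt' p; rewrite (bool_irrelevance ilt' ilt) => Bp.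
  apply/prefixes_eq; apply: (mdist_baire_lt _ _ k).1 => //; apply: le_lt_trans dk.
  by rewrite -lee_fin (le_trans (mdist_le_diam Bp Bq)).
exists z => _ [p [<- /AB[i _ Bp]]]; exists i.
  by case: i Bp => i /= ilt _; exact: leq_trans nk.
by case: i Bp => i ilt Bp; exact: zP Bp.
Qed.

Lemma dyadic_scale (d : R) : 0 < d < 1 -> exists k, 2^-1 ^+ k.+1 <= d < 2^-1 ^+ k.
Proof.
move=> /andP[d0 d1].
have exk : exists k, 2^-1 ^+ k <= d by have [k /ltW kd] := half_expr_lt d0; exists k.
case: (ex_minnP exk) => -[|k] kd kmin; first by move: kd; rewrite expr0 leNgt d1.
by exists k; rewrite kd/= ltNge; apply/negP => /kmin; rewrite ltnn.
Qed.

Lemma upper_dimP_lt (Y : metricType R) (E : set Y) (r : \bar R) : (upper_dimP E < r)%E ->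
  exists A : nat -> set Y, \bigcup_n A n = E /\ forall n, (upper_dimB (A n) < r)%E.
Proof.
move=> /ereal_inf_lt[_ [A AE <-] Ar]; exists A; split=> // n.
by apply: le_lt_trans Ar; apply: ereal_sup_ubound; exists n.
Qed.

Lemma directed_lower_dimP_lt (Y : metricType R) (E : set Y) (r : \bar R) :
  (directed_lower_dimP E < r)%E ->
  exists A : nat -> set Y, [/\ forall m n, (m <= n)%N -> A m `<=` A n, \bigcup_n A n = E &
    forall n, (lower_dimB (A n) < r)%E].
Proof.
move=> /ereal_inf_lt[_ [A [Ale AE] <-] Ar]; exists A; split=> // n.
by apply: le_lt_trans Ar; apply: ereal_sup_ubound; exists n.
Qed.

Lemma prefixes_cover h (A : nat -> set (baire_space R)) :
  \bigcup_n A n = range (prefixes (X := X) h) ->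
  X `<=` \bigcup_m [set x | exists p : S, set_val p = x /\ A m (prefixes h p)].
Proof.
move=> AE x /set_typeP[p <-]; have [m _ Am] : (\bigcup_n A n) (prefixes h p).
  by rewrite AE; exists p.
by exists m => //; exists p.
Qed.

Lemma leq_2_8 k : (1 <= k)%N -> (2 ^ k.+1 <= 8 ^ k)%N.
Proof. by move=> k1; rewrite (_ : 8 = 2 ^ 3)%N// -expnM leq_exp2l//; lia. Qed.

Lemma P_null_Pstar : P_null S -> Pstar X.
Proof.
move=> XP; apply: Pstar_pow => h.
have [A [AE A1]] : exists A : nat -> set (baire_space R),
    \bigcup_n A n = range (prefixes (X := X) h) /\ forall n, (upper_dimB (A n) < 1)%E.
  by apply: upper_dimP_lt; rewrite (XP _ _ (@prefixes_unif_continuous R X h)) lte_fin.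
exists (fun m => [set x | exists p : S, set_val p = x /\ A m (prefixes h p)]).
split=> [|m]; first exact: prefixes_cover.
have [A0|/eqP/set0P A0] := pselect (A m = set0).
  by exists 0%N => k _; exists (fun=> point) => x [p [_]]; rewrite A0.
have [d0 d00 dA] := upper_dimB_lt A0 (A1 m); have [k0 kd0] := half_expr_lt d00.
exists k0.+1 => k kk.
have lt k' : (k0 <= k')%N -> (2^-1 : R) ^+ k'.+1 < 2^-1 ^+ k0.
  by move=> k0k'; rewrite ltr_iXn2l ?invr_gt0 ?invf_lt1 ?ltr1n.
have kd : 2^-1 ^+ k.+1 <= (2^-1 : R) ^+ k.+1 < 2^-1 ^+ k.
  by rewrite lexx/= ltr_iXn2l ?invr_gt0 ?invf_lt1 ?ltr1n.
have Ak : (box_ratio (A m) (2^-1 ^+ k.+1) < 1)%E.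
  by apply: dA; rewrite exprn_gt0 ?invr_gt0//= (lt_trans _ kd0)// lt// ltnW.
apply: covered_le (box_ratio_covered h kd Ak) => //; apply: leq_2_8; exact: leq_ltn_trans kk.
Qed.

Lemma directed_P_null_dPstar : directed_P_null S -> dPstar X.
Proof.
move=> XP; apply: dPstar_pow => h.
have [A [Ale AE A1]] : exists A : nat -> set (baire_space R),
    [/\ forall m n, (m <= n)%N -> A m `<=` A n,
    \bigcup_n A n = range (prefixes (X := X) h) & forall n, (lower_dimB (A n) < 1)%E].
  by apply: directed_lower_dimP_lt; rewrite (XP _ _ (@prefixes_unif_continuous R X h)) lte_fin.
exists (fun m => [set x | exists p : S, set_val p = x /\ A m (prefixes h p)]).
split=> [|m n mn x [p [px Ap]]|m k0]; first exact: prefixes_cover.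
  by exists p; split=> //; exact: Ale Ap.
have [A0|/eqP/set0P A0] := pselect (A m = set0).
  by exists k0 => //; exists (fun=> point) => x [p [_]]; rewrite A0.
have X1 n : (2^-1 : R) ^+ n <= 1 by apply: exprn_ile1; rewrite ?invr_ge0// invf_le1 ?ler1n.
have [|d /andP[d0 dk0] Ad] := lower_dimB_lt A0 (A1 m) (d0 := 2^-1 ^+ k0.+2).
  by rewrite exprn_gt0// invr_gt0.
have [|k kd] := @dyadic_scale d; first by rewrite d0 (lt_le_trans dk0).
have k0k : (k0.+1 <= k)%N.
  have /andP[kd1 _] := kd; have := le_lt_trans kd1 dk0.
  by rewrite ltr_iXn2l ?invr_gt0 ?invf_lt1 ?ltr1n//; lia.
exists k; first exact: ltnW.
apply: covered_le (box_ratio_covered h kd Ad) => //; apply: leq_2_8; exact: leq_ltn_trans k0k.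
Qed.

(** The logarithm is quadratic in k, that of k sets at most k, so box ratios are at most 1/k. The
    shift makes exp(-k^2) the scale just before [scale k]. *)
Let scale k : R := expR (- (k.+1%:R ^+ 2)).

Let scale_gt0 k : 0 < scale k. Proof. exact: expR_gt0. Qed.

Let scale_lt m n : (m < n)%N -> scale n < scale m.
Proof. by move=> mn; rewrite ltr_expR ltrN2 ltrXn2r ?qualifE/= ?ltr_nat. Qed.

Let scale_small (d : R) : 0 < d -> exists k, scale k <= d.
Proof.
move=> d0; have [k kd] := ltr_add_invr d0; exists k.
rewrite add0r in kd; apply: le_trans (ltW kd).
rewrite /scale expRN lef_pV2 ?posrE ?expR_gt0//.
apply: le_trans (expR_ge1Dx _); by rewrite ler_wpDl// expr2 ler_peMr ?ler1n ?ler0n.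
Qed.

Lemma covering_number_image (Y : metricType R) (f : S -> Y) (h : nat -> nat) k d (A : set cantor) :
  (forall x y : S, agree (h k) (set_val x) (set_val y) -> mdist (f x) (f y) < d) ->
  0 <= d -> covered (h k) k A ->
  (covering_number (f @` [set p | A (set_val p)]) d <= k%:R%:E)%E.
Proof.
move=> hf d0 [z zP].
apply: (@covering_number_le _ _ _ _ _ (fun i => f @` [set p | agree (h k) (set_val p) (z i)])).
  by move=> _ [p /zP[i ik pz] <-]; exists i => //; exists p.
move=> i ik; apply: diam_le => // _ _ [p pz <-] [q qz <-].
by apply/ltW/hf; apply: agree_trans pz _; exact: agree_sym.
Qed.

Lemma lne_ratio_le (N : \bar R) k (d : R) : (0 < k)%N -> (N <= k%:R%:E)%E ->
  0 < d <= expR (- (k%:R ^+ 2)) -> (lne N * (`|ln d|^-1)%:E <= (k%:R^-1)%:E)%E.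
Proof.
move=> k0 Nk /andP[d0 dk]; have k0' : 0 < k%:R :> R by rewrite ltr0n.
have ld : ln d <= - (k%:R ^+ 2).
  by rewrite -[leRHS]expRK ler_ln ?posrE ?expR_gt0.
have kd : k%:R ^+ 2 <= `|ln d|.
  by rewrite ler0_norm; [lra|apply: le_trans ld _; rewrite oppr_le0 exprn_ge0].
have Nk' : (lne N <= k%:R%:E)%E.
  have [N0|N0] := leP N 0%E.
    by rewrite le0_lneNy// leNye.
  apply: (@le_trans _ _ (lne k%:R%:E)).
    by rewrite lee_lne// in_itv/= leey ?lee_fin ?ler0n ?(ltW N0).
  by rewrite lne_EFin// lee_fin ltW// ln_sublinear.
apply: (@le_trans _ _ (k%:R%:E * (`|ln d|^-1)%:E)%E).
  by rewrite lee_wpmul2r// lee_fin invr_ge0.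
rewrite -EFinM lee_fin ler_pdivrMr; last by apply: lt_le_trans kd; rewrite exprn_gt0.
by rewrite mulrC -ler_pdivrMr ?invr_gt0// invrK -expr2.
Qed.

Lemma upper_dimP_ge0 (Y : metricType R) (E : set Y) : (0 <= upper_dimP E)%E.
Proof.
apply: le_ereal_inf_tmp => _ [A _ <-]; apply: le_trans (upper_dimB_ge0 (A 0%N)) _.
by apply: ereal_sup_ubound; exists 0%N.
Qed.

Lemma directed_lower_dimP_ge0 (Y : metricType R) (E : set Y) : (0 <= directed_lower_dimP E)%E.
Proof.
apply: le_ereal_inf_tmp => _ [A _ <-]; apply: le_trans (lower_dimB_ge0 (A 0%N)) _.
by apply: ereal_sup_ubound; exists 0%N.
Qed.

Lemma bigcup_image_range (Y : metricType R) (f : S -> Y) (Xm : nat -> set cantor) :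
  X `<=` \bigcup_m Xm m -> \bigcup_m (f @` [set p | Xm m (set_val p)]) = range f.
Proof.
move=> XX; apply/seteqP; split=> [_ [m _ [p _ <-]]|_ [p _ <-]]; first by exists p.
by have [m _ mp] := XX _ (set_valP p); exists m => //; exists p.
Qed.

Lemma Pstar_P_null : Pstar X -> P_null S.
Proof.
move=> XP Y f fU; apply/eqP; rewrite eq_le upper_dimP_ge0 andbT.
have [h hf] := unif_continuous_modulus fU scale_gt0.
have [Xm [XX Xc]] := XP h.
apply: (@le_trans _ _ (ereal_sup (range (fun m => upper_dimB (f @` [set p | Xm m (set_val p)]))))).
  apply: ereal_inf_lbound; exists (fun m => f @` [set p | Xm m (set_val p)]) => //.
  exact: bigcup_image_range.
apply: ge_ereal_sup => _ [m _ <-]; apply/lee_addgt0Pr => e e0; rewrite add0e.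
apply: upper_dimB_le; first exact: ltW.
have [k0 k0P] := Xc m; have [K Ke] := ltr_add_invr e0; rewrite add0r in Ke.
exists (scale (maxn k0 K)) => // d /andP[d0 dk].
have exk := scale_small d0.
(* For the least such k, scale k <= d < exp(-k^2): k sets of diameter at most d suffice, and |ln d|
   is at least k^2. *)
case: (ex_minnP exk) => k kd kmin.
have kK : (maxn k0 K < k)%N.
  rewrite ltnNge; apply/negP; rewrite leq_eqVlt => /predU1P[kE|/scale_lt kE].
    by move: dk; rewrite -kE ltNge kd.
  by have := lt_trans dk kE; rewrite ltNge kd.
apply: le_trans (_ : _ <= (k%:R^-1)%:E)%E _; last first.
  rewrite lee_fin (le_trans _ (ltW Ke))// lef_pV2 ?posrE ?ltr0n ?ler_nat; lia.
apply: lne_ratio_le; first by lia.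
  apply: (@covering_number_image _ _ h) => //; last by apply: k0P; lia.
    by move=> x y xy; apply: lt_le_trans kd; exact: hf.
  exact: ltW.
rewrite d0/= ltW//; case: k kd kmin kK => // k kd kmin _.
by rewrite -/(scale k) ltNge; apply/negP => /kmin; rewrite ltnn.
Qed.

Lemma dPstar_directed_P_null : dPstar X -> directed_P_null S.
Proof.
move=> XP Y f fU; apply/eqP; rewrite eq_le directed_lower_dimP_ge0 andbT.
have [h hf] := unif_continuous_modulus fU scale_gt0.
have [Xm [XX Xle Xc]] := XP h.
apply: (@le_trans _ _ (ereal_sup (range (fun m => lower_dimB (f @` [set p | Xm m (set_val p)]))))).
  apply: ereal_inf_lbound; exists (fun m => f @` [set p | Xm m (set_val p)]) => //.
  split; last exact: bigcup_image_range.
  by move=> m n mn _ [p mp <-]; exists p => //; exact: Xle mp.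
apply: ge_ereal_sup => _ [m _ <-]; apply/lee_addgt0Pr => e e0; rewrite add0e.
apply: lower_dimB_le; first exact: ltW.
move=> d0 d00; have [k0 k0d] := scale_small d00.
have [K Ke] := ltr_add_invr e0; rewrite add0r in Ke.
have [k kk kc] := Xc m (maxn k0 K).+1.
exists (scale k); first by rewrite scale_gt0/= (lt_le_trans (scale_lt _) k0d)//; lia.
apply: le_trans (_ : _ <= (k%:R^-1)%:E)%E _; last first.
  rewrite lee_fin (le_trans _ (ltW Ke))// lef_pV2 ?posrE ?ltr0n ?ler_nat; lia.
apply: lne_ratio_le; first by lia.
  by apply: (@covering_number_image _ _ h) => //; [exact: hf|exact: ltW].
rewrite scale_gt0/= ler_expR lerN2 lerXn2r ?qualifE/= ?ler_nat//.
Qed.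

End packing.

(** * Hausdorff dimension *)

Section hausdorff.
Variable R : realType.

Lemma hausdorff_measure_ge0 (Y : metricType R) s (E : set Y) : (0 <= hausdorff_measure s E)%E.
Proof.
apply: (@le_trans _ _ (hausdorff_premeasure s 1 E)).
  apply: le_ereal_inf_tmp => _ [A _ <-]; apply: nneseries_ge0 => n _ _; exact: poweR_ge0.
by apply: ereal_sup_ubound; exists 1 => //=.
Qed.

Lemma dimH_ge0 (Y : metricType R) (E : set Y) : (0 <= dimH E)%E.
Proof. by apply: le_ereal_inf_tmp => _ [s [s0 _] <-]; rewrite lee_fin ltW. Qed.

(** Some s < 1 has measure 0, and a diameter at most 1 is bounded by its power s; so the diameters
    themselves have a small sum. *)
Lemma dimH_cover (Y : metricType R) (E : set Y) (d e : R) : (dimH E < 1)%E -> 0 < d -> 0 < e ->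
  exists (A : nat -> set Y) (a : nat -> R), [/\ E `<=` \bigcup_n A n,
    forall n, (diam (A n) <= (a n)%:E)%E, forall n, 0 <= a n <= d &
    forall N, \sum_(i < N) a i <= e].
Proof.
move=> /ereal_inf_lt[_ [s [s0 sE] <-]]; rewrite lte_fin => s1 d0 e0.
pose d' := Num.min d 1; have d'0 : 0 < d' by rewrite lt_min d0 ltr01.
have : (hausdorff_premeasure s d' E < e%:E)%E.
  apply: (@le_lt_trans _ _ 0%E); last by rewrite lte_fin.
  by rewrite -sE; apply: ereal_sup_ubound; exists d'.
move=> /ereal_inf_lt[_ [A [EA Ad] <-] Ae].
have fA n : diam (A n) \is a fin_num.
  rewrite ge0_fin_numE ?diam_ge0//; apply: le_lt_trans (Ad n) _; exact: ltry.
have a0 n : 0 <= fine (diam (A n)) by apply: fine_ge0; exact: diam_ge0.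
have ad n : fine (diam (A n)) <= d' by rewrite -lee_fin fineK.
exists A, (fun n => fine (diam (A n))); split=> // [n|n|N].
- by rewrite fineK.
- by rewrite a0 (le_trans (ad n))// ge_min lexx.
- rewrite -lee_fin -sumEFin; apply: le_trans (ltW Ae).
  rewrite -(big_mkord xpredT (fun n => (fine (diam (A n)))%:E)).
  apply: (@le_trans _ _ (\sum_(0 <= n < N) diam (A n) `^ s)%E); last first.
    by apply: nneseries_lim_ge => n _ _; exact: poweR_ge0.
  apply: lee_sum => n _; rewrite -[in leRHS](fineK (fA n)) poweR_EFin lee_fin.
  have [->|n0] := eqVneq (fine (diam (A n))) 0; first by rewrite powR_ge0.
  rewrite -[leLHS]powRr1//; apply: ger_powR; last exact: ltW.
  by rewrite lt_def n0 a0/= (le_trans (ad n))// ge_min lexx orbT.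
Qed.

Lemma hausdorff_measure_eq0 (Y : metricType R) s (E : set Y) : 0 < s ->
  (forall d e : R, 0 < d -> 0 < e -> exists (A : nat -> set Y) (a : nat -> R),
    [/\ E `<=` \bigcup_n A n, forall n, (diam (A n) <= (a n)%:E)%E,
        forall n, 0 <= a n <= d & forall n, a n `^ s <= e * 2^-1 ^+ n.+1]) ->
  hausdorff_measure s E = 0.
Proof.
move=> s0 H; apply/eqP; rewrite eq_le hausdorff_measure_ge0 andbT.
apply: ge_ereal_sup => _ [d /= d0 <-]; apply/lee_addgt0Pr => e e0; rewrite add0e.
have [A [a [EA Aa ad ae]]] := H d e d0 e0.
apply: (@le_trans _ _ (\sum_(n <oo) diam (A n) `^ s)%E).
  apply: ereal_inf_lbound; exists A => //; split=> // n.
  by apply: le_trans (Aa n) _; rewrite lee_fin; have /andP[] := ad n.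
apply: lime_le; first by apply: is_cvg_nneseries => n _ _; exact: poweR_ge0.
apply: nearW => N; rewrite big_mkord.
apply: (@le_trans _ _ (\sum_(n < N) (e * 2^-1 ^+ (1 + n))%:E)%E).
  apply: lee_sum => n _; apply: le_trans (_ : ((a n) `^ s)%:E <= _)%E; last by rewrite lee_fin ae.
  rewrite -poweR_EFin; apply: gt0_ler_poweR; rewrite ?in_itv/= ?leey ?diam_ge0//; first exact: ltW.
  by rewrite andbT lee_fin; have /andP[] := ad n.
rewrite sumEFin lee_fin -mulr_sumr -[leRHS]mulr1 ler_wpM2l ?(ltW e0)//.
by apply: le_trans (geometric_sum_le _ _ _) _; rewrite expr1 mulVf.
Qed.

(* Sets of weight about 2 ^ (- j) receive distinct indices in [2 ^ j, 2 ^ (j + 1)). *)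
Lemma weights_index (b : nat -> R) : (forall n, 0 < b n) ->
  (forall N, \sum_(i < N) b i <= 2^-1) -> exists p j : nat -> nat,
  [/\ injective p, forall n, b n < 2^-1 ^+ j n, forall n, (p n < 2 ^ (j n).+1)%N &
      forall n a, b n < 2^-1 ^+ a -> (a <= p n)%N].
Proof.
move=> b0 bs.
have b1 n : b n < 1.
  have := bs n.+1; rewrite big_ord_recr/=.
  have : 0 <= \sum_(i < n) b i by apply: sumr_ge0 => i _; exact/ltW.
  by lra.
have /choice[j jP] : forall n, exists k, 2^-1 ^+ k.+1 <= b n < 2^-1 ^+ k.
  by move=> n; apply: dyadic_scale; rewrite b0 b1.
(* The rank of n within its weight class. A member weighs at least 2^(-j-1) and the total is at most
   1/2, so a class has at most 2^j members. *)
pose c n := (\sum_(i < n) (j i == j n))%N.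
have cj n : (c n < 2 ^ j n)%N.
  have h2 : 2^-1 ^+ (j n).+1 * (c n).+1%:R <= (2^-1 : R).
    apply: le_trans (bs n.+1); rewrite big_ord_recr/= -(@natr1 R (c n)) mulrDr mulr1 lerD//.
      rewrite /c natr_sum mulr_sumr; apply: ler_sum => i _.
      case: eqP => [<-|_]; last by rewrite mulr0 ltW.
      by rewrite mulr1; have /andP[] := jP i.
    by have /andP[] := jP n.
  rewrite -(ltr_nat R) natrX; move: h2; rewrite exprS -mulrA ger_pMr ?invr_gt0//.
  by rewrite exprVn mulrC ler_pdivrMr ?exprn_gt0// mul1r -(@natr1 R (c n)); lra.
exists (fun n => 2 ^ j n + c n)%N, j; split.
- have H m n : (m < n)%N -> (2 ^ j m + c m)%N <> (2 ^ j n + c n)%N.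
    move=> mn E; have jmn : j m = j n.
      have [lt|lt|//] := ltngtP (j m) (j n).
        have := leq_pexp2l (isT : (0 < 2)%N) lt; rewrite expnS; have := cj m; lia.
      have := leq_pexp2l (isT : (0 < 2)%N) lt; rewrite expnS; have := cj n; lia.
    move: E; rewrite jmn => /addnI; rewrite /c jmn => E.
    have cq q : (\sum_(i < m.+1) (j i == q) <= \sum_(i < n) (j i == q))%N.
      by rewrite -(subnKC mn) big_split_ord leq_addr.
    by have := cq (j n); rewrite big_ord_recr/= jmn eqxx E addn1 ltnn.
  move=> m n E; have [/H|/H|//] := ltngtP m n; first by rewrite E.
  by rewrite E.
- by move=> n; have /andP[] := jP n.
- by move=> n; rewrite expnS; have := cj n; lia.
- move=> n a ba; have /andP[jb _] := jP n; have := le_lt_trans jb ba.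
  rewrite ltr_iXn2l ?invr_gt0 ?invf_lt1 ?ltr1n// ltnS => aj.
  by rewrite (leq_trans aj)// (leq_trans (ltnW (ltn_expl _ (isT : (1 < 2)%N))))// leq_addr.
Qed.

End hausdorff.

Section strong_measure_zero.
Variables (R : realType) (X : set cantor).
Local Notation S := (set_type X : metricType R).

(** Diameter below 2^(-j) under [prefixes] means one cylinder whose length dominates [h] up to
    2^(j+1), which covers every index that [weights_index] can assign. *)
Lemma weights_words (h : nat -> nat) (B : nat -> set S) (b : nat -> R) :
  (forall n, 0 < b n) -> (forall N, \sum_(i < N) b i <= 2^-1) ->
  (forall n x y, B n x -> B n y ->
    mdist (prefixes (fun j => runmax h (2 ^ j.+1)) x)
          (prefixes (fun j => runmax h (2 ^ j.+1)) y) < b n) ->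
  exists (p : nat -> nat) (t : nat -> cantor),
    (forall n a, b n < 2^-1 ^+ a -> (a <= p n)%N) /\
    forall n x, B n x -> agree (h (p n)) (set_val x) (t (p n)).
Proof.
move=> b0 bs Bb; have [p [j [pI bj pj ap]]] := weights_index b0 bs.
have /choice[t tP] : forall k, exists z, forall n x, p n = k -> B n x -> agree (h k) (set_val x) z.
  move=> k; have [[n [y [pn By]]]|H] := pselect (exists n y, p n = k /\ B n y); last first.
    by exists point => n x pn Bx; case: H; exists n, x.
  exists (set_val y) => n' x pn' Bx; have nn' : n' = n by apply: pI; rewrite pn'.
  rewrite {}nn' in Bx *; have /prefixes_eq : prefixes (fun j => runmax h (2 ^ j.+1)) x (j n) =
      prefixes (fun j => runmax h (2 ^ j.+1)) y (j n).
    by apply: (mdist_baire_lt _ _ (j n)).1 => //; apply: lt_trans (bj n); exact: Bb.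
  by apply: agree_le; rewrite -pn; apply: leq_runmax; exact: ltnW.
by exists p, t; split=> // n x Bx; exact: tP Bx.
Qed.

Lemma H_null_Smz : H_null S -> Smz X.
Proof.
move=> XH h; pose H j := runmax h (2 ^ j.+1).
have [|||A [a [EA Aa ad as_]]] := @dimH_cover R _ (range (prefixes (X := X) H)) 1 (2^-1 ^+ 2).
- by rewrite (XH _ _ (@prefixes_unif_continuous R X H)) lte_fin.
- by [].
- by rewrite exprn_gt0// invr_gt0.
(* The added term makes the weights positive and larger than the diameters; the total is at most 1/4
   + 1/4. *)
pose b n := a n + 2^-1 ^+ (3 + n).
have ab n : a n < b n by rewrite ltrDl exprn_gt0// invr_gt0.
have [|N|n x y Ax Ay|p [t [_ tP]]] := @weights_words h (fun n => prefixes H @^-1` A n) b.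
- by move=> n; apply: le_lt_trans (ab n); have /andP[] := ad n.
- rewrite big_split/=; have := geometric_sum_le R 3 N; have := as_ N.
  by rewrite !exprS expr0; lra.
- by apply: le_lt_trans (ab n); rewrite -lee_fin; apply: le_trans (Aa n); exact: mdist_le_diam.
exists t => x /(set_typeP R)[q <-]; have [|n _ An] := EA (prefixes H q); first by exists q.
by exists (p n); exact: tP.
Qed.

Lemma Smz_H_null : Smz X -> H_null S.
Proof.
move=> XS Y f fU; apply/eqP; rewrite eq_le dimH_ge0 andbT.
apply/lee_addgt0Pr => s s0; rewrite add0e; apply: ereal_inf_lbound; exists s => //; split=> //.
apply: hausdorff_measure_eq0 => // d e d0 e0.
pose a n := Num.min d ((e * 2^-1 ^+ n.+1) `^ s^-1).
have e0' n : 0 < e * 2^-1 ^+ n.+1 by rewrite mulr_gt0// exprn_gt0// invr_gt0.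
have a0 n : 0 < a n by rewrite lt_min d0 powR_gt0.
have [h hf] := unif_continuous_modulus fU a0.
have [t tP] := XS h.
exists (fun k => f @` [set q | agree (h k) (set_val q) (t k)]), a; split.
- move=> _ [q _ <-]; have [k kt] := tP _ (set_valP q).
  by exists k => //; exists q.
- move=> n; apply: diam_le; first exact: ltW.
  move=> _ _ [q qt <-] [q' q't <-]; apply/ltW/hf; apply: agree_trans qt _; exact: agree_sym.
- by move=> n; rewrite ltW//= ge_min lexx.
- move=> n; apply: le_trans (_ : (((e * 2^-1 ^+ n.+1) `^ s^-1) `^ s) <= _).
    apply: ge0_ler_powR; rewrite ?nnegrE ?powR_ge0 ?(ltW s0) ?(ltW (a0 n))//.
    by rewrite ge_min lexx orbT.
  by rewrite -powRrM mulVf ?gt_eqF// powRr1// ltW.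
Qed.

End strong_measure_zero.

(** * Completion of a metric space *)

(* The points of the completion of E are the uniform limits of the functions
   mdist x, with the distance of uniform convergence. *)
Definition metric_completion (R : realType) (E : metricType R) : Type :=
  {phi : E -> R | forall e : R, 0 < e -> exists x, forall y, `|phi y - mdist x y| <= e}.

HB.instance Definition _ (R : realType) (E : metricType R) :=
  gen_eqMixin (metric_completion E).
HB.instance Definition _ (R : realType) (E : metricType R) :=
  gen_choiceMixin (metric_completion E).

Section completion.
Variables (R : realType) (E : metricType R).
Implicit Types phi psi : metric_completion E.

Definition completion_dist phi psi : R := sup (range (fun y => `|sval phi y - sval psi y|)).

Let dist_has_sup phi psi : has_sup (range (fun y => `|sval phi y - sval psi y|)).
Proof.
case: phi psi => phi phiP [psi psiP] /=.
have [x xP] := phiP 1 ltr01; have [x' x'P] := psiP 1 ltr01.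
split; first by exists `|phi x - psi x|, x.
exists (1 + mdist x x' + 1) => _ [y _ <-].
have := xP y; have := x'P y; rewrite !ler_norml => /andP[h1 h2] /andP[h3 h4].
have := metric_triangle x x' y; have := metric_triangle x' x y.
by rewrite (metric_sym x' x) => h5 h6; apply/andP; split; lra.
Qed.

Let dist_ub phi psi y : `|sval phi y - sval psi y| <= completion_dist phi psi.
Proof. by apply: ub_le_sup; [exact: (dist_has_sup _ _).2|exists y]. Qed.

Let dist_le phi psi c : (forall y, `|sval phi y - sval psi y| <= c) ->
  completion_dist phi psi <= c.
Proof.
by move=> H; apply: ge_sup; [exact: (dist_has_sup _ _).1|move=> _ [y _ <-]; exact: H].
Qed.

Let point_of phi : E.
Proof. by have [x _] := cid (svalP phi 1 ltr01); exact: x. Qed.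

Let dxx phi : completion_dist phi phi = 0.
Proof.
apply/eqP; rewrite eq_le; apply/andP; split.
  by apply: dist_le => y; rewrite subrr normr0.
exact: le_trans (normr_ge0 _) (dist_ub phi phi (point_of phi)).
Qed.

Let d0 phi psi : completion_dist phi psi = 0 -> phi = psi.
Proof.
move=> d; have : sval phi = sval psi.
  apply/funext => y; apply/eqP; rewrite -subr_eq0 -normr_le0.
  by apply: le_trans (dist_ub _ _ y) _; rewrite d.
case: phi psi {d} => phi phiP [psi psiP] /= E'; rewrite E' in phiP *.
by congr exist; exact: Prop_irrelevance.
Qed.

Let dC phi psi : completion_dist phi psi = completion_dist psi phi.
Proof. by congr sup; congr image; apply/funext => y; rewrite distrC. Qed.

Let d_triangle psi phi xi :
  completion_dist phi xi <= completion_dist phi psi + completion_dist psi xi.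
Proof.
apply: dist_le => y; rewrite -(subrKA (sval psi y)).
by apply: le_trans (ler_normD _ _) _; rewrite lerD.
Qed.

HB.instance Definition _ := isMetric.Build R (metric_completion E) dxx d0 dC d_triangle.

Lemma completion_embed_subproof (x : E) (e : R) : 0 < e ->
  exists x' : E, forall y, `|mdist x y - mdist x' y| <= e.
Proof. by move=> e0; exists x => y; rewrite subrr normr0 ltW. Qed.

Definition completion_embed x : metric_completion E := exist _ _ (completion_embed_subproof x).

Lemma completion_approx phi (e : R) : 0 < e -> exists x, mdist phi (completion_embed x) <= e.
Proof. by move=> e0; have [x xP] := svalP phi e e0; exists x; exact: dist_le. Qed.

Lemma completion_isometry x y : mdist (completion_embed x) (completion_embed y) = mdist x y.
Proof.
apply/eqP; rewrite eq_le; apply/andP; split.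
  apply: dist_le => z /=; rewrite ler_norml.
  have := metric_triangle x y z; have := metric_triangle y x z.
  by rewrite (metric_sym y x) => h1 h2; apply/andP; split; lra.
have := dist_ub (completion_embed x) (completion_embed y) y.
by rewrite /= mdistxx subr0 ger0_norm// mdist_ge0.
Qed.

Lemma completion_dense : dense (range completion_embed).
Proof.
move=> O [phi Ophi] Oop; have /nbhs_ballP[e /= e0 eO] := open_nbhs_nbhs (conj Oop Ophi).
have [|x xP] := @completion_approx phi (e / 2); first by rewrite divr_gt0.
exists (completion_embed x); split; last by exists x.
apply: eO; rewrite ballEmdist/=; apply: le_lt_trans xP _.
by rewrite ltr_pdivrMr// ltr_pMr// ltr1n.
Qed.

Lemma completion_complete : complete_space (metric_completion E).
Proof.
move=> F FF /cauchyP Fc.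
have /choice[p pP] : forall n, exists p : metric_completion E, F (ball p (2^-1 ^+ n)).
  by move=> n; apply: Fc; rewrite exprn_gt0// invr_gt0.
have pd m n y : sval (p m) y - 2^-1 ^+ m <= sval (p n) y + 2^-1 ^+ n.
  have [q []] := filter_ex (filterI (pP m) (pP n)).
  rewrite !ballEmdist/= => mq nq.
  have := le_lt_trans (dist_ub _ _ y) mq; have := le_lt_trans (dist_ub _ _ y) nq.
  by rewrite !ltr_norml => /andP[h1 h2] /andP[h3 h4]; lra.
pose phi y := sup (range (fun n => sval (p n) y - 2^-1 ^+ n)).
have phi_hs y : has_sup (range (fun n => sval (p n) y - 2^-1 ^+ n)).
  split; first by exists (sval (p 0%N) y - 2^-1 ^+ 0), 0%N.
  by exists (sval (p 0%N) y + 2^-1 ^+ 0) => _ [n _ <-].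
have phiP n y : `|phi y - sval (p n) y| <= 2^-1 ^+ n.
  have h1 : sval (p n) y - 2^-1 ^+ n <= phi y.
    by apply: ub_le_sup; [exact: (phi_hs y).2|exists n].
  have h2 : phi y <= sval (p n) y + 2^-1 ^+ n.
    by apply: ge_sup; [exact: (phi_hs y).1|move=> _ [m _ <-]].
  by rewrite ler_norml; apply/andP; split; lra.
have phiK (e : R) : 0 < e -> exists x, forall y, `|phi y - mdist x y| <= e.
  move=> e0; have e2 : 0 < e / 2 by rewrite divr_gt0.
  have [n ne] := half_expr_lt e2; have [x xP] := svalP (p n) _ e2.
  exists x => y; rewrite -(subrKA (sval (p n) y)) (splitr e).
  apply: le_trans (ler_normD _ _) _; rewrite lerD//.
  exact: le_trans (phiP n y) (ltW ne).
exists (exist _ phi phiK) => A /nbhs_ballP[e /= e0 eA].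
have e2 : 0 < e / 2 by rewrite divr_gt0.
have [n ne] := half_expr_lt e2; apply: filterS (pP n) => q; rewrite ballEmdist/= => nq.
apply: eA; rewrite ballEmdist/=; apply: le_lt_trans (metric_triangle _ (p n) _) _.
rewrite (splitr e); apply: ler_ltD; last exact: lt_trans ne.
by apply: le_trans (ltW ne); apply: dist_le => y; exact: phiP.
Qed.

Lemma completionP : is_completion completion_embed.
Proof.
by split; [exact: completion_complete|exact: completion_isometry|exact: completion_dense].
Qed.

End completion.

Section totally_bounded.
Variables (R : realType) (Z : metricType R).

Lemma mdist_closure_le (A : set Z) (e : R) : (forall y z, A y -> A z -> mdist y z <= e) ->
  forall y z, closure A y -> closure A z -> mdist y z <= e.
Proof.
move=> Ae y z Ay Az; apply/ler_addgt0Pr => d d0; have d2 : 0 < d / 2 by rewrite divr_gt0.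
have [y' [Ay' yy']] := Ay _ (nbhsx_ballx y _ d2).
have [z' [Az' zz']] := Az _ (nbhsx_ballx z _ d2).
rewrite !ballEmdist/= in yy' zz'.
apply: le_trans (metric_triangle _ y' _) _.
apply: le_trans (lerD (ltW yy') (metric_triangle _ z' _)) _.
rewrite (metric_sym z' z); have := Ae _ _ Ay' Az'; lra.
Qed.

Lemma ultra_bigcup (F : set_system Z) (n : nat) (B : nat -> set Z) : UltraFilter F ->
  F (\bigcup_(i < n) B i) -> exists2 i, (i < n)%N & F (B i).
Proof.
move=> FU; elim: n => [|n IH] FB.
  have [z [i]] := filter_ex FB; by [].
have [Fn|Fn] := in_ultra_setVsetC (B n) FU; first by exists n.
have [|i ilt Fi] := IH; last by exists i => //; exact: ltnW.
apply: filterS (filterI FB Fn) => z [[i /= ilt Bi] nBn]; exists i => //=.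
by rewrite ltn_neqAle -ltnS ilt andbT; apply/eqP => ein; apply: nBn; rewrite -ein.
Qed.

(** An ultrafilter on the closure contains the closure of one of finitely many small sets, so it is
    Cauchy. *)
Lemma totally_bounded_compact (A : set Z) : complete_space Z ->
  (forall e : R, 0 < e -> exists n (B : nat -> set Z), A `<=` \bigcup_(i < n) B i /\
     forall i y z, (i < n)%N -> B i y -> B i z -> mdist y z <= e) ->
  compact (closure A).
Proof.
move=> Zc At; rewrite compact_ultra => F FU FA.
have Fc : cauchy F.
  apply/cauchyP => e e0; have e2 : 0 < e / 2 by rewrite divr_gt0.
  have [n [B [AB Be]]] := At _ e2.
  have : F (\bigcup_(i < n) closure (B i)).
    apply: filterS FA; rewrite [X in _ `<=` X](closure_id _).1.
      by apply: closureS => z /AB[i ilt Bz]; exists i => //; exact: subset_closure.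
    by apply: closed_bigcup => [|i _]; [exact: finite_II|exact: closed_closure].
  move=> /ultra_bigcup[i ilt Fi]; have [z Bz] := filter_ex Fi; exists z.
  apply: filterS Fi => w Bw; rewrite ballEmdist/=.
  apply: le_lt_trans (mdist_closure_le (fun y z => Be i y z ilt) Bz Bw) _.
  by rewrite ltr_pdivrMr// ltr_pMr// ltr1n.
have [z Fz] := Zc F _ Fc; exists z; split=> // U /nbhs_interior Uz.
have [w [Aw Uw]] := filter_ex (filterI FA (Fz _ Uz)).
by apply: Aw; rewrite /interior/= in Uw.
Qed.

End totally_bounded.

(** * Upper Hausdorff dimension *)

Section upper_hausdorff.
Variables (R : realType) (X : set cantor).
Local Notation S := (set_type X : metricType R).

Let to_range (Y : metricType R) (f : S -> Y) (p : S) : set_type (range f) :=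
  exist _ (f p) (mem_set (imageT f p)).

Lemma upper_dimH_ge0 (Y : metricType R) (E : set Y) : (0 <= upper_dimH E)%E.
Proof. by apply: le_ereal_inf_tmp => _ [Z [i [K [_ _ _ ->]]]]; exact: dimH_ge0. Qed.

(** Images of pieces are totally bounded, so their closures in the completion are compact. The
    coverings pass to these closures because each block of indices is finite: the closure of a
    finite union is the union of the closures. *)
Lemma Ssharp_upper_H_null : Ssharp X -> upper_H_null S.
Proof.
move=> XS Y f fU; apply/eqP; rewrite eq_le upper_dimH_ge0 andbT.
apply/lee_addgt0Pr => s s0; rewrite add0e.
pose g p : metric_completion (set_type (range f)) := completion_embed (to_range f p).
have gd p q : mdist (g p) (g q) = mdist (f p) (f q) by rewrite completion_isometry.
pose a k : R := (2^-1 ^+ k) `^ s^-1.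
have a0 k : 0 < a k by rewrite powR_gt0// exprn_gt0// invr_gt0.
have [h hf] := unif_continuous_modulus fU a0.
have [t [u [uS tu]]] := Ssharp_groups XS h.
pose W k := [set p : S | agree (h k) (set_val p) (t k)].
pose Xn n := [set p : S | forall m, (n <= m)%N -> exists2 k, (u m <= k < u m.+1)%N & W k p].
pose K := \bigcup_n closure (g @` Xn n).
have Kcpt n : compact (closure (g @` Xn n)).
  apply: totally_bounded_compact => [|e e0]; first exact: completion_complete.
  have [h' h'f] := unif_continuous_modulus fU (fun _ : nat => e0).
  have [z zP] := covered_words (h' 0%N) setT.
  exists (2 ^ h' 0)%N, (fun i => g @` [set p | agree (h' 0%N) (set_val p) (z i)]); split.
    by move=> _ [p _ <-]; have [i ilt pz] := zP (set_val p) I; exists i => //; exists p.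
  move=> i _ _ _ [p pz <-] [q qz <-]; rewrite gd; apply/ltW/(h'f 0%N).
  by apply: agree_trans pz _; exact: agree_sym.
apply: (@le_trans _ _ (dimH K)).
  apply: ereal_inf_lbound.
  exists (metric_completion (set_type (range f))), (@completion_embed _ _), K; split=> //.
  - exact: completionP.
  - by exists (fun n => closure (g @` Xn n)).
  - move=> _ [y _ <-]; have [p _ py] := set_valP y.
    have -> : y = to_range f p by exact: val_inj.
    have [n nP] := tu _ (set_valP p); exists n => //; apply: subset_closure.
    by exists p.
apply: ereal_inf_lbound; exists s => //; split=> //.
apply: hausdorff_measure_eq0 => // d e d0 e0.
(* The bound d^s keeps the diameters below d; the bound e/2 gives a(N+k)^s <= e 2^(-k-1). *)
have [N Nde] : exists N, 2^-1 ^+ N < Num.min (d `^ s) (e / 2).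
  by apply: half_expr_lt; rewrite lt_min powR_gt0// divr_gt0.
have N_le k : (2^-1 : R) ^+ (N + k) <= 2^-1 ^+ N.
  by rewrite ler_iXn2l ?invr_gt0 ?invf_lt1 ?ltr1n// leq_addr.
have s0' : 0 <= s^-1 by rewrite invr_ge0 ltW.
exists (fun k => closure (g @` W (N + k)%N)), (fun k => a (N + k)%N); split.
- move=> z [n _ nz]; pose m := maxn n N.
  have : closure (\bigcup_(k in `I_(u m.+1) `\` `I_(u m)) g @` W k) z.
    apply: closureS nz => _ [p pX <-].
    have [k /andP[uk ku] Wk] := pX m (leq_maxl _ _); exists k; last by exists p.
    by split=> //=; apply/negP; rewrite -leqNgt.
  have /closureS : \bigcup_(k in `I_(u m.+1) `\` `I_(u m)) g @` W k `<=`
      \bigcup_(k in `I_(u m.+1) `\` `I_(u m)) closure (g @` W k).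
    by move=> w [k km Wk]; exists k => //; exact: subset_closure.
  move=> /[apply]; rewrite -(closure_id _).1; last first.
    apply: closed_bigcup => [|k _]; last exact: closed_closure.
    exact: finite_setD (finite_II _).
  move=> [k [/= ku /negP]]; rewrite -leqNgt => uk Wk.
  have Nk : (N <= k)%N by have := increasing_ge uS m; lia.
  by exists (k - N)%N => //; rewrite subnKC.
- move=> k; apply: diam_le; first exact: ltW.
  apply: mdist_closure_le => _ _ [p pW <-] [q qW <-]; rewrite gd; apply/ltW/hf.
  by apply: agree_trans pW _; exact: agree_sym.
- move=> k; rewrite ltW//=.
  apply: le_trans (_ : (d `^ s) `^ s^-1 <= _); last first.
    by rewrite -powRrM mulfV ?gt_eqF// powRr1// ltW.
  apply: ge0_ler_powR; rewrite ?nnegrE ?powR_ge0 ?exprn_ge0 ?invr_ge0 ?(ltW s0)//.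
  by apply: le_trans (N_le k) _; move: Nde; rewrite lt_min => /andP[/ltW].
- move=> k; rewrite -powRrM mulVf ?gt_eqF// powRr1 ?exprn_ge0 ?invr_ge0//.
  rewrite exprD exprS mulrA ler_wpM2r ?exprn_ge0 ?invr_ge0//.
  by move: Nde; rewrite lt_min => /andP[_ /ltW].
Qed.

(** A fine covering of [K] is fattened into open sets, finitely many of which cover the compact set
    [C m]: this bounds the indices from above, while weights below 2^(-a) keep them at least [a]. *)
Lemma upper_H_null_Ssharp : upper_H_null S -> Ssharp X.
Proof.
move=> XH h; pose H j := runmax h (2 ^ j.+1).
have := XH _ _ (@prefixes_unif_continuous R X H).
have /[swap] : (0 < 1 :> \bar R)%E by rewrite lte_fin.
move=> <- /ereal_inf_lt[_ [Z [i [K [[_ iso _] [C [Ccpt KC]] iK ->]]]] K1].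
pose g p := i (to_range (prefixes H) p).
have gd p q : mdist (g p) (g q) = mdist (prefixes H p) (prefixes H q) by rewrite iso.
exists (fun m => [set x | exists p : S, set_val p = x /\ C m (g p)]); split.
  move=> x /(set_typeP R)[p <-]; have : K (g p) by apply: iK; exists (to_range (prefixes H) p).
  by rewrite KC => -[m _ Cm]; exists m => //; exists p.
move=> m a.
have X0 n : 0 < (2^-1 : R) ^+ n by rewrite exprn_gt0// invr_gt0.
have [A [r [KA Ar rd rs]]] := dimH_cover K1 (X0 a.+2) (X0 2%N).
pose eta n : R := 2^-1 ^+ (a + 5 + n).
pose U n := [set z | exists2 y, A n y & mdist y z < eta n].
have [||N CN] := @compact_nat_cover _ (C m) U (Ccpt m).
- move=> n; rewrite openE => z [y Ay yz]; apply/nbhs_ballP.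
  exists (eta n - mdist y z); first by rewrite /= subr_gt0.
  move=> w; rewrite ballEmdist/= => zw; exists y => //.
  by apply: le_lt_trans (metric_triangle _ z _) _; rewrite addrC -ltrBrDr.
- move=> z Cz; have [n _ Az] : (\bigcup_n A n) z by apply: KA; rewrite KC; exists m.
  by exists n => //; exists z => //; rewrite mdistxx X0.
(* Distances within [U n] are at most r + 2 eta, and the third eta makes the bound strict. The total
   is at most 1/4 + 6/32 < 1/2, and each weight at most (1/4 + 3/32) 2^(-a). *)
pose b n := r n + 3 * eta n.
have eta5 n : eta n <= 2^-1 ^+ a * 2^-1 ^+ 5.
  by rewrite -exprD ler_iXn2l ?invr_gt0 ?invf_lt1 ?ltr1n// leq_addr.
have [n|N'|n x y [x' Ax xx'] [y' Ay yy']|p [t [ap tP]]] :=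
  @weights_words R X h (fun n => g @^-1` U n) b.
- by have /andP[r0 _] := rd n; rewrite /b ltr_wpDl// mulr_gt0// X0.
- rewrite big_split/= -mulr_sumr.
  have := geometric_sum_le R (a + 5) N'; have := rs N'; rewrite exprD.
  have : (2^-1 : R) ^+ a <= 1 by apply: exprn_ile1; rewrite ?invr_ge0// invf_le1 ?ler1n.
  by rewrite !exprS expr0; nra.
- rewrite -/H -gd; apply: le_lt_trans (metric_triangle _ x' _) _.
  have x'y' : mdist x' y' <= r n by rewrite -lee_fin; apply: le_trans (Ar n); exact: mdist_le_diam.
  have := metric_triangle x' y' (g y); rewrite (metric_sym (g x)).
  by have := X0 (a + 5 + n)%N; rewrite /b -/(eta n); lra.
exists (\max_(n < N) p n).+1, t => _ [q [<- /CN[n /= nN Un]]].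
exists (p n); last exact: tP.
rewrite ltnS (@leq_bigmax _ (fun n : 'I_N => p n) (Ordinal nN)) andbT.
apply: ap; have /andP[_] := rd n; have := eta5 n; rewrite /b !exprS expr0.
by have := X0 a; lra.
Qed.

End upper_hausdorff.

Theorem theorem1p1 (R : realType) (X : set cantor_space) :
  let S : metricType R := set_type X in
  [/\ P_null S <-> additive_for (ideal_N R) X,
      directed_P_null S <-> T'_set X,
      (upper_H_null S <-> additive_for ideal_M X) /\
      (additive_for ideal_M X <-> additive_for (ideal_E R) X) &
      H_null S <-> strongly_null X] /\
  [/\ P_null S -> directed_P_null S,
      directed_P_null S -> upper_H_null S &
      upper_H_null S -> H_null S] /\
  [/\ additive_for (ideal_N R) X -> T'_set X,
      T'_set X -> additive_for ideal_M X &
      additive_for ideal_M X -> strongly_null X].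
Proof.
move=> S.
have PN : P_null S <-> Pstar X by split; [exact: P_null_Pstar|exact: Pstar_P_null].
have NP : additive_for (ideal_N R) X <-> Pstar X.
  by split; [exact: null_additive_Pstar|exact: Pstar_null_additive].
have dP : directed_P_null S <-> dPstar X.
  by split; [exact: directed_P_null_dPstar|exact: dPstar_directed_P_null].
have T' : T'_set X <-> dPstar X by split; [exact: T'_dPstar|exact: dPstar_T'].
have uH : upper_H_null S <-> Ssharp X.
  by split; [exact: upper_H_null_Ssharp|exact: Ssharp_upper_H_null].
have M : additive_for ideal_M X <-> Ssharp X.
  by split; [exact: (meager_additive_Ssharp R)|exact: (Ssharp_meager_additive R)].
have E : additive_for (ideal_E R) X <-> Ssharp X.
  by split; [exact: closed_null_additive_Ssharp|exact: Ssharp_closed_null_additive].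
have Hn : H_null S <-> Smz X by split; [exact: H_null_Smz|exact: Smz_H_null].
have sn : strongly_null X <-> Smz X.
  by split; [exact: (strongly_null_Smz R)|exact: (Smz_strongly_null R)].
have i1 := @Pstar_dPstar X; have i2 := @dPstar_Ssharp X; have i3 := @Ssharp_Smz X.
split; [|split]; split.
- exact: iff_trans PN (iff_sym NP).
- exact: iff_trans dP (iff_sym T').
- by split; [exact: iff_trans uH (iff_sym M)|exact: iff_trans M (iff_sym E)].
- exact: iff_trans Hn (iff_sym sn).
- by move=> H; exact/dP.2/i1/PN.1.
- by move=> H; exact/uH.2/i2/dP.1.
- by move=> H; exact/Hn.2/i3/uH.1.
- by move=> H; exact/T'.2/i1/NP.1.
- by move=> H; exact/M.2/i2/T'.1.
- by move=> H; exact/sn.2/i3/M.1.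
Qed.
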